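(* Let $\sigma>1$. Then there exists an orthonormal wavelet $\psi\in C^\infty(\mathbb{R})$ such that $\widehat{\psi}\in\mathcal{D}_\sigma(\mathbb{R})$.
   Context: Fourier transform: $\widehat f(\xi)=\int_{\mathbb{R}}f(x)e^{ix\xi}\,dx$ for $f\in L^1(\mathbb{R})$, extended to $L^2(\mathbb{R})$ in the standard way. Orthonormal wavelet: $\psi\in L^2(\mathbb{R})$ is an orthonormal wavelet if $\{\psi_{m,n}: m,n\in\mathbb{Z}\}$ is an orthonormal basis of $L^2(\mathbb{R})$, where $\psi_{m,n}(x)=2^{m/2}\psi(2^mx-n)$. Extended Gevrey classes: let $\mathbb{N}_0=\{0,1,2,\dots\}$; for $\tau>0$, $\sigma>1$ put $M^{\tau,\sigma}_0=1$ and $M^{\tau,\sigma}_p=p^{\tau p^\sigma}$ for $p\ge1$. The Roumieu class $\mathcal{E}_{\{\tau,\sigma\}}(\mathbb{R})$ is the set of $\phi\in C^\infty(\mathbb{R})$ such that for every compact $K\subset\mathbb{R}$ there are $C_K>0$ and $h>0$ with $|\phi^{(p)}(x)|\le C_K h^{p^\sigma}M^{\tau,\sigma}_p$ for all $x\in K$, $p\in\mathbb{N}_0$. The Beurling class $\mathcal{E}_{(\tau,\sigma)}(\mathbb{R})$ is the set of $\phi\in C^\infty(\mathbb{R})$ such that for every compact $K\subset\mathbb{R}$ and every $h>0$ there is $C_{K,h}>0$ with $|\phi^{(p)}(x)|\le C_{K,h}h^{p^\sigma}M^{\tau,\sigma}_p$ for all $x\in K$, $p\in\mathbb{N}_0$.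 $\mathcal{E}_{\tau,\sigma}(\mathbb{R})$ denotes either of these, $\mathcal{D}_{\tau,\sigma}(\mathbb{R})$ is the set of compactly supported functions in $\mathcal{E}_{\tau,\sigma}(\mathbb{R})$, and $\mathcal{D}_\sigma(\mathbb{R})=\bigcap_{\tau>0}\mathcal{D}_{\tau,\sigma}(\mathbb{R})$ (the Roumieu and Beurling versions give the same intersection). *)

(* Defs.v *)
From HB Require Import structures.
From mathcomp Require Export all_boot all_order all_algebra.
From mathcomp Require Export all_classical all_reals all_analysis.
From mathcomp Require Export complex.

Set Implicit Arguments.
Unset Strict Implicit.
Unset Printing Implicit Defensive.

Import Order.TTheory GRing.Theory Num.Theory.
Import numFieldNormedType.Exports.

Local Open Scope classical_set_scope.
Local Open Scope ring_scope.
Local Open Scope complex_scope.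

Section ComplexFunctions.
Context {R : realType}.
Implicit Types (f g : R -> R[i]) (x : R).

Definition fRe f : R -> R := fun x => complex.Re (f x).
Definition fIm f : R -> R := fun x => complex.Im (f x).

Definition cmeasurable f :=
  measurable_fun [set: R] (fRe f) /\ measurable_fun [set: R] (fIm f).

Definition cint f : R[i] :=
  Rintegral (@lebesgue_measure R) [set: R] (fRe f) +i*
  Rintegral (@lebesgue_measure R) [set: R] (fIm f).

Definition cnorm (p : \bar R) f : \bar R :=
  Lnorm (@lebesgue_measure R) p (fun x => (Normc.normc (f x))%:E).

(* Functions representing an element of L^p; two of them represent the same
   element when they are equal almost everywhere. *)
Definition inLp (p : \bar R) f := cmeasurable f /\ (cnorm p f < +oo)%E.

Definition inner f g : R[i] := cint (fun x => f x * (g x)^*).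

Definition cvgL2 (f_ : nat -> R -> R[i]) f :=
  cnorm 2%:E (fun x => f_ k x - f x) @[k --> \oo] --> 0%E.

Definition fourier f : R -> R[i] :=
  fun xi => cint (fun x => f x * (cos (x * xi) +i* sin (x * xi))).

(* g represents the Fourier transform of f in L^2: the continuous extension of
   [fourier] from L^1 `&` L^2, i.e. the closure of its graph in L^2 x L^2. *)
Definition fourierL2 f g :=
  [/\ inLp 2%:E f, inLp 2%:E g &
    exists f_ : nat -> R -> R[i],
      [/\ forall k, inLp 1%:E (f_ k) /\ inLp 2%:E (f_ k),
          cvgL2 f_ f &
          cvgL2 (fun k => fourier (f_ k)) g]].

Definition orthonormalL2 (I : eqType) (e : I -> R -> R[i]) :=
  (forall i, inLp 2%:E (e i)) /\
  (forall i j, inner (e i) (e j) = (i == j)%:R).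

Definition totalL2 (I : eqType) (e : I -> R -> R[i]) :=
  forall f, inLp 2%:E f -> forall eps : R, 0 < eps ->
  exists (s : seq I) (c : I -> R[i]),
    (cnorm 2%:E (fun x => f x - \sum_(i <- s) c i * e i x)%R < eps%:E)%E.

Definition orthonormal_basisL2 (I : eqType) (e : I -> R -> R[i]) :=
  orthonormalL2 e /\ totalL2 e.

Definition wavelet_system (psi : R -> R[i]) (mn : int * int) : R -> R[i] :=
  fun x => (2 `^ (mn.1%:~R / 2))%:C * psi (2 ^ mn.1 * x - mn.2%:~R).

Definition orthonormal_wavelet (psi : R -> R[i]) :=
  inLp 2%:E psi /\ orthonormal_basisL2 (wavelet_system psi).

(* R[i] carries no normed-module structure over R in the library, so a function
   R -> R[i] is differentiated componentwise. *)
Definition cderiv (p : nat) f : R -> R[i] :=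
  fun x => derive1n p (fRe f) x +i* derive1n p (fIm f) x.

Definition csmooth f := forall (p : nat) x,
  derivable (derive1n p (fRe f)) x 1 /\ derivable (derive1n p (fIm f)) x 1.

Definition gevreyM (tau sigma : R) (p : nat) : R :=
  if p is 0 then 1 else p%:R `^ (tau * p%:R `^ sigma).

Definition gevrey_bound (tau sigma : R) f (K : set R) (C h : R) :=
  forall x (p : nat), K x ->
    Normc.normc (cderiv p f x)
      <= C * h `^ (p%:R `^ sigma) * gevreyM tau sigma p.

Inductive gevrey_type := Roumieu | Beurling.

Definition gevreyE (k : gevrey_type) (tau sigma : R) f :=
  csmooth f /\
  forall K : set R, compact K ->
  match k with
  | Roumieu => exists C h : R, [/\ 0 < C, 0 < h & gevrey_bound tau sigma f K C h]
  | Beurling => forall h : R, 0 < h ->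
      exists2 C : R, 0 < C & gevrey_bound tau sigma f K C h
  end.

Definition gevreyD (k : gevrey_type) (tau sigma : R) f :=
  gevreyE k tau sigma f /\ compact (closure [set x | f x != 0]).

Definition gevreyDsigma (k : gevrey_type) (sigma : R) f :=
  forall tau : R, 0 < tau -> gevreyD k tau sigma f.

End ComplexFunctions.

(* Main.v *)
Require Import Defs.
From mathcomp Require Import measurable_realfun.
From mathcomp Require Import ring lra zify.

(* [psi] is a Meyer wavelet: [psihat x = bell x * e^(ix/2)], where [bell] is built
   from an even window [w] supported in [|x| <= 4 pi / 3] with
   [w x ^ 2 + w (2 pi - x) ^ 2 = 1] on [0, 2 pi].

   - Orthonormal basis.  Plancherel and Poisson summation are only needed for
     Lipschitz functions of compact support.  On the Fourier side, Poisson
     summation writes the sum over [n] of [|<H, psi_(m,n)>|^2] as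
     [2 pi (Z_(m+1) - Z_m)], where [Z_m -> |H|^2] as [m -> +oo] and [Z_m -> 0] as
     [m -> -oo].  The system is thus a Parseval frame, and a Parseval frame of
     unit vectors is orthonormal; totality follows by density.
   - Regularity.  [w] is a product of two affine reparametrisations of
     [sin (c * B)], where [B] is a primitive of the bump
     [exp (- 1 / x) * exp (- 1 / (1 - x))].  All these functions have p-th
     derivatives at most [C A^p m^p m!] with [m = j + 2p] and constants
     [A], [C], [j], hence at most [C p^(9p)] for large [p], which is
     below [C h^(p^sigma) p^(tau p^sigma)] for every [tau, h > 0] since
     [sigma > 1]. *)

Set Implicit Arguments.
Unset Strict Implicit.
Unset Printing Implicit Defensive.

Import Order.TTheory GRing.Theory Num.Theory.
Import numFieldNormedType.Exports.
Import complex.ComplexField.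

Local Open Scope classical_set_scope.
Local Open Scope ring_scope.
Local Open Scope complex_scope.

(** Fourier inversion is never proved. One tool replaces it: Poisson summation for the
    autocorrelation of [G], whose Fourier transform is [|fourier G|^2] and whose value at 0 is the
    squared norm of [G]. A sum of [|fourier G|^2] over shifted integers is then a finite sum of
    values at the points [2 pi j]. Integrating over the shift gives Plancherel; taking one dyadic
    level gives the frame identity.

    At scale [a] only [j = 0, +-1, +-2] survive. The phase [e^(ix/2)] gives the terms [+-1] the sign
    -1 and the terms [+-2] the sign +1, while the products of bells reduce to products of [w] at
    scale [a] and at scale [2 a] respectively. This is what makes the level a difference of two
    values of [Z]. Here [2 pi Z] is the energy of [H] along the translates of Meyer's scaling
    function, but no multiresolution analysis is built.

    The sine in the window makes two squares add up to 1 without taking a square root, which would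
    spoil the derivative bounds; and since sine and cosine reproduce each other under
    differentiation, no higher chain rule is needed. *)

Local Notation cj := (@conjc _).
Local Notation normc := (@Normc.normc _).

(** * Integration of real functions on the line *)

Section RealIntegral.
Context {R : realType}.
Local Notation mu := (@lebesgue_measure R).
Implicit Types (f g : R -> R) (a x M : R).

Definition rintable f := mu.-integrable [set: R] (EFin \o f).
Definition rint f : R := Rintegral mu [set: R] f.

Lemma rintableM f : rintable f -> measurable_fun [set: R] f.
Proof. by move=> /measurable_int /measurable_EFinP. Qed.

Lemma rintable_le f g : measurable_fun [set: R] f ->
  (forall x, `|f x| <= g x) -> rintable g -> rintable f.
Proof.
move=> mf fg ig; apply: le_integrable ig => //; first exact/measurable_EFinP.
by move=> x _ /=; rewrite lee_fin (le_trans (fg x))// ler_norm.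
Qed.

Lemma rintableD f g : rintable f -> rintable g -> rintable (fun x => f x + g x).
Proof. by move=> If Ig; have := integrableD measurableT If Ig. Qed.

Lemma rintableN f : rintable f -> rintable (fun x => - f x).
Proof. by move=> If; have := integrableN If. Qed.

Lemma rintableB f g : rintable f -> rintable g -> rintable (fun x => f x - g x).
Proof. by move=> If Ig; have := integrableB measurableT If Ig. Qed.

Lemma rintableZ a f : rintable f -> rintable (fun x => a * f x).
Proof. by move=> If; have := integrableZl measurableT a If. Qed.

Lemma rintable_norm f : rintable f -> rintable (fun x => `|f x|).
Proof. by move=> If; have := integrable_norm If. Qed.

Lemma rintable_sum (I : Type) (s : seq I) (F : I -> R -> R) :
  (forall i, rintable (F i)) -> rintable (fun x => \sum_(i <- s) F i x).
Proof.
move=> IF; elim: s => [|i s IHs].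
  by under eq_fun do rewrite big_nil; exact: integrable0.
by under eq_fun do rewrite big_cons; exact: rintableD.
Qed.

Lemma rintD f g : rintable f -> rintable g ->
  rint (fun x => f x + g x) = rint f + rint g.
Proof. by move=> If Ig; rewrite /rint RintegralD. Qed.

Lemma rintB f g : rintable f -> rintable g ->
  rint (fun x => f x - g x) = rint f - rint g.
Proof. by move=> If Ig; rewrite /rint RintegralB. Qed.

Lemma rintZ a f : rintable f -> rint (fun x => a * f x) = a * rint f.
Proof. by move=> If; rewrite /rint RintegralZl. Qed.

Lemma rintN f : rintable f -> rint (fun x => - f x) = - rint f.
Proof.
move=> If; rewrite -mulN1r -rintZ//.
by congr rint; apply/funext => x; rewrite mulN1r.
Qed.

Lemma rint0 : rint (fun=> 0) = 0.
Proof.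
rewrite /rint Rintegral_cst ?measurableT// mul0r//.
Qed.

Lemma rint_ge0 f : (forall x, 0 <= f x) -> 0 <= rint f.
Proof. by move=> f0; apply: Rintegral_ge0. Qed.

Lemma le_rint f g : rintable f -> rintable g -> (forall x, f x <= g x) ->
  rint f <= rint g.
Proof. by move=> If Ig fg; apply: le_Rintegral. Qed.

Lemma le_norm_rint f : rintable f -> `|rint f| <= rint (fun x => `|f x|).
Proof. by move=> If; apply: le_normr_Rintegral. Qed.

Lemma rint_sum (I : Type) (s : seq I) (F : I -> R -> R) :
  (forall i, rintable (F i)) ->
  rint (fun x => \sum_(i <- s) F i x) = \sum_(i <- s) rint (F i).
Proof.
move=> IF; elim: s => [|i s IHs].
  by under eq_fun do rewrite big_nil; rewrite big_nil rint0.
under eq_fun do rewrite big_cons.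
by rewrite big_cons -IHs rintD//; exact: rintable_sum.
Qed.

Lemma rintE f : rintable f -> (rint f)%:E = (\int[mu]_x (f x)%:E)%E.
Proof.
by move=> If; rewrite /rint /Rintegral fineK//; exact: integrable_fin_num.
Qed.

Lemma rintable_indic a b : rintable (\1_(`[a, b]%classic) : R -> R).
Proof. exact: integrable_indic_itv. Qed.

Lemma rintable_bsupp f M : measurable_fun [set: R] f ->
  (forall x, `|f x| <= M) -> (forall x, M < `|x| -> f x = 0) -> rintable f.
Proof.
move=> mf fM f0.
apply: (@rintable_le _ (fun x => M * \1_(`[- M, M]%classic) x)) => // [x|].
  rewrite indicE; case: (lerP `|x| M) => xM.
    by rewrite mem_set ?mulr1//= in_itv/= -ler_norml.
  rewrite f0// normr0 mulr_ge0//.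
  by rewrite (le_trans _ (fM x)).
by apply: rintableZ; exact: rintable_indic.
Qed.

(** Convergence is asked only almost everywhere because the Lebesgue differentiation theorem, on
    which the density argument rests, gives no more. *)
Lemma rint_dct_ae (f_ : nat -> R -> R) f g :
  (forall n, measurable_fun [set: R] (f_ n)) -> measurable_fun [set: R] f ->
  rintable g -> (forall n x, `|f_ n x| <= g x) ->
  {ae mu, forall x, f_ n x @[n --> \oo] --> f x} ->
  rintable f /\ rint (f_ n) @[n --> \oo] --> rint f.
Proof.
move=> mf mf' Ig fg ff.
have ff' : {ae mu, forall x, [set: R] x ->
    (fun n => (f_ n x)%:E) @ \oo --> (EFin \o f) x}.
  move: ff; apply: filterS; first exact: (ae_filter_ringOfSetsType mu).
  move=> x /= ff _; apply: (@cvg_EFin _ _ _ _ (fun n => (f_ n x)%:E)) => //.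
  exact: nearW.
have fg' : {ae mu, forall x n, [set: R] x ->
    (`|(f_ n x)%:E| <= (EFin \o g) x)%E}.
  by apply: aeW => y n _; rewrite /= lee_fin.
have [If _ cf] := @dominated_convergence _ _ _ mu _ measurableT
  (fun n x => (f_ n x)%:E) (EFin \o f) (EFin \o g)
  (fun n => (measurable_EFinP _ _).2 (mf n))
  ((measurable_EFinP _ _).2 mf') ff' Ig fg'.
split => //.
apply: fine_cvg; rewrite fineK; last exact: integrable_fin_num.
exact: cf.
Qed.

Lemma rint_dct (f_ : nat -> R -> R) f g :
  (forall n, measurable_fun [set: R] (f_ n)) -> rintable g ->
  (forall n x, `|f_ n x| <= g x) ->
  (forall x, f_ n x @[n --> \oo] --> f x) ->
  rintable f /\ rint (f_ n) @[n --> \oo] --> rint f.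
Proof.
move=> mf Ig fg ff; apply: rint_dct_ae Ig fg _ => //; last exact: aeW.
exact: (measurable_fun_cvg (fun n => mf n) (fun x _ => ff x)).
Qed.

End RealIntegral.

(** * Affine changes of variables *)

Section ChangeOfVariables.
Context {R : realType}.
Local Notation mu := (@lebesgue_measure R).
Implicit Types (f g : R -> R) (a b x M : R).

Lemma measurable_affine a b : measurable_fun [set: R] (fun x => a * x + b).
Proof.
apply: measurable_funD => //; exact: measurable_funM.
Qed.

(** Lebesgue measure is determined by the lengths of half-open intervals, and the push-forward under
    [a * x + b], scaled by [|a|], gives them the same lengths. A negative [a] exchanges the open and
    the closed end of the preimage. *)
Lemma ge0_integral_affine (f : R -> \bar R) a b : a != 0 ->
  measurable_fun [set: R] f -> (forall x, 0 <= f x)%E ->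
  (\int[mu]_x f x = `|a|%:E * \int[mu]_x f (a * x + b)%R)%E.
Proof.
move=> a0 mf f0.
pose phi := (fun x => a * x + b) : measurableTypeR R -> measurableTypeR R.
have mphi : measurable_fun [set: measurableTypeR R] phi by exact: measurable_affine.
have A0 : 0 <= `|a| by [].
have E : (\int[mu]_x f (a * x + b)%R = \int[pushforward mu phi]_x f x)%E.
  by rewrite ge0_integral_pushforward//= preimage_setT.
rewrite E -[`|a|]/((NngNum A0)%:num) -ge0_integral_mscale//.
apply: eq_measure_integral => A mA _; move: A mA.
apply: lebesgue_measure_unique => _ [[c d] _ <-].
rewrite /= /mscale /= /pushforward.
have an : a^-1 * a = 1 by rewrite mulVf.
have -> : phi @^-1` `]c, d] = if 0 < a then `]((c - b) / a), ((d - b) / a)]%classic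
    else `[((d - b) / a), ((c - b) / a)[%classic.
  apply/seteqP; split=> x /=; case: ifPn => ha; rewrite /= !in_itv/= /phi.
  - rewrite ltr_pdivrMr// ler_pdivlMr//; lra.
  - have a1 : a < 0 by rewrite lt_neqAle a0 leNgt.
    rewrite ltr_ndivlMr// ler_ndivrMr//; lra.
  - rewrite ltr_pdivrMr// ler_pdivlMr//; lra.
  - have a1 : a < 0 by rewrite lt_neqAle a0 leNgt.
    rewrite ltr_ndivlMr// ler_ndivrMr//; lra.
rewrite lebesgue_measure_itv/= lte_fin.
have [a1|a1] := ltP 0 a; rewrite lebesgue_measure_itv/= lte_fin.
  rewrite ltr_pM2r ?invr_gt0// ltrD2r.
  case: ifPn => _; last by rewrite mule0.
  rewrite -EFinB -EFinM gtr0_norm//; congr EFin; field.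
  by [].
have {}a1 : a < 0 by rewrite lt_neqAle a0.
rewrite ltr_nM2r ?invr_lt0// ltrD2r.
case: ifPn => _; last by rewrite mule0.
by rewrite -EFinB -EFinM ltr0_norm//; congr EFin; field.
Qed.

Lemma integral_comp_affine (f : R -> \bar R) a b : a != 0 ->
  measurable_fun [set: R] f -> (forall x, 0 <= f x)%E ->
  (\int[mu]_x f (a * x + b)%R = `|a|^-1%:E * \int[mu]_x f x)%E.
Proof.
move=> a0 mf f0; rewrite (@ge0_integral_affine f a b)// muleA -EFinM.
by rewrite mulVf ?normr_eq0// mul1e.
Qed.

Lemma rintable_affine f a b : a != 0 -> rintable f ->
  rintable (fun x => f (a * x + b)).
Proof.
move=> a0 If; have mf := rintableM If.
apply/integrableP; split.
  apply/measurable_EFinP; apply: (measurableT_comp mf); exact: measurable_affine.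
rewrite (@integral_comp_affine (fun x => `|(f x)%:E|)%E)//; last first.
  by apply: measurableT_comp => //; exact/measurable_EFinP.
by rewrite lte_mul_pinfty//; case/integrableP: If.
Qed.

(** The nonnegative case is applied to the positive and to the negative part of [f]. *)
Lemma rint_affine f a b : a != 0 -> rintable f ->
  rint (fun x => f (a * x + b)) = `|a|^-1 * rint f.
Proof.
move=> a0 If; apply: EFin_inj; rewrite EFinM.
have If' := rintable_affine b a0 If.
rewrite rintE// rintE// [LHS]integralE [X in (_ * X)%E]integralE.
have mf : measurable_fun [set: R] (EFin \o f) by exact: measurable_int If.
have Ep := @integral_comp_affine (EFin \o f)^\+%E a b a0.
have En := @integral_comp_affine (EFin \o f)^\-%E a b a0.
rewrite muleBr//; last first.
  rewrite fin_num_adde_defl//.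
  have := integrable_fin_num measurableT (integrable_funeneg measurableT If).
  by rewrite fin_numN.
congr (_ - _)%E.
- rewrite -Ep; [|exact: measurable_funepos|by []].
  by apply: eq_integral => x _; rewrite !unlock.
- rewrite -En; [|exact: measurable_funeneg|by []].
  by apply: eq_integral => x _; rewrite !unlock.
Qed.

Lemma rint_shift f b : rintable f -> rint (fun x => f (x + b)) = rint f.
Proof.
move=> If; have := @rint_affine f 1 b (oner_neq0 _) If.
by under eq_fun do rewrite mul1r; rewrite normr1 invr1 mul1r.
Qed.

Lemma rintable_shift f b : rintable f -> rintable (fun x => f (x + b)).
Proof.
move=> If; have := @rintable_affine f 1 b (oner_neq0 _) If.
by under eq_fun do rewrite mul1r.
Qed.

End ChangeOfVariables.

(** * Fubini for bounded functions supported in a square *)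

Section FubiniBox.
Context {R : realType}.
Local Notation mu := (@lebesgue_measure R).

Lemma rint_fubini (f : R * R -> R) (M : R) :
  measurable_fun [set: R * R] f -> (forall z, `|f z| <= M) ->
  (forall z, M < `|z.1| \/ M < `|z.2| -> f z = 0) ->
  rint (fun x => rint (fun y => f (x, y))) =
  rint (fun y => rint (fun x => f (x, y))).
Proof.
move=> mf fM f0.
have M0 : 0 <= M by rewrite (le_trans _ (fM (0, 0))).
(* [f] is dominated by [M] times the indicator of the square [[-M, M]^2], which has finite product
   measure. *)
have If : ((mu \x mu)%E).-integrable [set: R * R] (EFin \o f).
  pose I := `[- M, M]%classic : set R.
  have mI : measurable (I `*` I) by apply: measurableX; exact: measurable_itv.
  have II : ((mu \x mu)%E).-integrable [set: R * R]
      (fun z => (\1_(I `*` I) z)%:E).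
    apply/integrableP; split; first exact/measurable_EFinP/measurable_indic.
    under eq_integral do rewrite gee0_abs ?lee_fin//.
    rewrite integral_indic// setIT.
    rewrite [X in (X < _)%E](@product_measure1E _ _ _ _ _ mu mu I I)//=; try exact: measurable_itv.
    by rewrite lte_mul_pinfty// /I lebesgue_measure_itv/=; case: ifP => _;
      rewrite ?ltry// -?EFinB ?ltry.
  apply: le_integrable (integrableZl measurableT M II) => //.
    exact/measurable_EFinP.
  move=> z _; rewrite /= lee_fin indicE.
  have [zI|zI] := pselect ((I `*` I) z).
    by rewrite mem_set// mulr1 (le_trans (fM z))// ler_norm.
  rewrite memNset// f0 ?normr0//.
  apply: contrapT => /not_orP[/negP z1 /negP z2]; apply: zI.
  by split; rewrite /I/= in_itv/= -ler_norml leNgt.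
have sec1 x : rintable (fun y => f (x, y)).
  apply: (@rintable_bsupp _ _ M) => [|y|y My]; last 2 first.
  - exact: fM.
  - by apply: f0; right.
  exact: measurableT_comp.
have sec2 y : rintable (fun x => f (x, y)).
  apply: (@rintable_bsupp _ _ M) => [|x|x Mx]; last 2 first.
  - exact: fM.
  - by apply: f0; left.
  exact: measurableT_comp.
have E1 : (\int[mu]_x (rint (fun y => f (x, y)))%:E =
    \int[mu]_x \int[mu]_y (EFin \o f) (x, y))%E.
  by apply: eq_integral => x _; rewrite rintE.
have E2 : (\int[mu]_y (rint (fun x => f (x, y)))%:E =
    \int[mu]_y \int[mu]_x (EFin \o f) (x, y))%E.
  by apply: eq_integral => y _; rewrite rintE.
rewrite [LHS]/rint [RHS]/rint /Rintegral.
by rewrite E1 E2 (Fubini If).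
Qed.

End FubiniBox.

(** * Modulus and conjugation *)

Section ComplexNorm.
Context {R : realType}.
Implicit Types (z w : R[i]) (x : R).

Lemma cReD z w : complex.Re (z + w) = complex.Re z + complex.Re w.
Proof. by case: z w => [? ?] [? ?]. Qed.
Lemma cImD z w : complex.Im (z + w) = complex.Im z + complex.Im w.
Proof. by case: z w => [? ?] [? ?]. Qed.
Lemma cReN z : complex.Re (- z) = - complex.Re z.
Proof. by case: z. Qed.
Lemma cImN z : complex.Im (- z) = - complex.Im z.
Proof. by case: z. Qed.
Lemma cReM z w : complex.Re (z * w) =
  complex.Re z * complex.Re w - complex.Im z * complex.Im w.
Proof. by case: z w => [? ?] [? ?]. Qed.
Lemma cImM z w : complex.Im (z * w) =
  complex.Re z * complex.Im w + complex.Im z * complex.Re w.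
Proof. by case: z w => [? ?] [? ?]. Qed.
Lemma cReJ z : complex.Re (cj z) = complex.Re z.
Proof. by case: z. Qed.
Lemma cImJ z : complex.Im (cj z) = - complex.Im z.
Proof. by case: z. Qed.

Lemma complex_eq z w : complex.Re z = complex.Re w ->
  complex.Im z = complex.Im w -> z = w.
Proof. by case: z w => [? ?] [? ?] /= -> ->. Qed.

Lemma conjcD z w : cj (z + w) = (cj z) + (cj w) :> R[i].
Proof. by apply: complex_eq; rewrite ?(cReJ,cImJ,cReD,cImD)//; ring. Qed.
Lemma conjcN z : cj (- z) = - (cj z) :> R[i].
Proof. by apply: complex_eq; rewrite ?(cReJ,cImJ,cReN,cImN)//. Qed.
Lemma conjcB z w : cj (z - w) = (cj z) - (cj w) :> R[i].
Proof. by rewrite conjcD conjcN. Qed.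
Lemma conjcM z w : cj (z * w) = (cj z) * (cj w) :> R[i].
Proof. by apply: complex_eq; rewrite ?(cReJ,cImJ,cReM,cImM); ring. Qed.
Lemma conjcR x : cj x%:C = x%:C :> R[i].
Proof. by apply: complex_eq; rewrite ?(cReJ,cImJ)//= oppr0. Qed.
Lemma conjcC z : cj (cj z) = z :> R[i].
Proof. by apply: complex_eq; rewrite ?(cReJ,cImJ)// opprK. Qed.

Lemma normc_ge0 z : 0 <= normc z.
Proof. by case: z => a b /=; exact: sqrtr_ge0. Qed.

Lemma sqr_normc z : normc z ^+ 2 = complex.Re z ^+ 2 + complex.Im z ^+ 2.
Proof. by case: z => a b /=; rewrite sqr_sqrtr// addr_ge0 ?sqr_ge0. Qed.

Lemma mulc_conj z : z * (cj z) = (normc z ^+ 2)%:C.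
Proof.
rewrite sqr_normc.
by apply: complex_eq; rewrite ?(cReJ,cImJ,cReM,cImM)/=; ring.
Qed.

Lemma normcD z w : normc (z + w) <= normc z + normc w.
Proof. by have /andP[_] := lec_normD z w. Qed.

Lemma normcN z : normc (- z) = normc z.
Proof. by case: z => a b /=; rewrite !sqrrN. Qed.

Lemma normcJ z : normc (cj z) = normc z.
Proof. by case: z => a b /=; rewrite sqrrN. Qed.

Lemma normcR x : normc x%:C = `|x|.
Proof. by rewrite /= expr0n/= addr0 sqrtr_sqr. Qed.

Lemma normRe_le z : `|complex.Re z| <= normc z.
Proof.
rewrite -(@ler_pXn2r _ 2) ?nnegrE ?normc_ge0//.
by rewrite sqr_normc real_normK ?num_real// lerDl sqr_ge0.
Qed.

Lemma normIm_le z : `|complex.Im z| <= normc z.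
Proof.
rewrite -(@ler_pXn2r _ 2) ?nnegrE ?normc_ge0//.
by rewrite sqr_normc real_normK ?num_real// lerDr sqr_ge0.
Qed.

Lemma normc_le z : normc z <= `|complex.Re z| + `|complex.Im z|.
Proof.
rewrite -(@ler_pXn2r _ 2) ?nnegrE ?normc_ge0 ?addr_ge0//.
rewrite sqr_normc sqrrD !real_normK ?num_real// lerD2r lerDl.
by rewrite mulrn_wge0// mulr_ge0.
Qed.

Lemma normc_eq0 z : normc z = 0 -> z = 0.
Proof. exact: Normc.eq0_normc. Qed.

Lemma normc0 : normc (0 : R[i]) = 0.
Proof. exact: Normc.normc0. Qed.

Lemma normc_sum (I : Type) (s : seq I) (F : I -> R[i]) :
  normc (\sum_(i <- s) F i) <= \sum_(i <- s) normc (F i).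
Proof.
elim: s => [|i s IHs]; first by rewrite !big_nil normc0.
by rewrite !big_cons (le_trans (normcD _ _))// lerD2l.
Qed.

End ComplexNorm.

(** * Measurability of complex functions *)

Section ComplexMeasurable.
Context {R : realType} {d} {T : measurableType d}.
Implicit Types (f g : T -> R[i]).

(** The domain is arbitrary so that the notion also serves on [R * R], where Fubini is applied. *)
Definition cmeas f := measurable_fun [set: T] (fun x => complex.Re (f x)) /\
  measurable_fun [set: T] (fun x => complex.Im (f x)).

Lemma cmeasD f g : cmeas f -> cmeas g -> cmeas (fun x => f x + g x).
Proof.
move=> [f1 f2] [g1 g2]; split.
  by under eq_fun do rewrite cReD; exact: measurable_funD.
by under eq_fun do rewrite cImD; exact: measurable_funD.
Qed.

Lemma cmeasN f : cmeas f -> cmeas (fun x => - f x).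
Proof.
move=> [f1 f2]; split.
  by under eq_fun do rewrite cReN; exact: measurableT_comp.
by under eq_fun do rewrite cImN; exact: measurableT_comp.
Qed.

Lemma cmeasB f g : cmeas f -> cmeas g -> cmeas (fun x => f x - g x).
Proof. by move=> mf mg; apply: cmeasD => //; exact: cmeasN. Qed.

Lemma cmeasM f g : cmeas f -> cmeas g -> cmeas (fun x => f x * g x).
Proof.
move=> [f1 f2] [g1 g2]; split.
  under eq_fun do rewrite cReM.
  by apply: measurable_funB; exact: measurable_funM.
under eq_fun do rewrite cImM.
by apply: measurable_funD; exact: measurable_funM.
Qed.

Lemma cmeas_cst (c : R[i]) : cmeas (fun=> c).
Proof. by split; exact: measurable_cst. Qed.

Lemma cmeasJ f : cmeas f -> cmeas (fun x => cj (f x)).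
Proof.
move=> [f1 f2]; split; first by under eq_fun do rewrite cReJ.
by under eq_fun do rewrite cImJ; exact: measurableT_comp.
Qed.

Lemma cmeasR (f : T -> R) : measurable_fun [set: T] f -> cmeas (fun x => (f x)%:C).
Proof. by move=> mf; split => //=; exact: measurable_cst. Qed.

Lemma cmeas_sum (I : Type) (s : seq I) (F : I -> T -> R[i]) :
  (forall i, cmeas (F i)) -> cmeas (fun x => \sum_(i <- s) F i x).
Proof.
move=> mF; elim: s => [|i s IHs].
  by under eq_fun do rewrite big_nil; exact: cmeas_cst.
by under eq_fun do rewrite big_cons; exact: cmeasD.
Qed.

Lemma cmeas_normc f : cmeas f -> measurable_fun [set: T] (fun x => normc (f x)).
Proof.
move=> [f1 f2].
rewrite (_ : (fun _ => _) = (fun x =>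
    Num.sqrt (complex.Re (f x) ^+ 2 + complex.Im (f x) ^+ 2))); last first.
  by apply/funext => x; case: (f x).
apply: (@measurableT_comp _ _ _ _ _ _ (@Num.sqrt R)).
  exact: continuous_measurable_fun (@sqrt_continuous R).
by apply: measurable_funD; exact: measurable_funX.
Qed.

Lemma cmeas_sqr f : cmeas f ->
  measurable_fun [set: T] (fun x => normc (f x) ^+ 2).
Proof. by move=> /cmeas_normc mf; exact: measurable_funX. Qed.

Lemma cmeas_comp d' (T' : measurableType d') (g : T' -> T) f :
  measurable_fun [set: T'] g -> cmeas f ->
  measurable_fun [set: T'] (fun x => complex.Re (f (g x))) /\
  measurable_fun [set: T'] (fun x => complex.Im (f (g x))).
Proof.
move=> mg [f1 f2]; split.
  exact: (@measurableT_comp _ _ _ _ _ _ (fun x => complex.Re (f x))).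
exact: (@measurableT_comp _ _ _ _ _ _ (fun x => complex.Im (f x))).
Qed.

End ComplexMeasurable.

(** * Integration of complex functions *)

Section ComplexIntegral.
Context {R : realType}.
Implicit Types (f g : R -> R[i]) (a b x M : R) (c : R[i]).

Definition cintable f := rintable (fRe f) /\ rintable (fIm f).

Lemma Re_cint f : complex.Re (cint f) = rint (fun x => complex.Re (f x)).
Proof. by []. Qed.

Lemma Im_cint f : complex.Im (cint f) = rint (fun x => complex.Im (f x)).
Proof. by []. Qed.

Lemma cintable_cmeas f : cintable f -> cmeas f.
Proof. by move=> [f1 f2]; split; exact: rintableM. Qed.

Lemma cintable_le f (g : R -> R) : cmeas f ->
  (forall x, normc (f x) <= g x) -> rintable g -> cintable f.
Proof.
move=> [f1 f2] fg Ig; split; apply: rintable_le Ig => //= x;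
  apply: le_trans (fg x); [exact: normRe_le|exact: normIm_le].
Qed.

Lemma cintable_normc f : cintable f -> rintable (fun x => normc (f x)).
Proof.
move=> If; have mf := cintable_cmeas If; case: If => f1 f2.
apply: (@rintable_le _ _ (fun x => `|fRe f x| + `|fIm f x|)).
- exact: cmeas_normc.
- by move=> x; rewrite ger0_norm ?normc_ge0// normc_le.
- by apply: rintableD; exact: rintable_norm.
Qed.

Lemma cintableD f g : cintable f -> cintable g -> cintable (fun x => f x + g x).
Proof.
move=> [f1 f2] [g1 g2]; split; rewrite /fRe /fIm.
  by under eq_fun do rewrite cReD; exact: rintableD.
by under eq_fun do rewrite cImD; exact: rintableD.
Qed.

Lemma cintD f g : cintable f -> cintable g ->
  cint (fun x => f x + g x) = cint f + cint g.
Proof.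
move=> [f1 f2] [g1 g2]; apply: complex_eq; rewrite ?(cReD,cImD) ?(Re_cint,Im_cint).
  by under [in LHS]eq_fun do rewrite cReD; rewrite -rintD.
by under [in LHS]eq_fun do rewrite cImD; rewrite -rintD.
Qed.

Lemma cintableZ c f : cintable f -> cintable (fun x => c * f x).
Proof.
move=> [f1 f2]; split; rewrite /fRe /fIm.
  by under eq_fun do rewrite cReM; apply: rintableB; exact: rintableZ.
by under eq_fun do rewrite cImM; apply: rintableD; exact: rintableZ.
Qed.

Lemma cintZ c f : cintable f -> cint (fun x => c * f x) = c * cint f.
Proof.
move=> [f1 f2]; apply: complex_eq; rewrite ?(cReM,cImM) ?(Re_cint,Im_cint).
  under [in LHS]eq_fun do rewrite cReM.
  by rewrite rintB ?rintZ//; exact: rintableZ.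
under [in LHS]eq_fun do rewrite cImM.
by rewrite rintD ?rintZ//; exact: rintableZ.
Qed.

Lemma cintableN f : cintable f -> cintable (fun x => - f x).
Proof.
by move=> If; under eq_fun do rewrite -mulN1r; exact: cintableZ.
Qed.

Lemma cintN f : cintable f -> cint (fun x => - f x) = - cint f.
Proof.
by move=> If; under eq_fun do rewrite -mulN1r; rewrite cintZ// mulN1r.
Qed.

Lemma cintableB f g : cintable f -> cintable g -> cintable (fun x => f x - g x).
Proof. by move=> If Ig; apply: cintableD => //; exact: cintableN. Qed.

Lemma cintB f g : cintable f -> cintable g ->
  cint (fun x => f x - g x) = cint f - cint g.
Proof. by move=> If Ig; rewrite cintD ?cintN//; exact: cintableN. Qed.

Lemma cintableJ f : cintable f -> cintable (fun x => cj (f x)).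
Proof.
move=> [f1 f2]; split; rewrite /fRe /fIm.
  by under eq_fun do rewrite cReJ.
by under eq_fun do rewrite cImJ; exact: rintableN.
Qed.

Lemma cintJ f : cintable f -> cint (fun x => cj (f x)) = cj (cint f).
Proof.
move=> [f1 f2]; apply: complex_eq; rewrite ?(cReJ,cImJ) ?(Re_cint,Im_cint).
  by under eq_fun do rewrite cReJ.
by under eq_fun do rewrite cImJ; rewrite rintN.
Qed.

Lemma cint0 : cint (fun=> 0) = 0 :> R[i].
Proof. by apply: complex_eq; rewrite ?(Re_cint,Im_cint)/= rint0. Qed.

Lemma cintable0 : cintable (fun=> 0).
Proof. by split; exact: integrable0. Qed.

Lemma cintR (f : R -> R) : cint (fun x => (f x)%:C) = (rint f)%:C.
Proof. by apply: complex_eq; rewrite ?(Re_cint,Im_cint)//= rint0. Qed.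

Lemma cintable_sum (I : Type) (s : seq I) (F : I -> R -> R[i]) :
  (forall i, cintable (F i)) -> cintable (fun x => \sum_(i <- s) F i x).
Proof.
move=> IF; elim: s => [|i s IHs].
  by under eq_fun do rewrite big_nil; exact: cintable0.
by under eq_fun do rewrite big_cons; exact: cintableD.
Qed.

Lemma cint_sum (I : Type) (s : seq I) (F : I -> R -> R[i]) :
  (forall i, cintable (F i)) ->
  cint (fun x => \sum_(i <- s) F i x) = \sum_(i <- s) cint (F i).
Proof.
move=> IF; elim: s => [|i s IHs].
  by under eq_fun do rewrite big_nil; rewrite big_nil cint0.
under eq_fun do rewrite big_cons.
by rewrite big_cons -IHs cintD//; exact: cintable_sum.
Qed.

Lemma cintable_affine f a b : a != 0 -> cintable f ->
  cintable (fun x => f (a * x + b)).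
Proof.
move=> a0 [f1 f2]; split; [exact: (rintable_affine _ a0 f1)|].
exact: (rintable_affine _ a0 f2).
Qed.

Lemma cint_affine f a b : a != 0 -> cintable f ->
  cint (fun x => f (a * x + b)) = (`|a|^-1)%:C * cint f.
Proof.
move=> a0 [f1 f2]; apply: complex_eq; rewrite ?(cReM,cImM) ?(Re_cint,Im_cint)/=.
  by rewrite (rint_affine _ a0 f1) mul0r subr0.
by rewrite (rint_affine _ a0 f2) mul0r addr0.
Qed.

Lemma cintable_shift f b : cintable f -> cintable (fun x => f (x + b)).
Proof.
by move=> [f1 f2]; split; [exact: (rintable_shift _ f1)|exact: (rintable_shift _ f2)].
Qed.

Lemma cint_shift f b : cintable f -> cint (fun x => f (x + b)) = cint f.
Proof.
move=> [f1 f2]; apply: complex_eq; rewrite !(Re_cint,Im_cint).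
  exact: (rint_shift _ f1).
exact: (rint_shift _ f2).
Qed.

(* Multiply by the conjugate of the integral, then compare real parts. *)
Lemma normc_cint f : cintable f -> normc (cint f) <= rint (fun x => normc (f x)).
Proof.
move=> If; set z := cint f.
have [z0|z0] := eqVneq (normc z) 0.
  by rewrite z0; apply: rint_ge0 => x; exact: normc_ge0.
have zp : 0 < normc z by rewrite lt_neqAle eq_sym z0 normc_ge0.
rewrite -(ler_pM2l zp) -expr2.
have -> : normc z ^+ 2 = complex.Re (cint (fun x => (cj z) * f x)).
  by rewrite cintZ// mulrC mulc_conj.
rewrite Re_cint -rintZ; last exact: cintable_normc.
apply: le_rint => [||x].
- by have [] := cintableZ (cj z) If.
- by apply: rintableZ; exact: cintable_normc.
- rewrite -(normcJ z) -Normc.normcM.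
  by rewrite (le_trans (ler_norm _))// normRe_le.
Qed.

Lemma cintable_bsupp f M : cmeas f -> (forall x, normc (f x) <= M) ->
  (forall x, M < `|x| -> f x = 0) -> cintable f.
Proof.
move=> [f1 f2] fM f0; split; apply: (@rintable_bsupp _ _ M) => //= x.
- by rewrite (le_trans (normRe_le _)).
- by move=> Mx; rewrite /fRe f0.
- by rewrite (le_trans (normIm_le _)).
- by move=> Mx; rewrite /fIm f0.
Qed.

Lemma cint_fubini (f : R * R -> R[i]) M :
  cmeas f -> (forall z, normc (f z) <= M) ->
  (forall z, M < `|z.1| \/ M < `|z.2| -> f z = 0) ->
  cint (fun x => cint (fun y => f (x, y))) =
  cint (fun y => cint (fun x => f (x, y))).
Proof.
move=> [f1 f2] fM f0; apply: complex_eq; rewrite !(Re_cint,Im_cint).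
- apply: (@rint_fubini _ (fun z => complex.Re (f z)) M) => // z.
    by rewrite (le_trans (normRe_le _)).
  by move=> /f0 ->.
- apply: (@rint_fubini _ (fun z => complex.Im (f z)) M) => // z.
    by rewrite (le_trans (normIm_le _)).
  by move=> /f0 ->.
Qed.

End ComplexIntegral.

(** * Square-integrable functions and Bessel's inequality *)

Section SquareIntegrable.
Context {R : realType}.
Implicit Types (f g h : R -> R[i]) (a b x M : R) (c : R[i]).
Local Notation mu := (@lebesgue_measure R).

(** A form of [inLp 2%:E] that stays within real integrals; [inLp2P] and [cnorm2E] translate
    back. *)
Definition cL2 f := cmeas f /\ rintable (fun x => normc (f x) ^+ 2).
Definition nsq f : R := rint (fun x => normc (f x) ^+ 2).

Lemma innerE f g : inner f g = cint (fun x => f x * cj (g x)).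
Proof. by []. Qed.

Lemma nsq_ge0 f : 0 <= nsq f.
Proof. by apply: rint_ge0 => x; exact: sqr_ge0. Qed.

Lemma sqr_normcD_le (z w : R[i]) :
  normc (z + w) ^+ 2 <= 2 * normc z ^+ 2 + 2 * normc w ^+ 2.
Proof.
have h := normcD z w; have h0 := normc_ge0 (z + w).
have : normc (z + w) ^+ 2 <= (normc z + normc w) ^+ 2.
  by rewrite ler_sqr ?nnegrE ?addr_ge0 ?normc_ge0.
have := sqr_ge0 (normc z - normc w); nra.
Qed.

Lemma cL2D f g : cL2 f -> cL2 g -> cL2 (fun x => f x + g x).
Proof.
move=> [mf If] [mg Ig]; have mD := cmeasD mf mg; split=> //.
apply: (@rintable_le _ _ (fun x => 2 * normc (f x) ^+ 2 + 2 * normc (g x) ^+ 2)).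
- exact: (cmeas_sqr mD).
- by move=> x; rewrite ger0_norm ?sqr_ge0// sqr_normcD_le.
- by apply: rintableD; exact: rintableZ.
Qed.

Lemma nsqD_le f g : cL2 f -> cL2 g ->
  nsq (fun x => f x + g x) <= 2 * nsq f + 2 * nsq g.
Proof.
move=> f2 g2; have [_ I] := cL2D f2 g2.
rewrite /nsq -!rintZ; [|exact: g2.2|exact: f2.2].
rewrite -rintD; try by apply: rintableZ; [exact: f2.2|exact: g2.2].
apply: le_rint => //.
- by apply: rintableD; apply: rintableZ; [exact: f2.2|exact: g2.2].
- by move=> x; exact: sqr_normcD_le.
- by apply: rintableZ; exact: f2.2.
- by apply: rintableZ; exact: g2.2.
Qed.

Lemma cL2Z c f : cL2 f -> cL2 (fun x => c * f x).
Proof.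
move=> [mf If]; split; first by apply: cmeasM => //; exact: cmeas_cst.
by under eq_fun do rewrite Normc.normcM exprMn; exact: rintableZ.
Qed.

Lemma nsqZ c f : cL2 f -> nsq (fun x => c * f x) = normc c ^+ 2 * nsq f.
Proof.
move=> [_ If]; rewrite /nsq -rintZ//.
by under eq_fun do rewrite Normc.normcM exprMn.
Qed.

Lemma cL2N f : cL2 f -> cL2 (fun x => - f x).
Proof. by move=> f2; under eq_fun do rewrite -mulN1r; exact: cL2Z. Qed.

Lemma cL2B f g : cL2 f -> cL2 g -> cL2 (fun x => f x - g x).
Proof. by move=> f2 g2; apply: cL2D => //; exact: cL2N. Qed.

Lemma cL20 : cL2 (fun=> 0).
Proof.
split; first exact: cmeas_cst.
by under eq_fun do rewrite normc0 expr0n/=; exact: integrable0.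
Qed.

Lemma cL2_sum (I : Type) (s : seq I) (F : I -> R -> R[i]) :
  (forall i, cL2 (F i)) -> cL2 (fun x => \sum_(i <- s) F i x).
Proof.
move=> IF; elim: s => [|i s IHs].
  by under eq_fun do rewrite big_nil; exact: cL20.
by under eq_fun do rewrite big_cons; exact: cL2D.
Qed.

Lemma cL2_bsupp f M : cmeas f -> (forall x, normc (f x) <= M) ->
  (forall x, M < `|x| -> f x = 0) -> cL2 f.
Proof.
move=> mf fM f0; split => //.
have M0 : 0 <= M by rewrite (le_trans _ (fM 0))// normc_ge0.
apply: (@rintable_le _ _ (fun x => M * normc (f x))).
- exact: cmeas_sqr.
- move=> x; rewrite ger0_norm ?sqr_ge0// expr2.
  by rewrite ler_wpM2r ?normc_ge0.
- by apply: rintableZ; apply: cintable_normc; exact: (cintable_bsupp mf fM f0).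
Qed.

Lemma cintable_mul f g : cL2 f -> cL2 g -> cintable (fun x => f x * cj (g x)).
Proof.
move=> [mf If] [mg Ig].
apply: (@cintable_le _ _ (fun x => normc (f x) ^+ 2 + normc (g x) ^+ 2)).
- by apply: cmeasM => //; exact: cmeasJ.
- move=> x; rewrite Normc.normcM normcJ.
  have := sqr_ge0 (normc (f x) - normc (g x)).
  have := sqr_ge0 (normc (f x)); have := sqr_ge0 (normc (g x)).
  nra.
- exact: rintableD.
Qed.

Lemma innerDl f g h : cL2 f -> cL2 g -> cL2 h ->
  inner (fun x => f x + g x) h = inner f h + inner g h.
Proof.
move=> f2 g2 h2; rewrite !innerE -cintD; try exact: cintable_mul.
by under eq_fun do rewrite mulrDl.
Qed.

Lemma innerZl c f g : cL2 f -> cL2 g ->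
  inner (fun x => c * f x) g = c * inner f g.
Proof.
move=> f2 g2; rewrite !innerE -cintZ; last exact: cintable_mul.
by under eq_fun do rewrite -mulrA.
Qed.

Lemma innerJ f g : cL2 f -> cL2 g -> inner g f = cj (inner f g).
Proof.
move=> f2 g2; rewrite !innerE -cintJ; last exact: cintable_mul.
by under [in RHS]eq_fun do rewrite conjcM conjcC mulrC.
Qed.

Lemma innerBl f g h : cL2 f -> cL2 g -> cL2 h ->
  inner (fun x => f x - g x) h = inner f h - inner g h.
Proof.
move=> f2 g2 h2; rewrite innerDl//; last exact: cL2N.
by under [in X in _ + X]eq_fun do rewrite -mulN1r; rewrite innerZl// mulN1r.
Qed.

Lemma innerZr c f g : cL2 f -> cL2 g ->
  inner f (fun x => c * g x) = cj c * inner f g.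
Proof.
move=> f2 g2; rewrite (innerJ (cL2Z c g2) f2) innerZl// conjcM.
by rewrite (innerJ g2 f2).
Qed.

Lemma innerBr f g h : cL2 f -> cL2 g -> cL2 h ->
  inner h (fun x => f x - g x) = inner h f - inner h g.
Proof.
move=> f2 g2 h2; rewrite (innerJ (cL2B f2 g2) h2) innerBl// conjcB.
by rewrite (innerJ f2 h2) (innerJ g2 h2).
Qed.

Lemma innerDr f g h : cL2 f -> cL2 g -> cL2 h ->
  inner h (fun x => f x + g x) = inner h f + inner h g.
Proof.
move=> f2 g2 h2; rewrite (innerJ (cL2D f2 g2) h2) innerDl// conjcD.
by rewrite (innerJ f2 h2) (innerJ g2 h2).
Qed.

Lemma inner_nsq f : inner f f = (nsq f)%:C.
Proof. by rewrite innerE -cintR; under eq_fun do rewrite mulc_conj. Qed.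

Lemma nsqB f g : cL2 f -> cL2 g -> nsq (fun x => f x - g x) =
  nsq f - 2 * complex.Re (inner f g) + nsq g.
Proof.
move=> f2 g2; apply: complexI; rewrite -inner_nsq.
have fg := cL2B f2 g2.
rewrite innerBl// !innerBr// (innerJ f2 g2) !inner_nsq.
apply: complex_eq; rewrite ?(cReD,cImD,cReN,cImN,cReJ,cImJ)/=; ring.
Qed.

Lemma nsqD f g : cL2 f -> cL2 g -> nsq (fun x => f x + g x) =
  nsq f + 2 * complex.Re (inner f g) + nsq g.
Proof.
move=> f2 g2; apply: complexI; rewrite -inner_nsq.
have fg := cL2D f2 g2.
rewrite innerDl// !innerDr// (innerJ f2 g2) !inner_nsq.
apply: complex_eq; rewrite ?(cReD,cImD,cReN,cImN,cReJ,cImJ)/=; ring.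
Qed.

Section Bessel.
Variables (I : eqType) (e : I -> R -> R[i]) (f : R -> R[i]).
Hypotheses (e2 : forall i, cL2 (e i)) (f2 : cL2 f).
Hypothesis eo : forall i j, inner (e i) (e j) = (i == j)%:R.

Let res s x := f x - \sum_(i <- s) inner f (e i) * e i x.

Let res2 s : cL2 (res s).
Proof. by apply: cL2B => //; apply: cL2_sum => i; exact: cL2Z. Qed.

Let resS i s : res (i :: s) = (fun x => res s x - inner f (e i) * e i x).
Proof. by apply/funext => x; rewrite /res big_cons; ring. Qed.

Let res_inner s j : j \notin s -> inner (res s) (e j) = inner f (e j).
Proof.
elim: s => [_|i s IHs].
  by congr inner; apply/funext => x; rewrite /res big_nil subr0.
rewrite inE negb_or => /andP[ji js]; rewrite resS innerBl//; last exact: cL2Z.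
by rewrite IHs// innerZl// eo eq_sym (negPf ji) mulr0 subr0.
Qed.

(** Induction on [s]: the residual after [s] still has the full coefficient of [f] along a new
    [e i], so removing that component lowers the squared norm by exactly the square of this
    coefficient. *)
Lemma pythagoras s : uniq s ->
  nsq (fun x => f x - \sum_(i <- s) inner f (e i) * e i x) =
  nsq f - \sum_(i <- s) normc (inner f (e i)) ^+ 2.
Proof.
elim: s => [_|i s IHs /= /andP[si us]].
  rewrite big_nil subr0; congr nsq.
  by apply/funext => x; rewrite big_nil subr0.
rewrite -[X in nsq X]/(res (i :: s)) resS nsqB//; last exact: cL2Z.
rewrite [nsq (res s)]IHs// nsqZ// innerZr// res_inner// big_cons.
have -> : nsq (e i) = 1.
  by apply: complexI; rewrite -inner_nsq eo eqxx.
by rewrite [cj _ * _]mulrC mulc_conj /=; ring.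
Qed.

Lemma bessel s : uniq s -> \sum_(i <- s) normc (inner f (e i)) ^+ 2 <= nsq f.
Proof. by move=> us; rewrite -subr_ge0 -pythagoras// nsq_ge0. Qed.

End Bessel.

Lemma cnorm2E f : cL2 f -> cnorm 2%:E f = (Num.sqrt (nsq f))%:E.
Proof.
move=> f2; rewrite /cnorm unlock.
have -> : (\int[mu]_x (`|(normc (f x))%:E| `^ 2) = (nsq f)%:E)%E.
  rewrite /nsq rintE; last exact: f2.2.
  apply: eq_integral => x _; rewrite abse_EFin ger0_norm ?normc_ge0//.
  by rewrite poweR_EFin powR_mulrn ?normc_ge0.
by rewrite poweR_EFin powR12_sqrt// nsq_ge0.
Qed.

Lemma inLp2P f : inLp 2%:E f <-> cL2 f.
Proof.
split=> [[mf Nf]|f2]; last first.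
  by split; [exact: f2.1|rewrite cnorm2E// ltry].
split; first exact: mf.
apply/integrableP; split.
  by apply/measurable_EFinP; exact: cmeas_sqr.
move: Nf; rewrite /cnorm unlock => Nf.
have E : (\int[mu]_x `|(normc (f x) ^+ 2)%:E| =
    \int[mu]_x (`|(normc (f x))%:E| `^ 2))%E.
  apply: eq_integral => x _; rewrite !abse_EFin !ger0_norm ?normc_ge0 ?sqr_ge0//.
  by rewrite poweR_EFin powR_mulrn ?normc_ge0.
rewrite E.
apply: (@lty_poweRy _ _ 2^-1) => //.
Qed.

End SquareIntegrable.

(** * The exponential [e^(ix)] *)

Section ComplexExponential.
Context {R : realType}.
Implicit Types (x y t : R) (n : int).

Definition cis x : R[i] := cos x +i* sin x.

Lemma fourierE (f : R -> R[i]) xi :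
  fourier f xi = cint (fun x => f x * cis (x * xi)).
Proof. by []. Qed.

Lemma cis0 : cis 0 = 1.
Proof. by rewrite /cis cos0 sin0. Qed.

Lemma cisD x y : cis (x + y) = cis x * cis y.
Proof. by apply: complex_eq; rewrite ?(cReM,cImM)/= ?(cosD,sinD)//; ring. Qed.

Lemma cisJ x : cj (cis x) = cis (- x).
Proof. by rewrite /cis cosN sinN. Qed.

Lemma normc_cis x : normc (cis x) = 1.
Proof. by rewrite /= cos2Dsin2 sqrtr1. Qed.

Lemma cis_mulN x : cis x * cis (- x) = 1.
Proof. by rewrite -cisD subrr cis0. Qed.

Lemma cis_neq0 x : cis x != 0.
Proof. by apply/eqP => h; have := normc_cis x; rewrite h normc0 => /eqP; rewrite eq_sym oner_eq0. Qed.

Lemma cis_pi : cis pi = -1.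
Proof. by apply: complex_eq; rewrite ?(cReN,cImN)/= ?cospi ?sinpi// oppr0. Qed.

Lemma cis_2pi_nat (n : nat) : cis (2 * pi * n%:R) = 1.
Proof.
elim: n => [|n IHn]; first by rewrite mulr0 cis0.
rewrite -(addn1 n) natrD mulrDr mulr1 cisD IHn mul1r mulr2n mulrDl mul1r cisD cis_pi.
by rewrite mulN1r opprK.
Qed.

Lemma cis_2pi n : cis (2 * pi * n%:~R) = 1.
Proof.
case: n => n; first by rewrite -pmulrn cis_2pi_nat.
by rewrite NegzE mulrNz mulrN -cisJ cis_2pi_nat conjc1.
Qed.

Lemma cmeas_cis : cmeas (cis : R -> R[i]).
Proof.
split; apply: continuous_measurable_fun; [exact: continuous_cos|exact: continuous_sin].
Qed.

Lemma cmeas_cisM t : cmeas (fun x => cis (t * x)).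
Proof.
have mt : measurable_fun [set: R] (fun x : R => t * x).
  exact: measurable_funM.
exact: (cmeas_comp mt cmeas_cis).
Qed.

Lemma mvt_lip (f g : R -> R) x y : (forall z : R, is_derive z (1 : R) f (g z)) ->
  (forall z, `|g z| <= 1) -> `|f x - f y| <= `|x - y|.
Proof.
move=> fg g1; wlog xy : x y / y < x => [H|].
  have [yx|xy|->] := ltgtP y x; last by rewrite !subrr.
    exact: H.
  by rewrite distrC [leRHS]distrC; exact: H.
have [|c _ ->] := @MVT _ f g y x xy (fun z _ => fg z).
  by apply: derivable_within_continuous => z _; exact: ex_derive.
by rewrite normrM ler_piMl.
Qed.

Lemma normc_cisB x y : normc (cis x - cis y) <= 2 * `|x - y|.
Proof.
apply: le_trans (normc_le _) _; rewrite cReD cImD cReN cImN/= mulr2n mulrDl mul1r.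
have sin1 z : `|- sin z : R| <= 1 by rewrite normrN sin_max.
apply: lerD; first exact: (mvt_lip x y (@is_derive_cos R) sin1).
exact: (mvt_lip x y (@is_derive_sin R) (@cos_max R)).
Qed.

(** Makes the quotient in [chernoff] bounded. By conjugation [t >= 0]. Up to 1 the imaginary part
    suffices, since [sin t >= cos 1 * t] by the mean value theorem; from 1 to [pi] the real part
    does, since [1 - cos t >= 1 - cos 1], and division by [pi] makes this bound linear in [t]. *)
Lemma normc_cisB1_ge : exists2 c : R, 0 < c &
  forall t, `|t| <= pi -> c * `|t| <= normc (cis t - 1).
Proof.
have pi2 := pi_ge2 R.
have pi0 := pi_gt0 R.
have cos1 := @cos1_gt0 R.
have cos11 : cos (1 : R) < 1.
  rewrite -[ltRHS]cos0 ltr_cos//= !in_itv/=; lra.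
exists (Num.min (cos 1) ((1 - cos 1) / pi)).
  by rewrite lt_min cos1 divr_gt0// subr_gt0.
move=> t tpi; wlog t0 : t tpi / 0 <= t => [H|].
  have [|t0] := leP 0 t; first exact: H.
  rewrite -(normrN t) -(normcJ (cis t - 1)) conjcB cisJ conjc1.
  by apply: H; rewrite ?normrN// oppr_ge0 ltW.
rewrite ger0_norm//; rewrite ger0_norm// in tpi.
have [t1|t1] := leP t 1.
- apply: le_trans (normIm_le _); rewrite cImD cImN/= subr0.
  apply: (@le_trans _ _ (cos 1 * t)); first by rewrite ler_wpM2r// ge_min lexx.
  have [->|tn0] := eqVneq t 0; first by rewrite mulr0.
  have tp : 0 < t by rewrite lt_neqAle eq_sym tn0.
  have [|c] := @MVT _ sin cos 0 t tp (fun z _ => is_derive_sin z).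
    by apply: derivable_within_continuous => z _; exact: ex_derive.
  rewrite in_itv/= => /andP[c0 ct]; rewrite sin0 !subr0 => ->.
  rewrite (le_trans _ (ler_norm _))// ler_wpM2r//.
  by rewrite leNgt ltr_cos ?in_itv/=; lra.
- apply: le_trans (normRe_le _); rewrite cReD cReN/= distrC.
  apply: le_trans (ler_norm _).
  apply: (@le_trans _ _ ((1 - cos 1) / pi * t)).
    by rewrite ler_wpM2r// ge_min lexx orbT.
  apply: (@le_trans _ _ (1 - cos 1)).
    rewrite -mulrA ler_piMr ?subr_ge0 ?(ltW cos11)//.
    by rewrite mulrC ler_pdivrMr// mul1r.
  by rewrite lerD2l lerN2 leNgt ltr_cos ?in_itv/=; lra.
Qed.

End ComplexExponential.

(** * Half-open intervals *)

Section Intervals.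
Context {R : realType}.
Implicit Types (a b t x : R).

(** Half-open, so that consecutive translates tile a longer interval at every point and not merely
    almost everywhere. *)
Definition ivl a b t : R := if (a <= t) && (t < b) then 1 else 0.

Lemma ivl_indic a b : ivl a b = \1_(`[a, b[%classic).
Proof.
apply/funext => t; rewrite indicE /ivl; case: ifPn => h.
  by rewrite mem_set//= in_itv.
by rewrite memNset//= in_itv/=; apply/negP.
Qed.

Lemma measurable_ivl a b : measurable_fun [set: R] (ivl a b).
Proof. by rewrite ivl_indic; apply: measurable_indic; exact: measurable_itv. Qed.

Lemma cmeas_ivl a b : cmeas (fun t => (ivl a b t)%:C).
Proof. by apply: cmeasR; exact: measurable_ivl. Qed.

Lemma ivl_ge0 a b t : 0 <= ivl a b t.
Proof. by rewrite /ivl; case: ifP. Qed.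

Lemma ivl_le1 a b t : ivl a b t <= 1.
Proof. by rewrite /ivl; case: ifP. Qed.

Lemma ivl_out a b t : Num.max `|a| `|b| < `|t| -> ivl a b t = 0.
Proof.
rewrite gt_max => /andP[]; rewrite /ivl; case: ifP => // /andP[h1 h2].
have [t0|t0] := leP 0 t.
  by rewrite (ger0_norm t0) => _; rewrite ltNge (le_trans (ltW h2) (ler_norm b)).
rewrite (ltr0_norm t0) ltNge -(normrN a).
by rewrite (le_trans _ (ler_norm _))// lerN2.
Qed.

Lemma rintable_ivl a b (f : R -> R) (M : R) : measurable_fun [set: R] f ->
  (forall t, a <= t < b -> `|f t| <= M) -> rintable (fun t => ivl a b t * f t).
Proof.
move=> mf fM.
apply: (@rintable_bsupp _ _ (Num.max `|M| (Num.max `|a| `|b|))).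
- by apply: measurable_funM => //; exact: measurable_ivl.
- move=> t; rewrite le_max /ivl; case: ifP => h; last first.
    by rewrite mul0r normr0 normr_ge0.
  by rewrite mul1r (le_trans (fM _ h))// ler_norm.
- by move=> t; rewrite gt_max => /andP[_ h]; rewrite ivl_out// mul0r.
Qed.

Lemma cintable_ivl a b (f : R -> R[i]) (M : R) : cmeas f ->
  (forall t, a <= t < b -> normc (f t) <= M) ->
  cintable (fun t => (ivl a b t)%:C * f t).
Proof.
move=> mf fM.
apply: (@cintable_bsupp _ _ (Num.max `|M| (Num.max `|a| `|b|))).
- by apply: cmeasM => //; exact: cmeas_ivl.
- move=> t; rewrite le_max /ivl; case: ifP => h; last first.
    by rewrite mul0r normc0 normr_ge0.
  by rewrite mul1r (le_trans (fM _ h))// ler_norm.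
- by move=> t; rewrite gt_max => /andP[_ h]; rewrite ivl_out// mul0r.
Qed.

Lemma rint_ivl_FTC (F f : R -> R) a b : a < b ->
  (forall x : R, is_derive x (1 : R) F (f x)) -> continuous f ->
  rint (fun t => ivl a b t * f t) = F b - F a.
Proof.
move=> ab dF cf.
have iab : (@lebesgue_measure R).-integrable `[a, b] (EFin \o f).
  apply: continuous_compact_integrable; first exact: segment_compact.
  exact: continuous_subspaceT.
have cF : continuous F.
  by move=> x; apply: differentiable_continuous; apply/derivable1_diffP/ex_derive.
transitivity (Rintegral (@lebesgue_measure R) `[a, b]%classic f).
  rewrite -Rintegral_itv_bndo_bndc; last first.
    apply: integrableS iab => //; try exact: measurable_itv.
    exact: subset_itv_co_cc.
  rewrite Rintegral_mkcond /rint; congr Rintegral.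
  apply/funext => t; rewrite patchE ivl_indic indicE.
  by case: ifPn => _; rewrite ?mul1r ?mul0r.
rewrite /Rintegral (continuous_FTC2 (F := F))//.
- exact: continuous_subspaceT.
- split.
  + by move=> x _; exact: ex_derive.
  + by apply: cvg_at_right_filter; exact: cF.
  + by apply: cvg_at_left_filter; exact: cF.
- by move=> x _; rewrite derive1E; exact: derive_val.
Qed.

Lemma sum_ivl a (w t : R) (n : nat) : 0 < w ->
  \sum_(i < n) ivl a (a + w) (t - w * i%:R) = ivl a (a + w * n%:R) t.
Proof.
move=> w0; elim: n => [|n IHn].
  rewrite big_ord0 mulr0 addr0 /ivl; case: ifP => // /andP[h1 h2].
  by move: (le_lt_trans h1 h2); rewrite ltxx.
rewrite big_ord_recr/= IHn -(addn1 n) natrD mulrDr mulr1 /ivl.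
have wn : 0 <= w * n%:R by rewrite mulr_ge0// ltW.
case: (leP a t) => h1 /=; case: (ltP t (a + w * n%:R)) => h2 /=.
- case: (leP a (t - w * n%:R)) => /= h3; first by exfalso; lra.
  by rewrite addr0 ifT//; lra.
- rewrite add0r; congr (if _ then _ else _).
  by apply/idP/idP => h; lra.
- by rewrite add0r ifF//; apply/negP => h; lra.
- by rewrite add0r ifF//; apply/negP => h; lra.
Qed.

Lemma sum_ivlC a (w t : R) (n : nat) : 0 < w ->
  \sum_(i < n) (ivl a (a + w) (t - w * i%:R))%:C = (ivl a (a + w * n%:R) t)%:C.
Proof. by move=> w0; rewrite -rmorph_sum sum_ivl. Qed.

End Intervals.

(** * Orthogonality of the characters on one period *)

Section Dirichlet.
Context {R : realType}.
Implicit Types (t x : R) (n k : int) (N : nat).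

Definition box t : R := ivl (- pi) pi t.

Lemma cint_box_cis k :
  cint (fun t => (box t)%:C * cis (k%:~R * t)) = (2 * pi * (k == 0)%:R)%:C.
Proof.
have pi0 := pi_gt0 R; have pipi : - pi < (pi : R) by lra.
have [->|k0] := eqVneq k 0.
  rewrite mulr1 -[RHS]mulr1.
  under eq_fun do rewrite mul0r cis0 mulr1.
  rewrite cintR mulr1; congr (_%:C).
  have := @rint_ivl_FTC R id (cst 1) _ _ pipi (fun x => is_derive_id x 1).
  under eq_fun do rewrite mulr1.
  move=> ->; first ring.
  exact: cst_continuous.
have kR : k%:~R != 0 :> R by rewrite intr_eq0.
(* By periodicity the primitives of cosine and sine agree at both ends, so both integrals vanish. *)
have Epi : cis (k%:~R * pi : R) = cis (k%:~R * - pi).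
  rewrite (_ : k%:~R * pi = k%:~R * - pi + 2 * pi * k%:~R :> R); last by ring.
  by rewrite cisD cis_2pi mulr1.
have [Ec Es] : cos (k%:~R * pi : R) = cos (k%:~R * - pi) /\
    sin (k%:~R * pi : R) = sin (k%:~R * - pi).
  by split; [exact: (congr1 (@complex.Re R) Epi)|exact: (congr1 (@complex.Im R) Epi)].
have dk x : is_derive x (1 : R) (fun t => k%:~R * t) k%:~R.
  by apply: is_derive_eq; rewrite scaler1.
have ck : continuous (fun t : R => k%:~R * t).
  by move=> x; apply: cvgM; [exact: cvg_cst|exact: cvg_id].
rewrite mulr0; apply: complex_eq; rewrite !(Re_cint,Im_cint)/=.
- rewrite (_ : (fun _ => _) = (fun t => ivl (- pi) pi t * cos (k%:~R * t))); last first.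
    by apply/funext => t; rewrite mul0r subr0.
  have dF x : is_derive x (1 : R) (fun t => k%:~R^-1 * sin (k%:~R * t))
      (cos (k%:~R * x)).
    have dsk := @is_derive1_comp _ sin (fun t => k%:~R * t) x _ _ (is_derive_sin _) (dk x).
    apply: is_derive_eq.
    by rewrite /GRing.scale/= mulrC -mulrA mulfV// mulr1.
  have cf : continuous (fun t : R => cos (k%:~R * t)).
    by move=> x; apply: continuous_comp; [exact: ck|exact: continuous_cos].
  by rewrite (rint_ivl_FTC pipi dF cf) Es subrr.
- rewrite (_ : (fun _ => _) = (fun t => ivl (- pi) pi t * sin (k%:~R * t))); last first.
    by apply/funext => t; rewrite mul0r addr0.
  have dF x : is_derive x (1 : R) (fun t => - k%:~R^-1 * cos (k%:~R * t))
      (sin (k%:~R * x)).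
    have dsk := @is_derive1_comp _ cos (fun t => k%:~R * t) x _ _ (is_derive_cos _) (dk x).
    apply: is_derive_eq.
    by rewrite /GRing.scale/=; field.
  have cf : continuous (fun t : R => sin (k%:~R * t)).
    by move=> x; apply: continuous_comp; [exact: ck|exact: continuous_sin].
  by rewrite (rint_ivl_FTC pipi dF cf) Ec subrr.
Qed.

End Dirichlet.

(** * Convergence of complex sequences *)

Section ComplexConvergence.
Context {R : realType}.
Implicit Types (u v : nat -> R[i]) (l m c : R[i]).

Definition ccvg u l := normc (u n - l) @[n --> \oo] --> (0 : R).

Lemma ccvg_le u l (e : nat -> R) : (forall n, normc (u n - l) <= e n) ->
  e n @[n --> \oo] --> (0 : R) -> ccvg u l.
Proof.
move=> ue e0; apply: (@squeeze_cvgr _ _ _ _ (fun=> 0) e) => //.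
  by near=> n; rewrite normc_ge0 ue.
exact: cvg_cst.
Unshelve. all: end_near. Qed.

Lemma ccvg_cst c : ccvg (fun=> c) c.
Proof.
by rewrite /ccvg; under eq_fun do rewrite subrr normc0; exact: cvg_cst.
Qed.

Lemma ccvgD u v l m : ccvg u l -> ccvg v m -> ccvg (fun n => u n + v n) (l + m).
Proof.
move=> ul vm; apply: (@ccvg_le _ _ (fun n => normc (u n - l) + normc (v n - m))).
  move=> n; rewrite (_ : _ - _ = (u n - l) + (v n - m)); last by ring.
  exact: normcD.
by rewrite -(addr0 (0 : R)); exact: cvgD.
Qed.

Lemma ccvgZ c u l : ccvg u l -> ccvg (fun n => c * u n) (c * l).
Proof.
move=> ul; apply: (@ccvg_le _ _ (fun n => normc c * normc (u n - l))).
  by move=> n; rewrite -mulrBr Normc.normcM.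
by rewrite -(mulr0 (normc c)); apply: cvgM => //; exact: cvg_cst.
Qed.

Lemma ccvgB u v l m : ccvg u l -> ccvg v m -> ccvg (fun n => u n - v n) (l - m).
Proof.
move=> ul vm; rewrite -mulN1r.
rewrite (_ : (fun _ => _) = (fun n => u n + -1 * v n)).
  by apply: ccvgD => //; exact: ccvgZ.
by apply/funext => n; rewrite mulN1r.
Qed.

Lemma ccvg_sum (I : Type) (s : seq I) (u_ : I -> nat -> R[i]) (l_ : I -> R[i]) :
  (forall i, ccvg (u_ i) (l_ i)) ->
  ccvg (fun n => \sum_(i <- s) u_ i n) (\sum_(i <- s) l_ i).
Proof.
move=> ul; elim: s => [|i s IHs].
  by rewrite big_nil; under eq_fun do rewrite big_nil; exact: ccvg_cst.
by rewrite big_cons; under eq_fun do rewrite big_cons; exact: ccvgD.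
Qed.

Lemma ccvg_Re u l : ccvg u l ->
  complex.Re (u n) @[n --> \oo] --> complex.Re l.
Proof.
move=> ul; apply/cvgrPdist_le => e e0.
have /cvgrPdist_le/(_ e e0) := ul.
apply: filterS => n; rewrite sub0r normrN ger0_norm ?normc_ge0// => h.
by rewrite distrC -cReN -cReD (le_trans (normRe_le _)).
Qed.

Lemma ccvg_near u v l : (\forall n \near \oo, u n = v n) -> ccvg u l -> ccvg v l.
Proof.
move=> uv ul; apply: cvg_trans ul; apply: near_eq_cvg.
by apply: filterS uv => n ->.
Qed.

Lemma cvg0_bounded_sum (u : nat -> R) (K : R) : (forall n, 0 <= u n) ->
  (forall n, \sum_(0 <= i < n) u i <= K) -> u n @[n --> \oo] --> (0 : R).
Proof.
move=> u0 uK; apply: cvg_series_cvg_0.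
apply: nondecreasing_is_cvgn.
  by move=> m n mn; rewrite /series/= (big_cat_nat (leq0n m) mn)/= lerDl sumr_ge0.
by exists K => _ [n _ <-]; exact: uK.
Qed.

End ComplexConvergence.

(** * Dirichlet kernel and Riemann-Lebesgue lemma *)

Section Poisson.
Context {R : realType}.
Implicit Types (t x : R) (N : nat).

(** The frequencies run from [-N] to [N - 1]. This asymmetric kernel telescopes against [cis t - 1],
    and the corresponding unit intervals tile [[-N, N[]. *)
Definition dirichlet N t : R[i] := \sum_(i < N + N) cis ((i%:R - N%:R) * t).

Lemma dirichlet_mul N t :
  (cis t - 1) * dirichlet N t = cis (N%:R * t) - cis (- N%:R * t).
Proof.
rewrite /dirichlet mulr_sumr.
rewrite -(big_mkord xpredT (fun i => (cis t - 1) * cis ((i%:R - N%:R) * t))).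
under eq_bigr => i _.
  rewrite mulrBl mul1r -cisD.
  rewrite (_ : t + _ = (i.+1%:R - N%:R) * t); last by rewrite -(addn1 i) natrD; ring.
  over.
rewrite (telescope_sumr (fun i : nat => cis ((i%:R - N%:R) * t)) (leq0n _)).
by rewrite natrD addrK sub0r.
Qed.

Lemma cmeas_dirichlet N : cmeas (dirichlet N).
Proof. by apply: cmeas_sum => i; exact: cmeas_cisM. Qed.

Lemma normc_dirichlet N t : normc (dirichlet N t) <= (N + N)%:R.
Proof.
apply: le_trans (normc_sum _ _) _.
under eq_bigr do rewrite normc_cis.
by rewrite sumr_const cardT/= size_enum_ord.
Qed.

Lemma dirichlet_period N t (j : int) :
  dirichlet N (t + 2 * pi * j%:~R) = dirichlet N t.
Proof.
apply: eq_bigr => i _.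
rewrite mulrDr cisD (_ : _ * (_ * j%:~R) = 2 * pi * ((i%:Z - N%:Z) * j)%:~R).
  by rewrite cis_2pi mulr1.
by rewrite intrM intrB; ring.
Qed.

(** Bessel's inequality for the characters of frequencies [e n], orthonormal on one period after
    division by [sqrt (2 pi)]: the coefficients of a bounded function are square summable, hence
    tend to 0. A general injective [e] covers the frequencies [N] and [-N] alike. *)
Lemma riemann_lebesgue (B : R -> R[i]) (M : R) (e : nat -> int) :
  injective e -> cmeas B -> (forall t, normc (B t) <= M) ->
  ccvg (fun n => cint (fun t => (box t)%:C * (B t * cis ((e n)%:~R * t)))) 0.
Proof.
move=> einj mB BM; have pi0 := pi_gt0 R.
pose c : R := (Num.sqrt (2 * pi))^-1.
have c2 : c ^+ 2 * (2 * pi) = 1.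
  by rewrite exprVn sqr_sqrtr ?mulVf//; [rewrite gt_eqF// mulr_gt0|rewrite mulr_ge0// ltW].
have c0 : 0 < c by rewrite invr_gt0 sqrtr_gt0 mulr_gt0.
pose f t := (box t)%:C * B t.
pose g n t := c%:C * ((box t)%:C * cis (- (e n)%:~R * t)).
have box2 (h : R -> R[i]) K : cmeas h -> (forall t, normc (h t) <= K) ->
    cL2 (fun t => (box t)%:C * h t).
  move=> mh hK.
  apply: (@cL2_bsupp _ _ (Num.max (Num.max `|(- pi : R)| `|pi : R|) `|K|)).
  - by apply: cmeasM => //; exact: cmeas_ivl.
  - move=> t; rewrite le_max; apply/orP; right.
    rewrite Normc.normcM normcR ger0_norm ?ivl_ge0//.
    apply: le_trans (ler_piMl (normc_ge0 _) (ivl_le1 _ _ _)) _.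
    by rewrite (le_trans (hK t))// ler_norm.
  - by move=> t; rewrite gt_max => /andP[h1 _]; rewrite /box ivl_out// mul0r.
have f2 : cL2 f by exact: box2 mB BM.
have g2 n : cL2 (g n).
  apply: cL2Z; apply: (box2 _ 1); first exact: cmeas_cisM.
  by move=> t; rewrite normc_cis.
have boxbox t : (box t)%:C * (box t)%:C = (box t)%:C :> R[i].
  by rewrite /box /ivl; case: ifP; rewrite ?mulr1 ?mulr0.
have go i j : inner (g i) (g j) = (i == j)%:R.
  rewrite innerE.
  rewrite (_ : (fun _ => _) = fun t => (c ^+ 2)%:C * ((box t)%:C * cis ((e j - e i)%:~R * t))); last first.
    apply/funext => t; rewrite /g !conjcM !conjcR cisJ -mulNr opprK.
    rewrite intrB mulrBl addrC cisD -mulNr.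
    by rewrite -[in RHS]boxbox rmorphXn/=; ring.
  rewrite cintZ; last first.
    apply: (@cintable_ivl _ _ _ _ 1); first exact: cmeas_cisM.
    by move=> t _; rewrite normc_cis.
  rewrite cint_box_cis subr_eq0 (inj_eq einj) eq_sym -rmorphM/= mulrA c2 mul1r.
  by case: eqP.
have E n : inner f (g n) = c%:C * cint (fun t => (box t)%:C * (B t * cis ((e n)%:~R * t))).
  rewrite innerE -cintZ; last first.
    apply: (@cintable_ivl _ _ _ _ M); first by apply: cmeasM => //; exact: cmeas_cisM.
    by move=> t _; rewrite Normc.normcM normc_cis mulr1.
  congr cint; apply/funext => t; rewrite /f /g !conjcM !conjcR cisJ -mulNr opprK.
  by rewrite -[in RHS]boxbox; ring.
have h0 : normc (inner f (g n)) ^+ 2 @[n --> \oo] --> (0 : R).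
  apply: (@cvg0_bounded_sum _ _ (nsq f)) => n; first exact: sqr_ge0.
  by apply: (bessel g2 f2 go); rewrite iota_uniq.
have h1 : normc (inner f (g n)) @[n --> \oo] --> (0 : R).
  rewrite -(sqrtr0 R).
  rewrite (_ : (fun _ => _) = (fun n => Num.sqrt (normc (inner f (g n)) ^+ 2))).
    by apply: (continuous_cvg _ _ h0); exact: sqrt_continuous.
  by apply/funext => n; rewrite sqrtr_sqr ger0_norm// normc_ge0.
apply: (@ccvg_le _ _ _ (fun n => c^-1 * normc (inner f (g n)))).
  move=> n; rewrite E Normc.normcM normcR gtr0_norm// mulrA mulVf ?gt_eqF// mul1r.
  by rewrite subr0.
by rewrite -(mulr0 c^-1); apply: cvgM => //; exact: cvg_cst.
Qed.

End Poisson.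

(** * The test class: Lipschitz functions of compact support *)

Section LipschitzCompact.
Context {R : realType}.
Implicit Types (f g : R -> R[i]) (M x y t : R) (c : R[i]).

(** The Lipschitz bound is what [chernoff] needs at each lattice point, compact support makes the
    Poisson sum finite, and autocorrelation stays in the class. One constant is enough because each
    of the three bounds may be enlarged. *)
Definition lipc M f := [/\ forall x, normc (f x) <= M,
  forall x, M < `|x| -> f x = 0 &
  forall x y, normc (f x - f y) <= M * `|x - y|].

Definition LipC f := exists M, lipc M f.

Lemma lip_continuous (h : R -> R) (L : R) :
  (forall x y, `|h x - h y| <= L * `|x - y|) -> continuous h.
Proof.
move=> hL x; apply/cvgrPdist_le => e e0.
have K0 : 0 < `|L| + 1 by rewrite ltr_wpDl.
near=> y; apply: le_trans (hL _ _) _.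
apply: (@le_trans _ _ ((`|L| + 1) * `|x - y|)).
  by rewrite ler_wpM2r// (le_trans (ler_norm _))// lerDl.
rewrite mulrC -ler_pdivlMr//.
near: y; apply: cvgr_dist_le; last exact: divr_gt0.
exact: cvg_id.
Unshelve. all: end_near. Qed.

Lemma lip_cmeas f (L : R) :
  (forall x y, normc (f x - f y) <= L * `|x - y|) -> cmeas f.
Proof.
move=> fL; split; apply: continuous_measurable_fun; apply: (@lip_continuous _ L) => x y.
  by rewrite -cReN -cReD (le_trans (normRe_le _)).
by rewrite -cImN -cImD (le_trans (normIm_le _)).
Qed.

Lemma lipc_ge0 M f : lipc M f -> 0 <= M.
Proof. by move=> [h _ _]; rewrite (le_trans (normc_ge0 _) (h 0)). Qed.

Lemma lipc_cmeas M f : lipc M f -> cmeas f.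
Proof. by move=> [_ _]; exact: lip_cmeas. Qed.

Lemma lipc_cintable M f : lipc M f -> cintable f.
Proof. by move=> fM; have [h1 h2 h3] := fM; exact: cintable_bsupp (lipc_cmeas fM) h1 h2. Qed.

Lemma lipc_cL2 M f : lipc M f -> cL2 f.
Proof. by move=> fM; have [h1 h2 h3] := fM; exact: cL2_bsupp (lipc_cmeas fM) h1 h2. Qed.

Lemma LipC_cmeas f : LipC f -> cmeas f.
Proof. by move=> [M]; exact: lipc_cmeas. Qed.
Lemma LipC_cintable f : LipC f -> cintable f.
Proof. by move=> [M]; exact: lipc_cintable. Qed.
Lemma LipC_cL2 f : LipC f -> cL2 f.
Proof. by move=> [M]; exact: lipc_cL2. Qed.

Lemma LipC_intro f (B S L : R) : (forall x, normc (f x) <= B) ->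
  (forall x, S < `|x| -> f x = 0) ->
  (forall x y, normc (f x - f y) <= L * `|x - y|) -> LipC f.
Proof.
move=> fB fS fL; exists (Num.max B (Num.max S L)); split.
- by move=> x; rewrite le_max fB.
- by move=> x; rewrite !gt_max => /and3P[_ + _]; exact: fS.
- move=> x y; rewrite (le_trans (fL x y))// ler_wpM2r//.
  by rewrite !le_max lexx !orbT.
Qed.

Lemma LipCD f g : LipC f -> LipC g -> LipC (fun x => f x + g x).
Proof.
move=> [M [f1 f2 f3]] [K [g1 g2 g3]].
apply: (@LipC_intro _ (M + K) (Num.max M K) (M + K)).
- by move=> x; rewrite (le_trans (normcD _ _))// lerD.
- by move=> x; rewrite gt_max => /andP[? ?]; rewrite f2// g2// addr0.
- move=> x y; rewrite (_ : _ - _ = (f x - f y) + (g x - g y)); last by ring.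
  by rewrite (le_trans (normcD _ _))// mulrDl lerD.
Qed.

Lemma LipCM f g (B L : R) : LipC f -> (forall x, normc (g x) <= B) ->
  (forall x y, normc (g x - g y) <= L * `|x - y|) ->
  LipC (fun x => f x * g x).
Proof.
move=> [M fM] gB gL; have M0 := lipc_ge0 fM; have [f1 f2 f3] := fM.
have B0 : 0 <= B by rewrite (le_trans (normc_ge0 _) (gB 0)).
apply: (@LipC_intro _ (M * B) M (M * B + M * L)).
- by move=> x; rewrite Normc.normcM ler_pM// normc_ge0.
- by move=> x /f2 ->; rewrite mul0r.
- move=> x y.
  rewrite (_ : _ - _ = (f x - f y) * g x + f y * (g x - g y)); last by ring.
  rewrite (le_trans (normcD _ _))// !Normc.normcM mulrDl; apply: lerD.
    by rewrite -mulrA [B * _]mulrC mulrA ler_pM ?normc_ge0.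
  by rewrite -mulrA ler_pM ?normc_ge0.
Qed.

Lemma LipCZ c f : LipC f -> LipC (fun x => c * f x).
Proof.
move=> fM; under eq_fun do rewrite mulrC.
apply: (@LipCM _ _ (normc c) 0) => // x y.
by rewrite subrr normc0 mul0r.
Qed.

Lemma LipCJ f : LipC f -> LipC (fun x => cj (f x)).
Proof.
move=> [M [f1 f2 f3]]; exists M; split.
- by move=> x; rewrite normcJ.
- by move=> x /f2 ->; exact: conjc0.
- by move=> x y; rewrite -conjcB normcJ.
Qed.

Lemma LipC_cis f t : LipC f -> LipC (fun x => f x * cis (t * x)).
Proof.
move=> fM; apply: (@LipCM _ _ 1 (2 * `|t|)) => // [x|x y].
  by rewrite normc_cis.
by rewrite (le_trans (normc_cisB _ _))// -mulrBr normrM mulrA.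
Qed.

Lemma LipC_affine f t x : t != 0 -> LipC f -> LipC (fun y => f (t * y + x)).
Proof.
move=> t0 [M fM]; have M0 := lipc_ge0 fM; have [f1 f2 f3] := fM.
apply: (@LipC_intro _ M (`|t|^-1 * (M + `|x|)) (M * `|t|)) => //.
- move=> y; rewrite mulrC ltr_pdivrMr ?normr_gt0// => h; apply: f2.
  rewrite -(ltrD2r `|x|) (lt_le_trans h)// -normrM mulrC.
  by rewrite -{1}(addrK x (t * y)) (le_trans (ler_normB _ _)).
- move=> y z; rewrite (le_trans (f3 _ _))// -mulrA -normrM.
  by rewrite (_ : t * y + x - _ = t * (y - z))//; ring.
Qed.

End LipschitzCompact.

(** * Poisson summation on the test class *)

Section PoissonSummation.
Context {R : realType}.
Implicit Types (t x : R) (N J : nat).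

(* Chernoff's argument: (F t - F 0) / (cis t - 1) is bounded, and multiplying
   the Dirichlet kernel by cis t - 1 leaves two oscillating terms, to which the
   Riemann-Lebesgue lemma applies. *)
Lemma chernoff (F : R -> R[i]) (M L : R) : cmeas F ->
  (forall t, normc (F t) <= M) -> (forall t, normc (F t - F 0) <= L * `|t|) ->
  ccvg (fun N => cint (fun t => (box t)%:C * (F t * dirichlet N t)))
    ((2 * pi)%:C * F 0).
Proof.
move=> mF FM FL; have [c c0 hc] := @normc_cisB1_ge R.
have pi0 := pi_gt0 R.
(* At [t = 0] the quotient is [0 / 0 = 0]; the box contains no other zero of [cis t - 1]. *)
pose B t := (box t)%:C * ((F t - F 0) / (cis t - 1)).
have cis1 t : box t != 0 -> t != 0 -> cis t - 1 != 0.
  rewrite /box /ivl; case: ifPn => [/andP[h1 h2] _ t0|]; last by rewrite eqxx.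
  apply/eqP => h; have := hc t; rewrite h normc0.
  have tpi : `|t| <= pi by rewrite ler_norml h1 ltW.
  by move=> /(_ tpi); rewrite leNgt mulr_gt0// normr_gt0.
have mcis : cmeas (fun t : R => (cis t - 1)^-1).
  have m1 : cmeas (fun t : R => cis t - 1).
    by apply: cmeasB; [exact: cmeas_cis|exact: cmeas_cst].
  have m2 := cmeas_sqr m1.
  rewrite (_ : (fun _ => _) = (fun t => cj (cis t - 1) *
      (((normc (cis t - 1)) ^+ 2)^-1)%:C)).
    apply: cmeasM; first exact: cmeasJ.
    apply: cmeasR; under eq_fun do rewrite -powR_inv1 ?sqr_ge0//.
    exact: (measurableT_comp (measurable_powR _) m2).
  apply/funext => t; have [->|h] := eqVneq (cis t - 1) 0.
    by rewrite invr0 conjc0 mul0r.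
  have hn : normc (cis t - 1) ^+ 2 != 0.
    by apply: expf_neq0; apply: contraNneq h => h0; rewrite (normc_eq0 h0).
  apply: (mulfI h); rewrite mulfV// mulrA mulc_conj -(rmorphM (real_complex R)).
  by rewrite mulfV.
have mB : cmeas B.
  apply: cmeasM; first exact: cmeas_ivl.
  by apply: cmeasM => //; apply: cmeasB => //; exact: cmeas_cst.
have BM t : normc (B t) <= `|L| / c.
  have K0 : 0 <= `|L| / c by rewrite divr_ge0// ltW.
  rewrite /B Normc.normcM normcR.
  have [bt|bt] := eqVneq (box t) 0; first by rewrite bt normr0 mul0r.
  have [->|t0] := eqVneq t 0; first by rewrite subrr mul0r normc0 mulr0.
  have c1 := cis1 t bt t0.
  rewrite Normc.normcM Normc.normcV ger0_norm ?ivl_ge0//.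
  apply: le_trans (ler_piMl _ (ivl_le1 _ _ _)) _.
    by rewrite mulr_ge0 ?invr_ge0 ?normc_ge0.
  have tpi : `|t| <= pi.
    move: bt; rewrite /box /ivl; case: ifPn => [/andP[h1 h2] _|]; last by rewrite eqxx.
    by rewrite ler_norml h1 ltW.
  have cp : 0 < normc (cis t - 1).
    by rewrite (lt_le_trans _ (hc t tpi))// mulr_gt0// normr_gt0.
  rewrite ler_pdivrMr// mulrAC ler_pdivlMr//.
  apply: (@le_trans _ _ (`|L| * (c * `|t|))); last by rewrite ler_wpM2l// hc.
  rewrite mulrA mulrAC ler_pM2r//.
  by rewrite (le_trans (FL t))// ler_wpM2r// ler_norm.
pose I1 N := cint (fun t => (box t)%:C * (B t * cis ((N%:Z)%:~R * t))).
pose I2 N := cint (fun t => (box t)%:C * (B t * cis ((- N%:Z)%:~R * t))).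
have c1 : ccvg I1 0 by apply: riemann_lebesgue BM => // m n [].
have c2 : ccvg I2 0 by apply: riemann_lebesgue BM => // m n /oppr_inj[].
have := ccvgD (ccvg_cst ((2 * pi)%:C * F 0)) (ccvgB c1 c2).
(* [N = 0] is excluded: the kernel is then an empty sum, without the frequency 0 that produces
   [2 pi]. *)
rewrite subrr addr0; apply: ccvg_near; exists 1%N => // N /= N1.
have boxbox t : (box t)%:C * (box t)%:C = (box t)%:C :> R[i].
  by rewrite /box /ivl; case: ifP; rewrite ?mulr1 ?mulr0.
have ID : cint (fun t => (box t)%:C * dirichlet N t) = (2 * pi)%:C.
  rewrite /dirichlet; under eq_fun do rewrite mulr_sumr.
  rewrite cint_sum; last first.
    move=> i; apply: (@cintable_ivl _ _ _ _ 1); first exact: cmeas_cisM.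
    by move=> t _; rewrite normc_cis.
  have NN : (N < N + N)%N by rewrite -[X in (X < _)%N]addn0 ltn_add2l.
  rewrite (bigD1 (Ordinal NN))//= big1 => [|i iN].
    by under eq_fun do rewrite subrr -[0]/(0%:~R); rewrite cint_box_cis eqxx mulr1 addr0.
  under eq_fun do rewrite -[i%:R]/((i%:Z)%:~R) -[N%:R]/((N%:Z)%:~R) -intrB.
  rewrite cint_box_cis subr_eq0.
  suff /negPf -> : i%:Z != N%:Z by rewrite mulr0.
  by apply: contraNneq iN => -[iN]; apply/eqP/val_inj.
have Ic (h : R -> R[i]) : cmeas h -> (forall t, normc (h t) <= `|L| / c) ->
    forall s, cintable (fun t => (box t)%:C * (h t * cis (s * t))).
  move=> mh hM s; apply: (@cintable_ivl _ _ _ _ (`|L| / c)).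
    by apply: cmeasM => //; exact: cmeas_cisM.
  by move=> t _; rewrite Normc.normcM normc_cis mulr1.
rewrite /I1 /I2 -cintB; try exact: Ic.
rewrite -ID mulrC -cintZ; last first.
  apply: (@cintable_ivl _ _ _ _ (N + N)%:R); first exact: cmeas_dirichlet.
  by move=> t _; exact: normc_dirichlet.
rewrite -cintD; last 2 first.
- apply: cintableZ; apply: (@cintable_ivl _ _ _ _ (N + N)%:R).
    exact: cmeas_dirichlet.
  by move=> t _; exact: normc_dirichlet.
- by apply: cintableB; exact: Ic.
congr cint; apply/funext => t.
rewrite mulrNz mulNr -!pmulrn -mulNr -!mulrBr -dirichlet_mul.
rewrite /B [X in _ + X]mulrA [_ * (_ * (_ / _))]mulrA boxbox.
have [bt|bt] := eqVneq (box t) 0; first by rewrite bt !(mul0r,mulr0) addr0.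
have [->|t0] := eqVneq t 0; first by rewrite subrr !(mul0r,mulr0) addr0; ring.
have c3 := cis1 t bt t0.
by field.
Qed.

(** The support of [A] is covered by [2 J + 1] periods centred at the points [2 pi j] with
    [|j| <= J]. The kernel looks the same on each of them, and [chernoff] for the translate of [A]
    extracts the value at the centre. *)
Lemma poisson (A : R -> R[i]) (M : R) J : lipc M A -> M < (J.*2.+1)%:R * pi ->
  ccvg (fun N => cint (fun t => A t * dirichlet N t))
    (\sum_(i < J.*2.+1) (2 * pi)%:C * A (2 * pi * (i%:R - J%:R))).
Proof.
move=> AM MJ; have [A1 A2 A3] := AM; have pi0 := pi_gt0 R.
have mA := lipc_cmeas AM.
pose F (i : 'I_(J.*2.+1)) t := A (t + 2 * pi * (i%:R - J%:R)).
have H i : ccvg (fun N => cint (fun t => (box t)%:C * (F i t * dirichlet N t)))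
    ((2 * pi)%:C * F i 0).
  apply: (@chernoff (F i) M M) => [|t|t]; last 2 first.
  - exact: A1.
  - by rewrite (le_trans (A3 _ _))// add0r addrK.
  have ms : measurable_fun [set: R] (fun t => t + 2 * pi * (i%:R - J%:R)).
    exact: measurable_funD.
  exact: (cmeas_comp ms mA).
have := ccvg_sum (index_enum _) H.
rewrite (_ : \sum_(i <- _) _ =
    \sum_(i < J.*2.+1) (2 * pi)%:C * A (2 * pi * (i%:R - J%:R))); last first.
  by apply: eq_bigr => i _; rewrite /F add0r.
apply: ccvg_near; near=> N.
have IA i : cintable (fun t => (box t)%:C * (F i t * dirichlet N t)).
  apply: (@cintable_ivl _ _ _ _ (M * (N + N)%:R)).
    apply: cmeasM; last exact: cmeas_dirichlet.
    have ms : measurable_fun [set: R] (fun t => t + 2 * pi * (i%:R - J%:R)).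
      exact: measurable_funD.
    exact: (cmeas_comp ms mA).
  move=> t _; rewrite Normc.normcM ler_pM ?normc_ge0//; first exact: A1.
  exact: normc_dirichlet.
transitivity (\sum_(i < J.*2.+1)
   cint (fun t => (box (t - 2 * pi * (i%:R - J%:R)))%:C * (A t * dirichlet N t))).
  apply: eq_bigr => i _.
  rewrite -(cint_shift (- (2 * pi * (i%:R - J%:R))) (IA i)).
  congr cint; apply/funext => t; congr (_ * (_ * _)).
    by rewrite /F subrK.
  have := @dirichlet_period R N t (J%:Z - i%:Z).
  by rewrite intrB -!pmulrn => <-; congr dirichlet; ring.
rewrite -cint_sum; last first.
  move=> i; have := cintable_shift (- (2 * pi * (i%:R - J%:R))) (IA i).
  rewrite (_ : (fun _ => _) = fun t => (box (t - 2 * pi * (i%:R - J%:R)))%:C * (A t * dirichlet N t))//.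
  apply/funext => t; congr (_ * (_ * _)).
    by rewrite /F subrK.
  have := @dirichlet_period R N t (J%:Z - i%:Z).
  by rewrite intrB -!pmulrn => <-; congr dirichlet; ring.
congr cint; apply/funext => t; rewrite -mulr_suml.
have JR : (J.*2.+1)%:R = J%:R * 2 + 1 :> R.
  by rewrite -(addn1 (J.*2)) natrD -muln2 natrM.
(* Left end of the union of the periods: the translated boxes tile [[a, - a[], and [A] vanishes
   outside. *)
pose a : R := - (J.*2.+1)%:R * pi.
rewrite (eq_bigr (fun i : 'I_(J.*2.+1) =>
    (ivl a (a + 2 * pi) (t - 2 * pi * i%:R))%:C)); last first.
  move=> i _; congr (_%:C); rewrite /box /ivl /a JR.
  by congr (if _ then _ else _); congr andb; apply/idP/idP => h; lra.
rewrite sum_ivlC; last by rewrite mulr_gt0.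
have -> : a + 2 * pi * (J.*2.+1)%:R = (J.*2.+1)%:R * pi by rewrite /a; ring.
rewrite /ivl /a; case: ifPn => [_|h]; first by rewrite mul1r.
rewrite mulNr in h; rewrite A2 ?mul0r ?mulr0// (lt_le_trans MJ)//.
rewrite leNgt; apply: contra h; rewrite ltr_norml => /andP[h1 h2].
by rewrite ltW.
Unshelve. all: end_near. Qed.

End PoissonSummation.

(** * Integrals as limits over growing intervals *)

Section Exhaustion.
Context {R : realType}.
Local Notation mu := (@lebesgue_measure R).

(** Monotone convergence. Integrability of [h] is part of the conclusion: this is how a Fourier
    transform is found to be square integrable. *)
Lemma rint_exhaust (h : R -> R) (l : R) : measurable_fun [set: R] h ->
  (forall x, 0 <= h x) ->
  (forall N : nat, rintable (fun x => ivl (- N%:R) N%:R x * h x)) ->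
  rint (fun x => ivl (- N%:R) N%:R x * h x) @[N --> \oo] --> l ->
  rintable h /\ rint h = l.
Proof.
move=> mh h0 Ih hl.
pose g N x := (ivl (- (N%:R : R)) N%:R x * h x)%:E.
have gh x : g ^~ x @ \oo --> (h x)%:E.
  apply: cvg_EFin; first exact: nearW.
  apply: (@cvg_near_cst _ _ _ _ _ eventually_filter).
  near=> N; rewrite /= /ivl ifT ?mul1r//.
  have : `|x| < N%:R by near: N; exact: nbhs_infty_gtr.
  by rewrite ltr_norml => /andP[/ltW -> ->].
have [g0 mg] : (forall N x, [set: R] x -> (0 <= g N x)%E) /\
    (forall N, measurable_fun [set: R] (g N)).
  split=> [N x _|N]; first by rewrite lee_fin mulr_ge0// ivl_ge0.
  by apply/measurable_EFinP; exact: rintableM.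
have ndg x : [set: R] x -> {homo g ^~ x : m n / (m <= n)%N >-> (m <= n)%E}.
  move=> _ m n mn; rewrite lee_fin ler_wpM2r// /ivl.
  have mnR : m%:R <= n%:R :> R by rewrite ler_nat.
  case: ifPn => [/andP[h1 h2]|_]; last by case: ifP.
  by rewrite ifT// (lt_le_trans h2)// andbT (le_trans _ h1)// lerN2.
have /= := cvg_monotone_convergence measurableT mg g0 ndg (mu := mu).
have Eg N : (\int[mu]_x g N x =
    (rint (fun x => ivl (- N%:R) N%:R x * h x))%:E)%E by rewrite rintE.
under eq_fun do rewrite Eg.
rewrite (_ : (\int[mu]_x _)%E = \int[mu]_x (h x)%:E)%E; last first.
  by apply: eq_integral => x _; apply/cvg_lim => //; exact: gh.
move=> cI.
have cl : (rint (fun x => ivl (- N%:R) N%:R x * h x))%:E @[N --> \oo] --> l%:E.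
  by apply: cvg_EFin => //; exact: nearW.
have E : (\int[mu]_x (h x)%:E = l%:E)%E.
  exact: (cvg_unique _ cI cl).
have If : rintable h.
  apply/integrableP; split; first exact/measurable_EFinP.
  under eq_integral do rewrite gee0_abs ?lee_fin//.
  by rewrite E ltry.
by split => //; apply: EFin_inj; rewrite rintE.
Unshelve. all: end_near. Qed.

End Exhaustion.

(** * Fourier transform and autocorrelation of test functions *)

Section FourierLipC.
Context {R : realType}.
Implicit Types (f g G H : R -> R[i]) (x y t s M : R) (c : R[i]).

Lemma fourier_cintable G x : cintable G -> cintable (fun y => G y * cis (y * x)).
Proof.
move=> IG; apply: (@cintable_le _ _ (fun y => normc (G y))).
- apply: cmeasM; first exact: cintable_cmeas.
  by under eq_fun do rewrite mulrC; exact: cmeas_cisM.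
- by move=> y; rewrite Normc.normcM normc_cis mulr1.
- exact: cintable_normc.
Qed.

Lemma fourierD f g x : cintable f -> cintable g ->
  fourier (fun y => f y + g y) x = fourier f x + fourier g x.
Proof.
move=> If Ig; rewrite !fourierE -cintD; try exact: fourier_cintable.
by under eq_fun do rewrite mulrDl.
Qed.

Lemma fourierZ c f x : cintable f ->
  fourier (fun y => c * f y) x = c * fourier f x.
Proof.
move=> If; rewrite !fourierE -cintZ; last exact: fourier_cintable.
by under eq_fun do rewrite -mulrA.
Qed.

Lemma normc_fourier f x : cintable f ->
  normc (fourier f x) <= rint (fun y => normc (f y)).
Proof.
move=> If; rewrite fourierE.
apply: le_trans (normc_cint (fourier_cintable x If)) _.
by under eq_fun do rewrite Normc.normcM normc_cis mulr1.
Qed.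

Lemma fourier_lip M f x y : lipc M f ->
  normc (fourier f x - fourier f y) <=
    2 * M * rint (fun y => normc (f y)) * `|x - y|.
Proof.
move=> fM; have If := lipc_cintable fM; have [f1 f2 _] := fM.
have M0 := lipc_ge0 fM.
rewrite !fourierE -cintB; try exact: fourier_cintable.
have I2 : cintable (fun z => f z * cis (z * x) - f z * cis (z * y)).
  by apply: cintableB; exact: fourier_cintable.
apply: le_trans (normc_cint I2) _.
rewrite mulrAC -rintZ; last exact: cintable_normc.
apply: le_rint; [exact: cintable_normc| |].
  by apply: rintableZ; exact: cintable_normc.
move=> z; rewrite -mulrBr Normc.normcM mulrC.
have [zM|/f2 ->] := leP `|z| M; last by rewrite normc0 !mulr0.
rewrite ler_wpM2r ?normc_ge0// (le_trans (normc_cisB _ _))//.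
by rewrite -mulrBr normrM -mulrA ler_wpM2l// ler_wpM2r.
Qed.

Lemma fourier_cmeas f : LipC f -> cmeas (fourier f).
Proof.
move=> [M fM]; apply: (@lip_cmeas _ _ (2 * M * rint (fun y => normc (f y)))) => x y.
exact: fourier_lip.
Qed.

Definition autocorr G t : R[i] := cint (fun x => G (x + t) * cj (G x)).

Lemma LipC_autocorr_integrand G t : LipC G -> LipC (fun x => G (x + t) * cj (G x)).
Proof.
move=> LG; have [M [g1 g2 g3]] := LG.
under eq_fun do rewrite mulrC.
apply: (@LipCM _ (fun x => cj (G x)) (fun x => G (x + t)) M M (LipCJ LG)).
  by move=> x; exact: g1.
by move=> x y; rewrite (le_trans (g3 _ _))// (_ : x + t - _ = x - y)//; ring.
Qed.

Lemma LipC_autocorr G : LipC G -> LipC (autocorr G).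
Proof.
move=> LG; have [M GM] := LG; have [g1 g2 g3] := GM; have M0 := lipc_ge0 GM.
have IG := lipc_cintable GM.
have nI := cintable_normc IG.
have I0 : 0 <= rint (fun x => normc (G x)).
  by apply: rint_ge0 => x; exact: normc_ge0.
have IA t := LipC_cintable (LipC_autocorr_integrand t LG).
apply: (@LipC_intro _ _ (M * rint (fun x => normc (G x))) (M + M)
  (M * rint (fun x => normc (G x)))).
- move=> t; apply: le_trans (normc_cint (IA t)) _.
  rewrite -rintZ//; apply: le_rint; [exact: cintable_normc|exact: rintableZ|].
  by move=> x; rewrite Normc.normcM normcJ ler_wpM2r// normc_ge0.
- move=> t tM; rewrite /autocorr -[RHS]cint0; congr cint; apply/funext => x.
  have [xM|/g2 ->] := leP `|x| M; last by rewrite conjc0 mulr0.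
  rewrite g2 ?mul0r// -(ltrD2r M) (lt_le_trans tM)//.
  rewrite -{1}(addKr x t) addrC (le_trans (ler_normD _ _))// normrN.
  by rewrite lerD2l.
- move=> t s; rewrite /autocorr -cintB//.
  apply: le_trans (normc_cint (cintableB (IA t) (IA s))) _.
  rewrite mulrAC -rintZ//; apply: le_rint; [|exact: rintableZ|].
    by apply: cintable_normc; exact: cintableB.
  move=> x; rewrite -mulrBl Normc.normcM normcJ ler_wpM2r ?normc_ge0//.
  by rewrite (le_trans (g3 _ _))// (_ : x + t - _ = t - s)//; ring.
Qed.

Lemma autocorr0 G : autocorr G 0 = (nsq G)%:C.
Proof.
by rewrite /autocorr -inner_nsq innerE; under eq_fun do rewrite addr0.
Qed.

(** After Fubini, a shift by [y] in the inner integral produces [fourier G x] and leaves the factor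
    [cj (G y * cis (y * x))], whose integral is the conjugate of [fourier G x]. *)
Lemma fourier_autocorr G x : LipC G ->
  fourier (autocorr G) x = (normc (fourier G x) ^+ 2)%:C.
Proof.
move=> LG; have [M GM] := LG; have [g1 g2 g3] := GM; have M0 := lipc_ge0 GM.
have IA t := LipC_cintable (LipC_autocorr_integrand t LG).
rewrite fourierE.
pose f (z : R * R) := G (z.2 + z.1) * cj (G z.2) * cis (z.1 * x).
transitivity (cint (fun t => cint (fun y => f (t, y)))).
  congr cint; apply/funext => t; rewrite mulrC -cintZ//.
  by congr cint; apply/funext => y; rewrite /f/= mulrC.
rewrite (@cint_fubini _ f (Num.max (M * M) (M + M))); last 3 first.
- have mG := lipc_cmeas GM.
  apply: cmeasM; first apply: cmeasM.
  + have m1 : measurable_fun [set: R * R] (fun z : R * R => z.2 + z.1).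
      by apply: measurable_funD => //.
    exact: (cmeas_comp m1 mG).
  + apply: cmeasJ; exact: (cmeas_comp (@measurable_snd _ _ R R) mG).
  + have m1 : measurable_fun [set: R * R] (fun z : R * R => z.1 * x).
      by apply: measurable_funM => //.
    exact: (cmeas_comp m1 cmeas_cis).
- move=> z; rewrite le_max /f !Normc.normcM normc_cis mulr1 normcJ.
  by rewrite ler_pM ?normc_ge0.
- move=> [t y] /= h; rewrite /f/=.
  have [yM|/g2 ->] := leP `|y| M; last by rewrite conjc0 mulr0 mul0r.
  rewrite g2 ?mul0r//; case: h; rewrite gt_max => /andP[_ h].
    rewrite -(ltrD2r M) (lt_le_trans h)//.
    rewrite -{1}(addKr y t) addrC (le_trans (ler_normD _ _))// normrN.
    by rewrite lerD2l.
  by have := le_lt_trans yM (le_lt_trans _ h); rewrite ltxx lerDl => /(_ M0).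
transitivity (cint (fun y => fourier G x * cj (G y * cis (y * x)))).
  congr cint; apply/funext => y.
  have IG := fourier_cintable x (lipc_cintable GM).
  rewrite mulrC fourierE -(cint_shift y IG) -cintZ; last exact: (cintable_shift y IG).
  congr cint; apply/funext => t; rewrite /f/= conjcM cisJ.
  rewrite mulrDl cisD; have := cis_mulN (y * x).
  rewrite (addrC y t) => e.
  rewrite (_ : cj _ * _ * _ = G (t + y) * cj (G y) * cis (t * x) *
     (cis (y * x) * cis (- (y * x)))); last by ring.
  by rewrite e mulr1.
have IG := fourier_cintable x (lipc_cintable GM).
by rewrite cintZ ?cintJ// ?mulc_conj//; exact: cintableJ.
Qed.

End FourierLipC.

(** * Plancherel's theorem on the test class *)

Section Plancherel.
Context {R : realType}.
Implicit Types (f g G H : R -> R[i]) (x y t s M : R) (c : R[i]).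

Lemma cint_unit_cis (k : int) :
  cint (fun s : R => (ivl 0 1 s)%:C * cis (2 * pi * k%:~R * s)) = (k == 0)%:R.
Proof.
have pi0 := pi_gt0 R; have pi2 : 2 * pi != 0 :> R by rewrite gt_eqF// mulr_gt0.
have Ib : cintable (fun t : R => (box t)%:C * cis (k%:~R * t)).
  apply: (@cintable_ivl _ _ _ _ 1); first exact: cmeas_cisM.
  by move=> t _; rewrite normc_cis.
have I1 : cintable (fun s : R => (ivl 0 1 s)%:C * cis (2 * pi * k%:~R * s)).
  apply: (@cintable_ivl _ _ _ _ 1); first exact: cmeas_cisM.
  by move=> t _; rewrite normc_cis.
have := cint_affine (- pi) pi2 Ib; rewrite cint_box_cis.
have -> : (fun x : R => (box (2 * pi * x - pi))%:C * cis (k%:~R * (2 * pi * x - pi))) =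
    (fun s => cis (k%:~R * - pi) * ((ivl 0 1 s)%:C * cis (2 * pi * k%:~R * s))).
  apply/funext => s.
  rewrite (_ : k%:~R * (2 * pi * s - pi) = k%:~R * - pi + 2 * pi * k%:~R * s); last by ring.
  rewrite cisD.
  rewrite (_ : box _ = ivl 0 1 s); first by ring.
  rewrite /box /ivl; congr (if _ then _ else _); congr andb.
    by apply/idP/idP => h; nra.
  by apply/idP/idP => h; nra.
rewrite cintZ// => h; apply: (mulfI (cis_neq0 (k%:~R * - pi))); rewrite h.
rewrite gtr0_norm ?mulr_gt0//.
have [->|k0] := eqVneq k 0; last by rewrite !mulr0.
by rewrite mulr1 mul0r cis0 mulr1 -rmorphM/= mulVf.
Qed.

Lemma dirichlet_fourier G N s : LipC G ->
  cint (fun t => autocorr G t * cis (s * t) * dirichlet N t) =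
  (\sum_(i < N + N) normc (fourier G (s + (i%:R - N%:R))) ^+ 2)%:C.
Proof.
move=> LG; have IA := LipC_cintable (LipC_autocorr LG).
rewrite rmorph_sum/=.
under eq_bigr do rewrite -fourier_autocorr//.
rewrite -cint_sum; last by move=> i; exact: fourier_cintable.
congr cint; apply/funext => t; rewrite /dirichlet mulr_sumr.
apply: eq_bigr => i _; rewrite -mulrA -cisD; congr (_ * cis _); ring.
Qed.

(** The constant does not depend on [s], so that one number of periods serves Poisson summation for
    all shifts [s] at once. *)
Lemma lipc_cis M f s : lipc M f -> `|s| <= 1 ->
  lipc (3 * M) (fun t => f t * cis (s * t)).
Proof.
move=> fM s1; have M0 := lipc_ge0 fM; have [f1 f2 f3] := fM.
have M3 : M <= 3 * M by lra.
split.
- by move=> x; rewrite Normc.normcM normc_cis mulr1 (le_trans (f1 x)).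
- by move=> x xM; rewrite f2 ?mul0r// (le_lt_trans _ xM).
- move=> x y.
  rewrite (_ : _ - _ = (f x - f y) * cis (s * x) + f y * (cis (s * x) - cis (s * y))); last by ring.
  rewrite (le_trans (normcD _ _))// !Normc.normcM normc_cis mulr1.
  have -> : 3 * M = M + 2 * M by ring.
  rewrite mulrDl lerD// mulrC -mulrA [M * _]mulrC mulrA.
  rewrite ler_pM ?normc_ge0// (le_trans (normc_cisB _ _))// ler_wpM2l//.
  by rewrite -mulrBr normrM ler_piMl.
Qed.

Lemma measurable_fourier_sqr G : LipC G ->
  measurable_fun [set: R] (fun x => normc (fourier G x) ^+ 2).
Proof. by move=> /fourier_cmeas /cmeas_sqr. Qed.

Lemma fourier_sqr_le G x : LipC G ->
  normc (fourier G x) ^+ 2 <= rint (fun y => normc (G y)) ^+ 2.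
Proof.
move=> LG; rewrite ler_sqr ?nnegrE ?normc_ge0//.
  exact: normc_fourier (LipC_cintable LG).
by apply: rint_ge0 => y; exact: normc_ge0.
Qed.

Lemma sum_unit_translates (h : R -> R) N (K : R) :
  measurable_fun [set: R] h -> (forall x, `|h x| <= K) ->
  rint (fun s => ivl 0 1 s * \sum_(i < N + N) h (s + (i%:R - N%:R))) =
  rint (fun x => ivl (- N%:R) N%:R x * h x).
Proof.
move=> mh hK.
have Ii i : rintable (fun s => ivl 0 1 s * h (s + (i%:R - N%:R))).
  apply: (@rintable_ivl _ _ _ _ K) => //.
  have ms : measurable_fun [set: R] (fun s : R => s + (i%:R - N%:R)).
    exact: measurable_funD.
  exact: (measurableT_comp mh ms).
under eq_fun do rewrite mulr_sumr.
rewrite rint_sum//.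
have Ei (i : 'I_(N + N)) : (fun x => ivl (- N%:R) (- N%:R + 1) (x - 1 * i%:R) * h x) =
    (fun s => (fun s => ivl 0 1 s * h (s + (i%:R - N%:R))) (s + - (i%:R - N%:R))).
  apply/funext => x; congr (_ * h _); last by ring.
  rewrite /ivl; congr (if _ then _ else _); congr andb; apply/idP/idP; lra.
transitivity (\sum_(i < N + N)
    rint (fun x => ivl (- N%:R) (- N%:R + 1) (x - 1 * i%:R) * h x)).
  by apply: eq_bigr => i _; rewrite Ei (rint_shift _ (Ii i)).
rewrite -rint_sum; last by move=> i; rewrite Ei; exact: (rintable_shift _ (Ii i)).
congr rint; apply/funext => x; rewrite -mulr_suml sum_ivl//.
by rewrite mul1r natrD addKr.
Qed.

(** Poisson summation for [autocorr G], modulated by [cis (s * t)], evaluates the sum of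
    [|fourier G|^2] over the integers shifted by [s] as the real part of a trigonometric polynomial
    [P s]. Integration over [s] from 0 to 1 recovers the integral over the line on one side, and on
    the other keeps only the constant term [2 pi * autocorr G 0]. *)
Theorem plancherel G : LipC G ->
  cL2 (fourier G) /\ nsq (fourier G) = 2 * pi * nsq G.
Proof.
move=> LG; have pi0 := pi_gt0 R.
have [M AM] := LipC_autocorr LG.
have M0 := lipc_ge0 AM.
pose A := autocorr G.
pose h x := normc (fourier G x) ^+ 2.
have mh := measurable_fourier_sqr LG.
pose K := rint (fun y => normc (G y)) ^+ 2.
have h0 x : 0 <= h x by exact: sqr_ge0.
have hK x : `|h x| <= K by rewrite ger0_norm// fourier_sqr_le.
have [J JM] : exists J : nat, 3 * M < (J.*2.+1)%:R * pi.
  near \oo => J; exists J.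
  have : M * 3 / pi < J%:R by near: J; exact: nbhs_infty_gtr.
  rewrite ltr_pdivrMr// => h1.
  rewrite mulrC (lt_le_trans h1)// ler_wpM2r ?(ltW pi0)// ler_nat.
  by rewrite -addnn -addnS leq_addr.
pose P s : R[i] := \sum_(j < J.*2.+1)
  (2 * pi)%:C * (A (2 * pi * (j%:R - J%:R)) * cis (s * (2 * pi * (j%:R - J%:R)))).
pose S N s := \sum_(i < N + N) h (s + (i%:R - N%:R)).
have SP s : `|s| <= 1 -> S N s @[N --> \oo] --> complex.Re (P s).
  move=> s1; have := poisson (lipc_cis AM s1) JM.
  move/ccvg_Re; under eq_fun do rewrite dirichlet_fourier//.
  by [].
(* Increasing partial sums stay below their limit; the bound [KP] of that limit provides the
   domination needed to integrate over [s]. *)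
have Snd s : {homo S ^~ s : m n / (m <= n)%N >-> m <= n}.
  apply: homo_leq; [by []|by move=> ? ? ?; exact: le_trans|move=> N].
  have -> : S N.+1 s = h (s + (0 - N.+1%:R)) + S N s + h (s + ((N + N).+1%:R - N.+1%:R)).
    rewrite /S addnS big_ord_recr/= addSn big_ord_recl/=; congr (_ + _ + _).
    apply: eq_bigr => i _; congr h.
    by rewrite /bump/= add1n -(addn1 i) -(addn1 N) !natrD; ring.
  by rewrite addrAC lerDr addr_ge0.
have Sle N s : `|s| <= 1 -> S N s <= complex.Re (P s).
  move=> s1; have cS := SP s s1; rewrite -(cvg_lim _ cS)//.
  by apply: nondecreasing_cvgn_le; [exact: Snd|apply/cvg_ex; exists (complex.Re (P s))].
pose KP := \sum_(j < J.*2.+1) 2 * pi * normc (A (2 * pi * (j%:R - J%:R))).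
have PK s : complex.Re (P s) <= KP.
  rewrite (le_trans (ler_norm _))// (le_trans (normRe_le _))//.
  apply: le_trans (normc_sum _ _) _; apply: ler_sum => j _.
  by rewrite !Normc.normcM normc_cis mulr1 normcR gtr0_norm// mulr_gt0.
have S0 N s : 0 <= S N s by apply: sumr_ge0.
have mS N : measurable_fun [set: R] (S N).
  apply: measurable_sum => i.
  have ms : measurable_fun [set: R] (fun s : R => s + (i%:R - N%:R)).
    exact: measurable_funD.
  exact: (measurableT_comp mh ms).
have ivl1 s : ivl 0 1 s != 0 -> `|s| <= 1.
  rewrite /ivl; case: ifPn => [/andP[h1 h2] _|]; last by rewrite eqxx.
  by rewrite ger0_norm// ltW.
have [||||IP cP] := @rint_dct R (fun N s => ivl 0 1 s * S N s)
    (fun s => ivl 0 1 s * complex.Re (P s)) (fun s => KP * ivl 0 1 s).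
- by move=> N; apply: measurable_funM => //; exact: measurable_ivl.
- apply: rintableZ.
  have : rintable (fun s : R => ivl 0 1 s * cst 1 s).
    by apply: (@rintable_ivl _ _ _ (cst 1) 1) => // t _; rewrite normr1.
  by under eq_fun do rewrite mulr1.
- move=> N s; have [->|s1] := eqVneq (ivl 0 1 s) 0.
    by rewrite mul0r mulr0 normr0.
  rewrite ger0_norm ?mulr_ge0 ?ivl_ge0// mulrC ler_wpM2r ?ivl_ge0//.
  by rewrite (le_trans (Sle N s (ivl1 _ s1))).
- move=> s; have [->|s1] := eqVneq (ivl 0 1 s) 0.
    by rewrite mul0r; under eq_fun do rewrite mul0r; exact: cvg_cst.
  by apply: cvgM; [exact: cvg_cst|exact: SP (ivl1 _ s1)].
have EP : rint (fun s => ivl 0 1 s * complex.Re (P s)) = 2 * pi * nsq G.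
  have -> : 2 * pi * nsq G = complex.Re (cint (fun s => (ivl 0 1 s)%:C * P s)).
    pose Q (j : 'I_(J.*2.+1)) s := (2 * pi)%:C * A (2 * pi * (j%:R - J%:R)) *
      ((ivl 0 1 s)%:C * cis (2 * pi * (j%:Z - J%:Z)%:~R * s)).
    have Iu (k : int) : cintable (fun s : R => (ivl 0 1 s)%:C * cis (2 * pi * k%:~R * s)).
      apply: (@cintable_ivl _ _ _ _ 1); first exact: cmeas_cisM.
      by move=> t _; rewrite normc_cis.
    have -> : (fun s => (ivl 0 1 s)%:C * P s) = (fun s => \sum_(j < J.*2.+1) Q j s).
      apply/funext => s; rewrite /P mulr_sumr; apply: eq_bigr => j _.
      rewrite /Q intrB -!pmulrn [s * _]mulrC; ring.
    rewrite cint_sum; last by move=> j; apply: cintableZ.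
    have JJ : (J < J.*2.+1)%N by rewrite ltnS -addnn leq_addr.
    rewrite (bigD1 (Ordinal JJ))//= big1 => [|j jJ].
      rewrite addr0 /Q cintZ// cint_unit_cis !subrr eqxx mulr1 mulr0.
      by rewrite /A autocorr0 -rmorphM.
    rewrite /Q cintZ// cint_unit_cis subr_eq0.
    suff /negPf -> : j%:Z != J%:Z by rewrite mulr0.
    by apply: contraNneq jJ => -[jJ]; apply/eqP/val_inj.
  rewrite Re_cint; congr rint; apply/funext => s.
  by rewrite cReM/= mul0r subr0.
move: cP; rewrite EP => cP.
have [||||Ih Eh] := @rint_exhaust R h (2 * pi * nsq G) => //.
- by move=> N; apply: (@rintable_ivl _ _ _ _ K).
- apply: cvg_trans cP; apply: near_eq_cvg; apply: nearW => N.
  by rewrite (@sum_unit_translates h N K).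
split; last exact: Eh.
by split => //; exact: fourier_cmeas.
Unshelve. all: end_near. Qed.

(** Polarisation: comparing the norms of [G + c H] for [c = 1] and [c = i] gives the real and the
    imaginary part. *)
Lemma plancherel_inner G H : LipC G -> LipC H ->
  inner (fourier G) (fourier H) = (2 * pi)%:C * inner G H.
Proof.
move=> LG LH.
have [fG EG] := plancherel LG; have [fH EH] := plancherel LH.
have G2 := LipC_cL2 LG; have H2 := LipC_cL2 LH.
have key c : complex.Re (inner (fourier G) (fun x => c * fourier H x)) =
    2 * pi * complex.Re (inner G (fun x => c * H x)).
  have LcH := LipCZ c LH; have [fcH EcH] := plancherel LcH.
  have [_ ED] := plancherel (LipCD LG LcH).
  have Ec : fourier (fun x => c * H x) = (fun x => c * fourier H x).
    by apply/funext => x; rewrite fourierZ//; exact: LipC_cintable.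
  move: ED; rewrite (_ : fourier _ = fun x => fourier G x + c * fourier H x); last first.
    apply/funext => x; rewrite fourierD ?Ec//; exact: LipC_cintable.
  rewrite nsqD//; last exact: cL2Z.
  rewrite (nsqD G2 (cL2Z c H2)) EG -Ec EcH => ED.
  rewrite Ec in ED *.
  have two : (2 : R) != 0 by [].
  apply: (mulfI two); move: ED; rewrite !mulrDr => /addIr /addrI ->; ring.
have k1 := key 1; have ki := key (0 +i* 1).
rewrite !innerZr// in k1 ki.
move: k1 ki; rewrite conjc1 !mul1r.
move: (inner _ _) (inner _ _) => [a b] [a' b']; rewrite !cReM/=.
rewrite !mul0r !mulN1r !opprK !add0r => k1 ki.
by apply: complex_eq; rewrite ?(cReM,cImM)/= ?k1 ?ki; ring.
Qed.

End Plancherel.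

(** * Meyer's window and the bell *)

Section MeyerWindow.
Context {R : realType}.
Implicit Types (w : R -> R) (x y t : R).

(** Up to normalisation, [w] is the Fourier transform of Meyer's scaling function, and the last
    identity expresses the orthonormality of its integer translates. *)
Definition meyer_window w :=
  [/\ forall x, 0 <= w x <= 1,
      exists L, forall x y, `|w x - w y| <= L * `|x - y|,
      forall x, w (- x) = w x &
      [/\ forall x, `|x| <= 2 * pi / 3 -> w x = 1,
          forall x, 4 * pi / 3 <= `|x| -> w x = 0 &
          forall x, 0 <= x <= 2 * pi -> w x ^+ 2 + w (2 * pi - x) ^+ 2 = 1]].

(** A square root of [w (x / 2) ^+ 2 - w x ^+ 2] (see [bell_sqr]) in the form of a polynomial in
    values of [w], to which derivative bounds for [w] carry over. *)
Definition bell w x : R := w (x / 2) * (w (x - 2 * pi) + w (x + 2 * pi)).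

Definition meyer_hat w x : R[i] := (bell w x)%:C * cis (2^-1 * x).

Section Identities.
Variable w : R -> R.
Hypothesis mw : meyer_window w.

Lemma window_eq1 x : - (2 * pi / 3) <= x <= 2 * pi / 3 -> w x = 1.
Proof. by move=> h; case: mw => _ _ _ [h1 _ _]; apply: h1; rewrite ler_norml. Qed.

Lemma window_eq0 x : x <= - (4 * pi / 3) \/ 4 * pi / 3 <= x -> w x = 0.
Proof.
move=> h; case: mw => _ _ _ [_ h0 _]; apply: h0; case: h => h.
  by rewrite -normrN (le_trans _ (ler_norm _))// lerNr.
by rewrite (le_trans h)// ler_norm.
Qed.

Lemma window_even x : w (- x) = w x.
Proof. by case: mw. Qed.

Lemma bell_even x : bell w (- x) = bell w x.
Proof.
rewrite /bell (_ : - x - 2 * pi = - (x + 2 * pi)); last by ring.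
rewrite (_ : - x + 2 * pi = - (x - 2 * pi)); last by ring.
by rewrite mulNr !window_even addrC.
Qed.

(** On [[0, 2 pi]], [w (x - 2 pi) ^+ 2] is [1 - w x ^+ 2], and [w (x / 2)] is 1 wherever [w x] is
    nonzero. Beyond [2 pi], [w x] is 0, and [w (x - 2 pi)] is 1 as long as [w (x / 2)] is
    nonzero. *)
Lemma bell_sqr x : bell w x ^+ 2 = w (x / 2) ^+ 2 - w x ^+ 2.
Proof.
have pi0 := pi_gt0 R.
wlog x0 : x / 0 <= x => [H|].
  have [|xN] := leP 0 x; first exact: H.
  by have := H (- x); rewrite bell_even mulNr !window_even; apply; rewrite oppr_ge0 ltW.
rewrite /bell (@window_eq0 (x + 2 * pi)); last by right; lra.
rewrite addr0.
have [x1|x1] := leP x (2 * pi); last first.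
  rewrite (@window_eq0 x); last by right; lra.
  have [x2|x2] := leP x (8 * pi / 3).
    by rewrite (@window_eq1 (x - 2 * pi)) ?mulr1 ?expr0n ?subr0//=; lra.
  by rewrite (@window_eq0 (x / 2)) ?mul0r ?expr0n ?subr0//=; right; lra.
have h : w x ^+ 2 + w (2 * pi - x) ^+ 2 = 1.
  by case: mw => _ _ _ [_ _]; apply; rewrite x0.
rewrite exprMn -[x - 2 * pi]opprB window_even.
rewrite (_ : w (2 * pi - x) ^+ 2 = 1 - w x ^+ 2); last by rewrite -[in RHS]h; ring.
have [x2|x2] := leP x (4 * pi / 3).
  by rewrite (@window_eq1 (x / 2)) ?expr1n ?mul1r//; lra.
by rewrite (@window_eq0 x) ?expr0n/= ?subr0 ?mulr1//; right; lra.
Qed.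

(** Both sides vanish outside [-4 pi / 3 < x < -2 pi / 3], and there the half-scale factors
    [w (x / 2)] and [w ((x + 2 pi) / 2)] are 1. *)
Lemma bell_mul2pi x : bell w (x + 2 * pi) * bell w x = w (x + 2 * pi) * w x.
Proof.
have pi0 := pi_gt0 R.
rewrite /bell.
have -> : x + 2 * pi - 2 * pi = x by ring.
have [x1|x1] := leP x (- (4 * pi / 3)).
  rewrite (@window_eq0 x); last by left.
  rewrite add0r mulr0.
  have [x2|x2] := leP x (- (8 * pi / 3)).
    by rewrite (@window_eq0 (x / 2)) ?mul0r ?mulr0//; left; lra.
  by rewrite (@window_eq0 (x + 2 * pi + 2 * pi)) ?mulr0 ?mul0r//; right; lra.
have [x2|x2] := ltP x (- (2 * pi / 3)).
  rewrite (@window_eq1 (x / 2)); last by lra.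
  rewrite (@window_eq1 ((x + 2 * pi) / 2)); last by lra.
  rewrite (@window_eq0 (x - 2 * pi)); last by left; lra.
  rewrite (@window_eq0 (x + 2 * pi + 2 * pi)); last by right; lra.
  by rewrite !mul1r addr0 add0r mulrC.
rewrite (@window_eq0 (x + 2 * pi)); last by right; lra.
rewrite mul0r addr0.
have [x3|x3] := leP (2 * pi / 3) x.
  by rewrite (@window_eq0 ((x + 2 * pi) / 2)) ?mul0r//; right; lra.
by rewrite (@window_eq0 (x - 2 * pi)) ?mulr0//; left; lra.
Qed.

(** The overlap is now [-8 pi / 3 < x < -4 pi / 3], where the second factors of both bells are 1.
    What remains is the right-hand side of [bell_mul2pi] at the doubled scale, which allows the
    levels to telescope. *)
Lemma bell_mul4pi x :
  bell w (x + 4 * pi) * bell w x = w (x / 2 + 2 * pi) * w (x / 2).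
Proof.
have pi0 := pi_gt0 R.
rewrite /bell (_ : (x + 4 * pi) / 2 = x / 2 + 2 * pi); last by lra.
have [x1|x1] := leP x (- (8 * pi / 3)).
  by rewrite (@window_eq0 (x / 2)) ?(mul0r,mulr0)//; left; lra.
have [x2|x2] := leP (- (4 * pi / 3)) x.
  by rewrite (@window_eq0 (x / 2 + 2 * pi)) ?(mul0r,mulr0)//; right; lra.
rewrite (@window_eq1 (x + 4 * pi - 2 * pi)); last by lra.
rewrite (@window_eq1 (x + 2 * pi)); last by lra.
rewrite (@window_eq0 (x - 2 * pi)); last by left; lra.
rewrite (@window_eq0 (x + 4 * pi + 2 * pi)); last by right; lra.
by rewrite addr0 add0r !mulr1.
Qed.

(** The support of the bell has diameter at most [16 pi / 3], which is less than [6 pi]; hence only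
    the shifts 0, [2 pi] and [4 pi] matter. *)
Lemma bell_mul_far x t : 6 * pi <= t -> bell w (x + t) * bell w x = 0.
Proof.
have pi0 := pi_gt0 R.
move=> t6; rewrite /bell.
have [x1|x1] := leP x (- (8 * pi / 3)).
  by rewrite (@window_eq0 (x / 2)) ?(mul0r,mulr0)//; left; lra.
by rewrite (@window_eq0 ((x + t) / 2)) ?mul0r//; right; lra.
Qed.

Lemma window_bound x : `|w x| <= 1.
Proof. by case: mw => /(_ x)/andP[h0 h1] _ _ _; rewrite ger0_norm. Qed.

Lemma bell_out x : 8 * pi / 3 <= `|x| -> bell w x = 0.
Proof.
move=> h; rewrite /bell; case: mw => _ _ _ [_ h0 _].
rewrite h0 ?mul0r// normrM (_ : `|2^-1| = 2^-1 :> R); last by rewrite ger0_norm.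
lra.
Qed.

Lemma LipC_meyer_hat : LipC (meyer_hat w).
Proof.
have pi0 := pi_gt0 R.
have [L wL] : exists L, forall x y, `|w x - w y| <= L * `|x - y| by case: mw.
apply: LipC_cis; apply: (@LipC_intro _ _ 2 (8 * pi / 3) (2 * `|L| + 2 * `|L|)).
- move=> x; rewrite normcR /bell normrM.
  rewrite -[leRHS]mul1r ler_pM// ?window_bound//.
  rewrite (le_trans (ler_normD _ _))//.
  by rewrite -[leRHS]/(1 + 1 : R) lerD ?window_bound.
- by move=> x h; rewrite bell_out// ltW.
- move=> x y.
  rewrite (_ : (bell w x)%:C - _ = (bell w x - bell w y)%:C); last by rewrite rmorphB.
  rewrite normcR /bell.
  have wL' u v : `|w u - w v| <= `|L| * `|u - v|.
    by rewrite (le_trans (wL u v))// ler_wpM2r// ler_norm.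
  set A := w (x / 2); set A' := w (y / 2).
  set B := w (x - 2 * pi) + w (x + 2 * pi).
  set B' := w (y - 2 * pi) + w (y + 2 * pi).
  have AA : `|A - A'| <= `|L| * `|x - y|.
    rewrite (le_trans (wL' _ _))// -mulrBl normrM.
    rewrite (_ : `|2^-1| = 2^-1 :> R); last by rewrite ger0_norm.
    have : 0 <= `|L| * `|x - y| by rewrite mulr_ge0.
    by lra.
  have BB : `|B - B'| <= 2 * `|L| * `|x - y|.
    rewrite (_ : B - B' = (w (x - 2 * pi) - w (y - 2 * pi)) +
      (w (x + 2 * pi) - w (y + 2 * pi))); last by rewrite /B /B'; ring.
    rewrite (le_trans (ler_normD _ _))//.
    rewrite (_ : 2 * `|L| * _ = `|L| * `|x - y| + `|L| * `|x - y|); last by ring.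
    rewrite lerD// (le_trans (wL' _ _))//.
      by rewrite (_ : x - 2 * pi - _ = x - y)//; ring.
    by rewrite (_ : x + 2 * pi - _ = x - y)//; ring.
  have B2 : `|B| <= 2.
    rewrite (le_trans (ler_normD _ _))//.
    by rewrite -[leRHS]/(1 + 1 : R) lerD ?window_bound.
  have A1 : `|A'| <= 1 by exact: window_bound.
  rewrite (_ : A * B - A' * B' = (A - A') * B + A' * (B - B')); last by ring.
  rewrite (le_trans (ler_normD _ _))// !normrM mulrDl; apply: lerD.
    by rewrite -mulrA mulrC ler_pM.
  by rewrite -[leRHS]mul1r ler_pM.
Qed.

Lemma measurable_window a b : measurable_fun [set: R] (fun x => w (a * x + b)).
Proof.
have [L wL] : exists L, forall x y, `|w x - w y| <= L * `|x - y| by case: mw.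
apply: measurableT_comp (measurable_affine a b).
by apply: continuous_measurable_fun; exact: lip_continuous wL.
Qed.

End Identities.
End MeyerWindow.

Section Scaling.
Context {R : realType}.

Lemma rint_scale (f : R -> R) a : 0 < a -> rintable f ->
  rint (fun x => f (a * x)) = a^-1 * rint f.
Proof.
move=> a0 If; have an : a != 0 by rewrite gt_eqF.
have := rint_affine 0 an If; rewrite gtr0_norm// => <-.
by congr rint; apply/funext => x; rewrite addr0.
Qed.

Lemma rintable_scale (f : R -> R) a : 0 < a -> rintable f ->
  rintable (fun x => f (a * x)).
Proof.
move=> a0 If; have an : a != 0 by rewrite gt_eqF.
have := rintable_affine 0 an If.
by under eq_fun do rewrite addr0.
Qed.

Lemma cint_scale (f : R -> R[i]) a : 0 < a -> cintable f ->
  cint (fun x => f (a * x)) = (a^-1)%:C * cint f.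
Proof.
move=> a0 If; have an : a != 0 by rewrite gt_eqF.
have := cint_affine 0 an If; rewrite gtr0_norm// => <-.
by congr cint; apply/funext => x; rewrite addr0.
Qed.

Lemma cintable_scale (f : R -> R[i]) a : 0 < a -> cintable f ->
  cintable (fun x => f (a * x)).
Proof.
move=> a0 If; have an : a != 0 by rewrite gt_eqF.
have := cintable_affine 0 an If.
by under eq_fun do rewrite addr0.
Qed.

End Scaling.

Lemma realCM {R : realType} (x y : R) : (x * y)%:C = x%:C * y%:C :> R[i].
Proof. exact: (rmorphM (real_complex R)). Qed.

Lemma cRe_sum {R : realType} (I : Type) (s : seq I) (P : pred I) (F : I -> R[i]) :
  complex.Re (\sum_(i <- s | P i) F i) = \sum_(i <- s | P i) complex.Re (F i).
Proof.
elim: s => [|i s IHs]; first by rewrite !big_nil.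
by rewrite !big_cons; case: ifP => _; rewrite ?cReD IHs.
Qed.

(** * The energy of one dyadic level *)

Section FrameLevel.
Context {R : realType}.
Implicit Types (x y t s a c : R) (N : nat).
Variable w : R -> R.
Hypothesis mw : meyer_window w.
Variables (H : R -> R[i]) (B L : R).
Hypotheses (HB : forall x, normc (H x) <= B)
  (HL : forall x y, normc (H x - H y) <= L * `|x - y|) (H2 : cL2 H).

(** For [a = 2^m], [c = 2^(m/2)] and [s = n] this is the Fourier transform of the wavelet of index
    [(m, n)]. *)
Definition atom a c s x : R[i] :=
  (c^-1)%:C * (meyer_hat w (a^-1 * x) * cis (s * (a^-1 * x))).

Let Phi a x : R[i] := cj (meyer_hat w x) * H (a * x).

Let LipC_Phi a : LipC (Phi a).
Proof.
apply: (@LipCM _ (fun x => cj (meyer_hat w x)) (fun x => H (a * x)) B (L * `|a|)).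
- by apply: LipCJ; exact: LipC_meyer_hat.
- by move=> x; exact: HB.
- by move=> x y; rewrite (le_trans (HL _ _))// -mulrBr normrM mulrA.
Qed.

(** Rescaling turns the coefficients of one level into samples of a single Fourier transform.
    [Phi a] takes its compact support from the bell, so Poisson summation applies although [H],
    later a Fourier transform, is not compactly supported. *)
Lemma inner_atom a c s : 0 < a -> c ^+ 2 = a ->
  inner H (atom a c s) = c%:C * fourier (Phi a) (- s).
Proof.
move=> a0 c2; have an : a != 0 by rewrite gt_eqF.
have cn : c != 0 by apply: contraNneq an => c0; rewrite -c2 c0 expr0n.
pose g x := Phi a x * cis (x * - s).
have Ig : cintable g.
  by apply: fourier_cintable; apply: LipC_cintable.
have ai : 0 < a^-1 by rewrite invr_gt0.
rewrite innerE fourierE -[cint (fun x => Phi a x * _)]/(cint g).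
have -> : (fun x => H x * cj (atom a c s x)) = (fun x => (c^-1)%:C * g (a^-1 * x)).
  apply/funext => x; rewrite /atom /g /Phi !conjcM !conjcR cisJ mulVKf//.
  rewrite (_ : a^-1 * x * - s = - (s * (a^-1 * x))); last by ring.
  by rewrite cisJ; ring.
rewrite cintZ; last exact: (cintable_scale ai Ig).
rewrite cint_scale// mulrA invrK -rmorphM/=; congr (_%:C * _).
by rewrite -c2 expr2 mulKf.
Qed.

(** [2 pi * lowZ s] is the energy of [H] along the translates of the scaling function at scale [s]:
    in its Poisson sum [lowY] is the term 0, [lowX] the term 1, and the conjugate of [lowX] the term
    -1. *)
Definition lowY s : R := rint (fun x => normc (H x) ^+ 2 * w (s^-1 * x) ^+ 2).
Definition lowXf s x : R[i] :=
  H (x + 2 * pi * s) * cj (H x) * (w (s^-1 * x + 2 * pi) * w (s^-1 * x))%:C.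
Definition lowX s : R[i] := cint (lowXf s).
Definition lowZ s : R := lowY s + 2 * complex.Re (lowX s).

Let mwaff a b : measurable_fun [set: R] (fun x => w (a * x + b)).
Proof. exact: measurable_window. Qed.

Let mwmul a : measurable_fun [set: R] (fun x => w (a * x)).
Proof. by have := mwaff a 0; under eq_fun do rewrite addr0. Qed.

Lemma rintable_sqr_window (u : R -> R) : measurable_fun [set: R] u ->
  (forall x, `|u x| <= 1) -> rintable (fun x => normc (H x) ^+ 2 * u x).
Proof.
move=> mu u1; apply: (@rintable_le _ _ (fun x => normc (H x) ^+ 2)).
- by apply: measurable_funM => //; exact: cmeas_sqr H2.1.
- by move=> x; rewrite normrM ger0_norm ?sqr_ge0// ler_piMr// sqr_ge0.
- exact: H2.2.
Qed.

Let win1 x : `|w x| <= 1. Proof. exact: window_bound. Qed.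

Let win2 x y : `|w x * w y| <= 1.
Proof. by rewrite normrM -[leRHS]mulr1 ler_pM. Qed.

Let IY s : rintable (fun x => normc (H x) ^+ 2 * w (s^-1 * x) ^+ 2).
Proof.
by apply: rintable_sqr_window => [|x]; [exact: measurable_funX|rewrite expr2].
Qed.

Lemma lowX_cintable s : 0 < s -> cintable (lowXf s).
Proof.
move=> s0; apply: (@cintable_bsupp _ _ (Num.max (B * B) (s * (4 * pi / 3)))).
- apply: cmeasM; last by apply: cmeasR; exact: measurable_funM.
  apply: cmeasM; last exact: cmeasJ H2.1.
  have ms : measurable_fun [set: R] (fun x => x + 2 * pi * s).
    exact: measurable_funD.
  exact: (cmeas_comp ms H2.1).
- move=> x; rewrite le_max !Normc.normcM normcR normcJ.
  rewrite (_ : _ <= B * B)// -[leRHS]mulr1.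
  by rewrite !ler_pM// ?mulr_ge0 ?normc_ge0.
- move=> x; rewrite gt_max => /andP[_ h]; rewrite /lowXf.
  case: mw => _ _ _ [_ h0 _].
  rewrite (h0 (s^-1 * x)) ?mulr0//.
  by rewrite normrM gtr0_norm ?invr_gt0// ler_pdivlMl// ltW.
Qed.

Let nsq_Phi a : 0 < a -> a * nsq (Phi a) = lowY (2 * a) - lowY a.
Proof.
move=> a0; have an : a != 0 by rewrite gt_eqF.
pose g x := normc (H x) ^+ 2 * w ((2 * a)^-1 * x) ^+ 2 -
   normc (H x) ^+ 2 * w (a^-1 * x) ^+ 2.
have Ig : rintable g by apply: rintableB.
have -> : nsq (Phi a) = rint (fun x => g (a * x)).
  congr rint; apply/funext => x; rewrite /Phi Normc.normcM normcJ /meyer_hat.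
  rewrite Normc.normcM normcR normc_cis mulr1 exprMn real_normK ?num_real//.
  rewrite (bell_sqr mw) /g mulKf// (_ : (2 * a)^-1 * (a * x) = x / 2).
    by ring.
  by field.
rewrite rint_scale// mulrA mulfV// mul1r.
by rewrite /g rintB.
Qed.

(** A shift by [2 pi] turns the phase [e^(ix/2)] by [pi]. This is the origin of the sign, and the
    reason for the factor 1/2 in the phase. *)
Let autocorr_Phi2 a : 0 < a -> a%:C * autocorr (Phi a) (2 * pi) = - lowX a.
Proof.
move=> a0; have an : a != 0 by rewrite gt_eqF.
have -> : autocorr (Phi a) (2 * pi) = - cint (fun x => lowXf a (a * x)).
  rewrite -cintN; last exact: (cintable_scale a0 (lowX_cintable a0)).
  congr cint; apply/funext => x.
  rewrite /Phi /lowXf !conjcM !conjcC mulKf// -(bell_mul2pi mw) realCM.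
  rewrite /meyer_hat ?(conjcM,conjcC,conjcR,cisJ).
  rewrite (_ : 2^-1 * (x + 2 * pi) = 2^-1 * x + pi); last by field.
  rewrite (_ : a * (x + 2 * pi) = a * x + 2 * pi * a); last by ring.
  rewrite opprD cisD -(cisJ pi) cis_pi conjcN conjc1.
  have := cis_mulN (2^-1 * x); set u := cis _; set v := cis _ => e.
  rewrite (_ : _ * _ * _ * _ = - ((u * v) * (H (a * x + 2 * pi * a) *
     cj (H (a * x)) * ((bell w (x + 2 * pi))%:C * (bell w x)%:C)))); last by ring.
  by rewrite e mul1r.
by rewrite (cint_scale a0 (lowX_cintable a0)) mulrN mulrA -rmorphM/= mulfV// mul1r.
Qed.

(** Here the phase makes a full turn, so the sign is positive, and [bell_mul4pi] moves the cross
    term to scale [2 a]. *)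
Let autocorr_Phi4 a : 0 < a -> a%:C * autocorr (Phi a) (4 * pi) = lowX (2 * a).
Proof.
move=> a0; have an : a != 0 by rewrite gt_eqF.
have a20 : 0 < 2 * a by rewrite mulr_gt0.
have -> : autocorr (Phi a) (4 * pi) = cint (fun x => lowXf (2 * a) (a * x)).
  congr cint; apply/funext => x.
  rewrite /Phi /lowXf !conjcM !conjcC.
  rewrite (_ : (2 * a)^-1 * (a * x) = x / 2); last by field.
  rewrite -(bell_mul4pi mw) realCM.
  rewrite /meyer_hat ?(conjcM,conjcC,conjcR,cisJ).
  rewrite (_ : 2^-1 * (x + 4 * pi) = 2^-1 * x + 2 * pi * 1%:~R); last by rewrite mulr1z; field.
  rewrite (_ : a * (x + 4 * pi) = a * x + 2 * pi * (2 * a)); last by ring.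
  rewrite opprD cisD -(cisJ (2 * pi * 1%:~R)) cis_2pi conjc1.
  have := cis_mulN (2^-1 * x); set u := cis _; set v := cis _ => e.
  rewrite (_ : _ * _ * _ * _ = ((u * v) * (H (a * x + 2 * pi * (2 * a)) *
     cj (H (a * x)) * ((bell w (x + 4 * pi))%:C * (bell w x)%:C)))); last by ring.
  by rewrite e mul1r.
by rewrite (cint_scale a0 (lowX_cintable a20)) mulrA -rmorphM/= mulfV// mul1r.
Qed.

Let autocorr_far a t : 6 * pi <= t -> autocorr (Phi a) t = 0.
Proof.
move=> t6; rewrite /autocorr -[RHS]cint0; congr cint; apply/funext => x.
rewrite /Phi /meyer_hat ?(conjcM,conjcC,conjcR).
have := bell_mul_far mw x t6 => /(congr1 (real_complex R)); rewrite realCM => e.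
set u := (bell w (x + t))%:C in e *; set v := (bell w x)%:C in e *.
rewrite (_ : _ * _ * _ = (u * v) * (cj (cis (2^-1 * (x + t))) * H (a * (x + t)) *
   cis (2^-1 * x) * cj (H (a * x)))); last by ring.
by rewrite e mul0r.
Qed.

Lemma autocorrN (G : R -> R[i]) t : LipC G -> autocorr G (- t) = cj (autocorr G t).
Proof.
move=> LG; have I1 := LipC_cintable (LipC_autocorr_integrand t LG).
have I2 := LipC_cintable (LipC_autocorr_integrand (- t) LG).
rewrite /autocorr -cintJ// -(cint_shift t I2).
by congr cint; apply/funext => x; rewrite addrK conjcM conjcC mulrC.
Qed.

Lemma sum_symmetric (f : R -> R) J :
  \sum_(j < J.*2.+1) f (j%:R - J%:R) =
  f 0 + \sum_(k < J) (f k.+1%:R + f (- k.+1%:R)).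
Proof.
elim: J => [|J IHJ]; first by rewrite big_ord_recl !big_ord0 subrr.
rewrite doubleS big_ord_recr/= big_ord_recl/= [in RHS]big_ord_recr/=.
rewrite (eq_bigr (fun j : 'I_(J.*2.+1) => f (j%:R - J%:R))); last first.
  move=> i _; congr f; rewrite /bump/= add1n -(addn1 i) -(addn1 J) !natrD.
  by ring.
rewrite IHJ sub0r (_ : J.*2.+2%:R - J.+1%:R = J.+1%:R :> R).
  by ring.
by rewrite -muln2 -(addn1 J) -(addn2 (J * 2)) !natrD natrM; ring.
Qed.

(** Poisson summation for the autocorrelation of [Phi a] leaves five terms. After multiplication by
    [a] the central one is [lowY (2 a) - lowY a]; in real parts the pair [+-1] gives [- lowX a]
    twice and the pair [+-2] gives [lowX (2 a)] twice. *)
Lemma frame_level a c : 0 < a -> c ^+ 2 = a ->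
  \sum_(i < N + N) normc (inner H (atom a c (N%:R - i%:R))) ^+ 2
    @[N --> \oo] --> 2 * pi * (lowZ (2 * a) - lowZ a).
Proof.
move=> a0 c2; have pi0 := pi_gt0 R.
have LP := LipC_Phi a.
have [M AM] := LipC_autocorr LP.
(* [J.+2] rather than [J], so that the terms [+-1] and [+-2] are certain to occur in the sum. *)
have [J JM] : exists J : nat, 3 * M < (J.+2.*2.+1)%:R * pi.
  near \oo => J; exists J.
  have : M * 3 / pi < J%:R by near: J; exact: nbhs_infty_gtr.
  rewrite ltr_pdivrMr// => h1.
  rewrite mulrC (lt_le_trans h1)// ler_wpM2r ?(ltW pi0)// ler_nat.
  by rewrite !doubleS -addnn -!addnS leq_addr.
have s0 : `|0 : R| <= 1 by rewrite normr0.
have /ccvg_Re := poisson (lipc_cis AM s0) JM.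
under eq_fun do rewrite dirichlet_fourier//.
pose f x := complex.Re (autocorr (Phi a) (2 * pi * x)).
have fN x : f (- x) = f x.
  by rewrite /f mulrN (autocorrN _ LP) cReJ.
have ffar x : 3 <= x -> f x = 0.
  move=> x3; rewrite /f autocorr_far//.
  have : 2 * pi * 3 <= 2 * pi * x by rewrite ler_wpM2l// mulr_ge0// ltW.
  by move=> h; apply: le_trans h; lra.
have -> : complex.Re (\sum_(j < J.+2.*2.+1) (2 * pi)%:C *
    (autocorr (Phi a) (2 * pi * (j%:R - J.+2%:R)) *
     cis (0 * (2 * pi * (j%:R - J.+2%:R))))) =
    2 * pi * (f 0 + 2 * f 1 + 2 * f 2).
  transitivity (2 * pi * \sum_(j < J.+2.*2.+1) f (j%:R - J.+2%:R)).
    rewrite mulr_sumr cRe_sum.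
    by apply: eq_bigr => j _; rewrite mul0r cis0 mulr1 cReM/= mul0r subr0.
  congr (_ * _); rewrite sum_symmetric !big_ord_recl/= big1 => [|i _].
    by rewrite !fN; ring.
  by rewrite !fN ffar ?addr0// /bump/= !add1n ler_nat.
move=> h; have := cvgM (cvg_cst a) h.
have -> : a * (2 * pi * (f 0 + 2 * f 1 + 2 * f 2)) =
    2 * pi * (lowZ (2 * a) - lowZ a).
  have e0 : a * f 0 = lowY (2 * a) - lowY a.
    by rewrite /f mulr0 autocorr0 -nsq_Phi.
  have e1 : a * f 1 = - complex.Re (lowX a).
    by rewrite -cReN -autocorr_Phi2// cReM/= mul0r subr0 /f mulr1.
  have e2 : a * f 2 = complex.Re (lowX (2 * a)).
    rewrite -autocorr_Phi4// cReM/= mul0r subr0 /f.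
    by rewrite (_ : 2 * pi * 2 = 4 * pi)//; ring.
  rewrite /lowZ (_ : a * _ = 2 * pi * (a * f 0 + 2 * (a * f 1) + 2 * (a * f 2))).
    by rewrite e0 e1 e2; ring.
  by ring.
move=> hc; apply: cvg_trans (hc _ _); apply: near_eq_cvg; apply: nearW => N.
rewrite [LHS]mulr_sumr; apply: eq_bigr => i _.
rewrite inner_atom// Normc.normcM exprMn normcR real_normK ?num_real// c2.
by rewrite add0r opprB.
Unshelve. all: end_near. Qed.

End FrameLevel.

(** * Limits of the low-frequency energy at large and small scales *)

Section FrameLimits.
Context {R : realType}.
Implicit Types (x y t s a c : R) (k : nat).
Variable w : R -> R.
Hypothesis mw : meyer_window w.
Variables (H : R -> R[i]) (B L : R).
Hypotheses (HB : forall x, normc (H x) <= B)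
  (HL : forall x y, normc (H x - H y) <= L * `|x - y|) (H2 : cL2 H).

Let mwaff a b : measurable_fun [set: R] (fun x => w (a * x + b)).
Proof. exact: measurable_window. Qed.

Let mwmul a : measurable_fun [set: R] (fun x => w (a * x)).
Proof. by have := mwaff a 0; under eq_fun do rewrite addr0. Qed.

Let mwin : measurable_fun [set: R] w.
Proof. by have := mwmul 1; under eq_fun do rewrite mul1r. Qed.

Let win1 x : `|w x| <= 1. Proof. exact: window_bound. Qed.

Let win2 x y : `|w x * w y| <= 1.
Proof. by rewrite normrM -[leRHS]mulr1 ler_pM. Qed.

Definition weighted (u : R -> R) r := rint (fun x => normc (H x) ^+ 2 * u (r * x)).

Lemma weighted_cvg (u : R -> R) (r : nat -> R) l :
  (forall a, measurable_fun [set: R] (fun x => u (a * x))) ->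
  (forall x, `|u x| <= 1) ->
  (forall x, \forall k \near \oo, u (r k * x) = l) ->
  weighted u (r k) @[k --> \oo] --> l * nsq H.
Proof.
move=> mu u1 ul.
have [|||_ +] := @rint_dct R (fun k x => normc (H x) ^+ 2 * u (r k * x))
  (fun x => l * normc (H x) ^+ 2) (fun x => normc (H x) ^+ 2) _ H2.2.
- by move=> k; apply: measurable_funM => //; exact: cmeas_sqr H2.1.
- by move=> k x; rewrite normrM ger0_norm ?sqr_ge0// ler_piMr// sqr_ge0.
- move=> x; apply: (@cvg_near_cst _ _ _ _ _ eventually_filter).
  by apply: filterS (ul x) => k ->; rewrite mulrC.
- by rewrite rintZ//; exact: H2.2.
Qed.

Lemma expr2n_gt (C : R) : \forall k \near \oo, C < 2 ^+ k.
Proof.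
near=> k; have : C < k%:R by near: k; exact: nbhs_infty_gtr.
by move=> /lt_le_trans; apply; rewrite -natrX ler_nat ltnW// ltn_expl.
Unshelve. all: end_near. Qed.

Lemma near_small x (e : R) : 0 < e -> \forall k \near \oo, `|(2 ^+ k)^-1 * x| <= e.
Proof.
move=> e0; apply: filterS (expr2n_gt (`|x| / e)) => k hk.
rewrite normrM gtr0_norm ?invr_gt0 ?exprn_gt0//.
by rewrite ler_pdivrMl ?exprn_gt0// mulrC -ler_pdivrMl// mulrC ltW.
Qed.

Lemma near_large x (e : R) : x != 0 -> \forall k \near \oo, e <= `|2 ^+ k * x|.
Proof.
move=> x0; apply: filterS (expr2n_gt (e / `|x|)) => k hk.
rewrite normrM gtr0_norm ?exprn_gt0//.
by rewrite -ler_pdivrMr ?normr_gt0// ltW.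
Qed.

(** [u1] and [u2] vanish both for [|x| <= 2 pi / 3] and for [|x| >= 4 pi / 3], so that the cross
    term disappears at both ends of the scale. *)
Let u1 x := w x * w (x - 2 * pi).
Let u2 x := w (x + 2 * pi) * w x.

Let u_small x : `|x| <= 2 * pi / 3 -> u1 x = 0 /\ u2 x = 0.
Proof.
rewrite ler_norml => /andP[h1 h2]; have pi0 := pi_gt0 R.
split; first by rewrite /u1 (window_eq0 mw (x := x - 2 * pi)) ?mulr0//; left; lra.
by rewrite /u2 (window_eq0 mw (x := x + 2 * pi)) ?mul0r//; right; lra.
Qed.

Let u_large x : 4 * pi / 3 <= `|x| -> u1 x = 0 /\ u2 x = 0.
Proof.
move=> h; case: mw => _ _ _ [_ h0 _].
by split; rewrite /u1 /u2 (h0 x)// ?mul0r ?mulr0.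
Qed.

Let e1 : 0 < 2 * pi / 3 :> R.
Proof. by rewrite divr_gt0// mulr_gt0// pi_gt0. Qed.

Let u_at_small x : \forall k \near \oo, u1 ((2 ^+ k)^-1 * x) = 0 /\ u2 ((2 ^+ k)^-1 * x) = 0.
Proof. by apply: filterS (near_small x e1) => k; exact: u_small. Qed.

Let u_at_large x : \forall k \near \oo, u1 (2 ^+ k * x) = 0 /\ u2 (2 ^+ k * x) = 0.
Proof.
have [->|x0] := eqVneq x 0.
  apply: nearW => k; rewrite mulr0; apply: u_small.
  by rewrite normr0 ltW.
by apply: filterS (near_large (4 * pi / 3) x0) => k; exact: u_large.
Qed.

Let mu1 a : measurable_fun [set: R] (fun x => u1 (a * x)).
Proof. by apply: measurable_funM => //; exact: mwaff. Qed.

Let mu2 a : measurable_fun [set: R] (fun x => u2 (a * x)).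
Proof. by apply: measurable_funM => //; exact: mwaff. Qed.

(** The inequality [p q <= (p^2 + q^2) / 2] for the moduli of [H] at [x + 2 pi s] and at [x];
    translating the first term back turns its weight into [u1]. *)
Lemma lowX_le s : 0 < s ->
  normc (lowX w H s) <= 2^-1 * (weighted u1 s^-1 + weighted u2 s^-1).
Proof.
move=> s0; have sn : s != 0 by rewrite gt_eqF.
have I1 : rintable (fun x => normc (H x) ^+ 2 * u1 (s^-1 * x)).
  by apply: (rintable_sqr_window H2) => // x; exact: win2.
have I2 : rintable (fun x => normc (H x) ^+ 2 * u2 (s^-1 * x)).
  by apply: (rintable_sqr_window H2) => // x; exact: win2.
have I1' := rintable_shift (2 * pi * s) I1.
have IX := @lowX_cintable R w mw H B HB H2 s s0.
apply: le_trans (normc_cint IX) _.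
rewrite /weighted -(rint_shift (2 * pi * s) I1) -rintD// -rintZ; last exact: rintableD.
apply: le_rint; [exact: cintable_normc|apply: rintableZ; exact: rintableD|].
move=> x; rewrite /lowXf !Normc.normcM normcR normcJ /u1 /u2.
rewrite (_ : s^-1 * (x + 2 * pi * s) = s^-1 * x + 2 * pi); last by field.
rewrite addrK.
have [w0 w1] : 0 <= w (s^-1 * x) /\ 0 <= w (s^-1 * x + 2 * pi).
  by case: mw => h _ _ _; split; [have /andP[] := h (s^-1 * x)|have /andP[] := h (s^-1 * x + 2 * pi)].
rewrite ger0_norm ?mulr_ge0//.
set W := w _ * w _; have W0 : 0 <= W by rewrite mulr_ge0.
set p := normc (H (x + _)); set q := normc (H x).
have pq : 0 <= (p - q) ^+ 2 by exact: sqr_ge0.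
have -> : 2^-1 * (p ^+ 2 * W + q ^+ 2 * W) = p * q * W + 2^-1 * ((p - q) ^+ 2 * W).
  by field.
by rewrite lerDl mulr_ge0 ?invr_ge0// mulr_ge0.
Qed.

Let lowX_cvg0 (s : nat -> R) : (forall k, 0 < s k) ->
  (forall x, \forall k \near \oo, u1 ((s k)^-1 * x) = 0 /\ u2 ((s k)^-1 * x) = 0) ->
  complex.Re (lowX w H (s k)) @[k --> \oo] --> (0 : R).
Proof.
move=> s0 su.
have c1 : weighted u1 (s k)^-1 @[k --> \oo] --> 0 * nsq H.
  apply: (@weighted_cvg u1 (fun k => (s k)^-1)) => [//|x|x].
    exact: win2.
  by apply: filterS (su x) => k [].
have c2 : weighted u2 (s k)^-1 @[k --> \oo] --> 0 * nsq H.
  apply: (@weighted_cvg u2 (fun k => (s k)^-1)) => [//|x|x].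
    exact: win2.
  by apply: filterS (su x) => k [].
rewrite mul0r in c1 c2.
have h : 2^-1 * (weighted u1 (s k)^-1 + weighted u2 (s k)^-1) @[k --> \oo] --> (0 : R).
  have e : (0 : R) = 2^-1 * (0 + 0) by rewrite addr0 mulr0.
  by rewrite [X in _ --> X]e; apply: cvgM; [exact: cvg_cst|exact: cvgD].
have : ccvg (fun k => lowX w H (s k)) 0.
  by apply: ccvg_le h => k; rewrite subr0; exact: lowX_le.
by move/ccvg_Re.
Qed.

Lemma lowZ_cvgy : lowZ w H (2 ^+ k) @[k --> \oo] --> nsq H.
Proof.
have cX : complex.Re (lowX w H (2 ^+ k)) @[k --> \oo] --> (0 : R).
  by apply: lowX_cvg0 => // k; rewrite exprn_gt0.
have cY : lowY w H (2 ^+ k) @[k --> \oo] --> nsq H.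
  have := @weighted_cvg (fun x => w x ^+ 2) (fun k => (2 ^+ k)^-1) 1.
  rewrite mul1r; apply.
  - by move=> a; exact: measurable_funX.
  - by move=> x; rewrite expr2.
  - move=> x; apply: filterS (near_small x e1) => k h.
    by case: mw => _ _ _ [h1 _ _]; rewrite h1// expr1n.
have e : nsq H = nsq H + 2 * 0 by rewrite mulr0 addr0.
rewrite [X in _ --> X]e; apply: cvgD; first exact: cY.
by apply: cvgM; [exact: cvg_cst|exact: cX].
Qed.

(** Since [H] is bounded by [B], [lowY] at scale [2^-k] is at most [B ^+ 2 * 2^-k] times the
    integral of [w ^+ 2]. *)
Lemma lowZ_cvg0 : lowZ w H (2 ^+ k)^-1 @[k --> \oo] --> (0 : R).
Proof.
have cX : complex.Re (lowX w H (2 ^+ k)^-1) @[k --> \oo] --> (0 : R).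
  apply: lowX_cvg0 => [k|x]; first by rewrite invr_gt0 exprn_gt0.
  by under eq_near do rewrite invrK; exact: u_at_large.
have Iw : rintable (fun x => w x ^+ 2).
  apply: (@rintable_bsupp _ _ (Num.max 1 (4 * pi / 3))).
  - exact: measurable_funX.
  - by move=> x; rewrite le_max expr2 win2.
  - move=> x; rewrite gt_max => /andP[_ h].
    by case: mw => _ _ _ [_ h0 _]; rewrite h0 ?expr0n// ltW.
have cY : lowY w H (2 ^+ k)^-1 @[k --> \oo] --> (0 : R).
  apply: (@squeeze_cvgr _ _ _ _ (fun=> 0)
    (fun k => (B ^+ 2 * rint (fun x => w x ^+ 2)) * (2 ^+ k)^-1)).
  - near=> k; have k0 : 0 < 2 ^+ k :> R by rewrite exprn_gt0.
    apply/andP; split.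
      by apply: rint_ge0 => x; rewrite mulr_ge0// sqr_ge0.
    rewrite /lowY invrK -mulrA [rint _ * _]mulrC -(rint_scale k0 Iw).
    rewrite -rintZ; last exact: (rintable_scale k0 Iw).
    apply: le_rint.
    + apply: (rintable_sqr_window H2); first exact: measurable_funX.
      by move=> x; rewrite expr2.
    + by apply: rintableZ; exact: (rintable_scale k0 Iw).
    + move=> x; rewrite ler_wpM2r ?sqr_ge0//.
      by rewrite ler_sqr ?nnegrE ?normc_ge0// (le_trans (normc_ge0 _) (HB 0)).
  - exact: cvg_cst.
  - have e : (0 : R) = B ^+ 2 * rint (fun x => w x ^+ 2) * 0 by rewrite mulr0.
    rewrite [X in _ --> X]e; apply: cvgM; first exact: cvg_cst.
    apply/cvgrPdist_le => eps eps0; apply: filterS (near_small 1 eps0) => k.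
    by rewrite mulr1 sub0r normrN.
have e : (0 : R) = 0 + 2 * 0 by rewrite mulr0 addr0.
rewrite [X in _ --> X]e; apply: cvgD; first exact: cY.
by apply: cvgM; [exact: cvg_cst|exact: cX].
Unshelve. all: end_near. Qed.

End FrameLimits.

Lemma ler_sum_subset {R : numDomainType} (I : eqType) (F : I -> R) (s t : seq I) :
  (forall i, 0 <= F i) -> uniq s -> {subset s <= t} ->
  \sum_(i <- s) F i <= \sum_(i <- t) F i.
Proof.
move=> F0; elim: s t => [|x s IHs] t /=; first by rewrite big_nil sumr_ge0.
move=> /andP[xs us] st; have xt : x \in t by rewrite st// mem_head.
rewrite (perm_big _ (perm_to_rem xt))/= !big_cons lerD2l IHs// => y ys.
have yt : y \in t by rewrite st// inE ys orbT.
by apply: rem_mem => //; apply: contraNneq xs => <-.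
Qed.

(** * The frame identity over all levels *)

Section DyadicFrame.
Context {R : realType}.
Implicit Types (m n : int) (M N k : nat).
Variable w : R -> R.
Hypothesis mw : meyer_window w.

Definition dyadic m : R := 2 ^ m.
Definition dyadic_half m : R := 2 `^ (m%:~R / 2).

Lemma dyadic_gt0 m : 0 < dyadic m.
Proof. by rewrite /dyadic exprz_gt0. Qed.

Lemma dyadic_half_sqr m : dyadic_half m ^+ 2 = dyadic m.
Proof.
rewrite /dyadic_half /dyadic -powR_mulrn ?powR_ge0// -powRrM.
by rewrite mulfVK// powR_intmul.
Qed.

Lemma dyadic_half_gt0 m : 0 < dyadic_half m.
Proof. by rewrite powR_gt0. Qed.

Lemma dyadicS m : dyadic (m + 1) = 2 * dyadic m.
Proof. by rewrite /dyadic expfzDr// expr1z mulrC. Qed.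

Lemma dyadic_nat k : dyadic k%:Z = 2 ^+ k.
Proof. by []. Qed.

Lemma dyadicN k : dyadic (- k%:Z) = (2 ^+ k)^-1.
Proof. by rewrite /dyadic -exprnN. Qed.

Definition wavelet_hat (mn : int * int) : R -> R[i] :=
  atom w (dyadic mn.1) (dyadic_half mn.1) mn.2%:~R.

(** Levels from [-M] to [M - 1] and translations from [N] down to [1 - N]: the frequencies of
    [dirichlet N] with the sign change of [inner_atom]. *)
Definition dyadic_rect M N : seq (int * int) :=
  [seq (i%:Z - M%:Z, N%:Z - j%:Z) | i <- iota 0 (M + M), j <- iota 0 (N + N)].

Lemma uniq_dyadic_rect M N : uniq (dyadic_rect M N).
Proof.
apply: allpairs_uniq; [exact: iota_uniq|exact: iota_uniq|].
move=> [i j] [i' j'] _ _ /= [/addIr e1 /addrI /oppr_inj e2].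
by congr pair; [case: e1|case: e2].
Qed.

Lemma mem_dyadic_rect (s : seq (int * int)) :
  exists K, {subset s <= dyadic_rect K K}.
Proof.
have key (z : int) (K : nat) : (absz z < K)%N ->
    (exists2 i, i \in iota 0 (K + K) & z = i%:Z - K%:Z) /\
    (exists2 j, j \in iota 0 (K + K) & z = K%:Z - j%:Z).
  move=> zK; split.
  - exists (absz (z + K%:Z)); last by lia.
    by rewrite mem_iota; lia.
  - exists (absz (K%:Z - z)); last by lia.
    by rewrite mem_iota; lia.
exists (\max_(p <- s) maxn (absz p.1) (absz p.2)).+1 => -[m n] mns.
have h : (maxn (absz m) (absz n) <= \max_(p <- s) maxn (absz p.1) (absz p.2))%N.
  exact: (@leq_bigmax_seq _ _ xpredT (fun p : int * int => maxn (absz p.1) (absz p.2)) (m, n)).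
have [hm hn] : (absz m < (\max_(p <- s) maxn (absz p.1) (absz p.2)).+1)%N /\
    (absz n < (\max_(p <- s) maxn (absz p.1) (absz p.2)).+1)%N.
  by rewrite !ltnS; split; apply: leq_trans h; rewrite ?leq_maxl ?leq_maxr.
have [[i ii ->] _] := key _ _ hm; have [_ [j jj ->]] := key _ _ hn.
exact: allpairs_f.
Qed.

Section Coefficients.
Variables (H : R -> R[i]) (B L : R).
Hypotheses (HB : forall x, normc (H x) <= B)
  (HL : forall x y, normc (H x - H y) <= L * `|x - y|) (H2 : cL2 H).

Let T m N := \sum_(j < N + N) normc (inner H (wavelet_hat (m, N%:Z - j%:Z))) ^+ 2.
Let D m := 2 * pi * (lowZ w H (dyadic (m + 1)) - lowZ w H (dyadic m)).

Let T_cvg m : T m N @[N --> \oo] --> D m.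
Proof.
have := @frame_level R w mw H B L HB HL H2 (dyadic m) (dyadic_half m)
  (dyadic_gt0 m) (dyadic_half_sqr m).
rewrite -dyadicS; apply: cvg_trans; apply: near_eq_cvg; apply: nearW => N.
by apply: eq_bigr => i _; rewrite /wavelet_hat intrB.
Qed.

Let T_nd m : {homo T m : N N' / (N <= N')%N >-> N <= N'}.
Proof.
apply: homo_leq; [by []|by move=> ? ? ?; exact: le_trans|move=> N].
have -> : T m N.+1 = normc (inner H (wavelet_hat (m, N.+1%:Z - 0))) ^+ 2 +
   T m N + normc (inner H (wavelet_hat (m, N.+1%:Z - (N + N).+1%:Z))) ^+ 2.
  rewrite /T addnS big_ord_recr/= addSn big_ord_recl/=; congr (_ + _ + _).
  apply: eq_bigr => i _; congr (normc (inner H (wavelet_hat (m, _))) ^+ 2).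
  by rewrite /bump/=; lia.
by rewrite addrAC lerDr addr_ge0// sqr_ge0.
Qed.

Let T_le m N : T m N <= D m.
Proof.
rewrite -(cvg_lim _ (@T_cvg m))//.
by apply: nondecreasing_cvgn_le; [exact: T_nd|apply/cvg_ex; exists (D m); exact: T_cvg].
Qed.

Let D_ge0 m : 0 <= D m.
Proof. by rewrite (le_trans _ (T_le m 0))// /T big_ord0. Qed.

Let sum_D M : \sum_(i < M + M) D (i%:Z - M%:Z) =
  2 * pi * (lowZ w H (2 ^+ M) - lowZ w H (2 ^+ M)^-1).
Proof.
rewrite /D -mulr_sumr; congr (_ * _).
rewrite -(big_mkord xpredT (fun i => lowZ w H (dyadic (i%:Z - M%:Z + 1)) -
  lowZ w H (dyadic (i%:Z - M%:Z)))).
under eq_bigr => i _.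
  rewrite (_ : i%:Z - M%:Z + 1 = i.+1%:Z - M%:Z); last by lia.
  over.
rewrite (telescope_sumr (fun i : nat => lowZ w H (dyadic (i%:Z - M%:Z))) (leq0n _)).
rewrite sub0r dyadicN -dyadic_nat; congr (lowZ w H (dyadic _) - _); lia.
Qed.

Let sumD_cvg : \sum_(i < M + M) D (i%:Z - M%:Z) @[M --> \oo] --> 2 * pi * nsq H.
Proof.
under eq_fun do rewrite sum_D.
apply: cvgM; first exact: cvg_cst.
rewrite -[X in _ --> X]subr0; apply: cvgB.
  exact: (lowZ_cvgy mw HB H2).
exact: (lowZ_cvg0 mw HB H2).
Qed.

Let sumD_le M : \sum_(i < M + M) D (i%:Z - M%:Z) <= 2 * pi * nsq H.
Proof.
rewrite -(cvg_lim _ sumD_cvg)//.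
apply: nondecreasing_cvgn_le; last by apply/cvg_ex; exists (2 * pi * nsq H); exact: sumD_cvg.
apply: homo_leq; [by []|by move=> ? ? ?; exact: le_trans|move=> N].
have -> : \sum_(i < N.+1 + N.+1) D (i%:Z - N.+1%:Z) =
    D (0 - N.+1%:Z) + \sum_(i < N + N) D (i%:Z - N%:Z) + D ((N + N).+1%:Z - N.+1%:Z).
  rewrite addnS big_ord_recr/= addSn big_ord_recl/=; congr (_ + _ + _).
  by apply: eq_bigr => i _; congr D; rewrite /bump/=; lia.
by rewrite addrAC lerDr addr_ge0.
Qed.

Let sum_rect M N :
  \sum_(mn <- dyadic_rect M N) normc (inner H (wavelet_hat mn)) ^+ 2 =
  \sum_(i < M + M) T (i%:Z - M%:Z) N.
Proof.
rewrite /dyadic_rect big_allpairs_dep -(big_mkord xpredT (fun i => T (i%:Z - M%:Z) N)).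
rewrite /index_iota subn0; apply: eq_bigr => i _.
by rewrite /T -(big_mkord xpredT (fun j => normc (inner H (wavelet_hat (i%:Z - M%:Z, N%:Z - j%:Z))) ^+ 2)) /index_iota subn0.
Qed.

(** The indices lie in some rectangle. There each level contributes at most its limit [D m], and the
    telescoping sums of [D] increase to [2 pi * nsq H]. *)
Lemma frame_upper (s : seq (int * int)) : uniq s ->
  \sum_(mn <- s) normc (inner H (wavelet_hat mn)) ^+ 2 <= 2 * pi * nsq H.
Proof.
move=> us; have [K sK] := mem_dyadic_rect s.
apply: (@le_trans _ _ (\sum_(mn <- dyadic_rect K K) normc (inner H (wavelet_hat mn)) ^+ 2)).
  by apply: ler_sum_subset => // i; exact: sqr_ge0.
rewrite sum_rect; apply: le_trans (sumD_le K).
by apply: ler_sum => i _; exact: T_le.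
Qed.

Lemma frame_lower (e : R) : 0 < e -> exists2 s : seq (int * int), uniq s &
  2 * pi * nsq H - e <= \sum_(mn <- s) normc (inner H (wavelet_hat mn)) ^+ 2.
Proof.
move=> e0; have e2 : 0 < e / 2 by rewrite divr_gt0.
(* Half of [e] pays for the levels left out. Once [M] is fixed, the other half pays for the
   translations left out in the finitely many levels kept. *)
have /cvgrPdist_le/(_ _ e2)[M _ /(_ M (leqnn _)) hM] := sumD_cvg.
have cT : \sum_(i < M + M) T (i%:Z - M%:Z) N @[N --> \oo] -->
    \sum_(i < M + M) D (i%:Z - M%:Z).
  by apply: cvg_big => [|i _]; [exact: add_continuous|exact: T_cvg].
have /cvgrPdist_le/(_ _ e2)[N _ /(_ N (leqnn _)) hN] := cT.
exists (dyadic_rect M N); first exact: uniq_dyadic_rect.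
rewrite sum_rect; move: hM hN; rewrite /= !ler_norml => /andP[_ h1] /andP[_ h2].
move: h1 h2; set X := \sum_(i < _) _; set Y := \sum_(i < _) _; set Z := 2 * pi * _.
by move=> h1 h2; lra.
Qed.

End Coefficients.
End DyadicFrame.

Lemma cRe_realM {R : realType} (x : R) (z : R[i]) :
  complex.Re (x%:C * z) = x * complex.Re z.
Proof. by rewrite cReM /= mul0r subr0. Qed.

Lemma cIm_realM {R : realType} (x : R) (z : R[i]) :
  complex.Im (x%:C * z) = x * complex.Im z.
Proof. by rewrite cImM /= mul0r addr0. Qed.

(** * The inverse Fourier transform of a test function *)

Section InverseFourier.
Context {R : realType}.
Implicit Types (f g G H : R -> R[i]) (x y t : R).

(** The reflection matches the kernel [e^(+ i x xi)] of [fourier]. That this is an inverse is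
    established in the sense of L^2, by [fourierL2_ifourier]. *)
Definition ifourier G x : R[i] := ((2 * pi)^-1)%:C * fourier G (- x).

Let pi2 : 0 < 2 * pi :> R.
Proof. by rewrite mulr_gt0// pi_gt0. Qed.

Lemma cint_reflect f : cintable f -> cint (fun x => f (- x)) = cint f.
Proof.
move=> If; have n1 : -1 != 0 :> R by rewrite oppr_eq0.
have := cint_affine 0 n1 If; rewrite normrN normr1 invr1 mul1r => <-.
by congr cint; apply/funext => x; rewrite mulN1r addr0.
Qed.

Lemma cL2_reflect f : cL2 f -> cL2 (fun x => f (- x)).
Proof.
move=> [mf If]; split.
  have mo : measurable_fun [set: R] (fun x : R => - x).
    have := measurable_affine (-1 : R) 0.
    by under eq_fun do rewrite mulN1r addr0.
  exact: (cmeas_comp mo mf).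
have n1 : -1 != 0 :> R by rewrite oppr_eq0.
have := rintable_affine 0 n1 If.
by under eq_fun do rewrite mulN1r addr0.
Qed.

Lemma inner_reflect f g : cL2 f -> cL2 g ->
  inner (fun x => f (- x)) (fun x => g (- x)) = inner f g.
Proof.
move=> f2 g2; rewrite !innerE.
exact: (cint_reflect (cintable_mul f2 g2)).
Qed.

Lemma cL2_ifourier G : LipC G -> cL2 (ifourier G).
Proof. by move=> /plancherel[fG _]; apply: cL2Z; exact: cL2_reflect. Qed.

Lemma inner_ifourier G H : LipC G -> LipC H ->
  inner (ifourier G) (ifourier H) = ((2 * pi)^-1)%:C * inner G H.
Proof.
move=> LG LH; have [fG _] := plancherel LG; have [fH _] := plancherel LH.
have fG' := cL2_reflect fG; have fH' := cL2_reflect fH.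
rewrite innerZl ?innerZr//; last exact: cL2Z.
rewrite inner_reflect// plancherel_inner// conjcR; congr (_ * _).
by rewrite mulrA -realCM mulVf ?gt_eqF// mul1r.
Qed.

Lemma nsq_ifourier G : LipC G -> nsq (ifourier G) = (2 * pi)^-1 * nsq G.
Proof.
move=> LG; apply: complexI; rewrite -inner_nsq inner_ifourier// inner_nsq.
by rewrite realCM.
Qed.

(** Fubini alone, both functions having compact support. This duality takes the place of the
    inversion theorem, in [fourierL2_ifourier] as well as in the proof of totality. *)
Lemma inner_ifourierr f G : LipC f -> LipC G ->
  inner f (ifourier G) = ((2 * pi)^-1)%:C * inner (fourier f) G.
Proof.
move=> Lf LG; have [M fM] := Lf; have [K GK] := LG.
have M0 := lipc_ge0 fM; have K0 := lipc_ge0 GK.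
have [f1 f2 _] := fM; have [g1 g2 _] := GK.
have If := LipC_cintable Lf; have IG := LipC_cintable LG.
have [ff _] := plancherel Lf.
pose h (z : R * R) := f z.1 * cj (G z.2) * cis (z.2 * z.1).
have e1 : inner f (ifourier G) =
    ((2 * pi)^-1)%:C * cint (fun x => cint (fun y => h (x, y))).
  rewrite innerE -cintZ; last first.
    have -> : (fun x => cint (fun y => h (x, y))) = (fun x => f x * cj (fourier G (- x))).
      apply/funext => x; rewrite fourierE -cintJ; last exact: fourier_cintable.
      rewrite -cintZ; last by apply: cintableJ; exact: fourier_cintable.
      congr cint; apply/funext => y; rewrite /h/= conjcM cisJ mulrN opprK.
      by rewrite mulrA.
    have [fG _] := plancherel LG.
    exact: (cintable_mul (LipC_cL2 Lf) (cL2_reflect fG)).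
  congr cint; apply/funext => x; rewrite /ifourier conjcM conjcR mulrCA; congr (_ * _).
  rewrite fourierE -cintJ; last exact: fourier_cintable.
  rewrite -cintZ; last by apply: cintableJ; exact: fourier_cintable.
  congr cint; apply/funext => y; rewrite /h/= conjcM cisJ mulrN opprK.
  by rewrite mulrA.
rewrite e1 (@cint_fubini _ h (Num.max (M * K) (Num.max M K))); last 3 first.
- have mf := LipC_cmeas Lf; have mG := LipC_cmeas LG.
  apply: cmeasM; first apply: cmeasM.
  + exact: (cmeas_comp (@measurable_fst _ _ R R) mf).
  + by apply: cmeasJ; exact: (cmeas_comp (@measurable_snd _ _ R R) mG).
  + have m1 : measurable_fun [set: R * R] (fun z : R * R => z.2 * z.1).
      exact: measurable_funM.
    exact: (cmeas_comp m1 cmeas_cis).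
- move=> z; rewrite le_max /h !Normc.normcM normc_cis mulr1 normcJ.
  by rewrite ler_pM ?normc_ge0.
- move=> [x y] /= hz; rewrite /h/=.
  case: hz; rewrite !gt_max => /and3P[_ h1 h2].
    by rewrite f2// !mul0r.
  by rewrite g2// conjc0 mulr0 mul0r.
congr (_ * _); rewrite innerE; congr cint; apply/funext => y.
rewrite fourierE mulrC -cintZ; last exact: fourier_cintable.
congr cint; apply/funext => x; rewrite /h/= [y * x]mulrC.
by ring.
Qed.

Lemma normc_ifourier G x : LipC G ->
  normc (ifourier G x) <= (2 * pi)^-1 * rint (fun y => normc (G y)).
Proof.
move=> LG; rewrite Normc.normcM normcR gtr0_norm ?invr_gt0//.
by rewrite ler_pM2l ?invr_gt0// normc_fourier//; exact: LipC_cintable.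
Qed.

Lemma ifourier_lip G : LipC G -> exists L : R, forall x y,
  normc (ifourier G x - ifourier G y) <= L * `|x - y|.
Proof.
move=> [M GM]; exists ((2 * pi)^-1 * (2 * M * rint (fun y => normc (G y)))) => x y.
rewrite -mulrBr Normc.normcM normcR gtr0_norm ?invr_gt0// -[leRHS]mulrA.
rewrite ler_pM2l ?invr_gt0// (le_trans (fourier_lip _ _ GM))//.
by rewrite -opprD normrN.
Qed.

(** A Lipschitz cut-off: multiplied by it, a bounded Lipschitz function such as [ifourier G] becomes
    a test function. *)
Definition tent (k : nat) x : R := Num.max 0 (Num.min 1 (k%:R + 1 - `|x|)).

Lemma tent_ge0 k x : 0 <= tent k x.
Proof. by rewrite le_max lexx. Qed.

Lemma tent_le1 k x : tent k x <= 1.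
Proof. by rewrite ge_max ler01 ge_min lexx. Qed.

Lemma tent_eq1 k x : `|x| <= k%:R -> tent k x = 1.
Proof.
move=> h; have h1 : 1 <= k%:R + 1 - `|x| by lra.
by rewrite /tent (min_idPl h1) (max_idPr ler01).
Qed.

Lemma tent_eq0 k x : k%:R + 1 < `|x| -> tent k x = 0.
Proof.
move=> h; have h1 : k%:R + 1 - `|x| <= 1.
  by have : 0 <= k%:R :> R by []; lra.
rewrite /tent (min_idPr h1); apply/max_idPl; lra.
Qed.

Lemma lip_max0 (u v : R) : `|Num.max 0 u - Num.max 0 v| <= `|u - v|.
Proof.
have h1 := ler_norm (u - v); have h2 := ler_norm (- (u - v)).
rewrite normrN in h2; have h3 := normr_ge0 (u - v).
by case: (leP 0 u) => hu; case: (leP 0 v) => hv; rewrite ler_norml;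
  apply/andP; split; lra.
Qed.

Lemma lip_min1 (u v : R) : `|Num.min 1 u - Num.min 1 v| <= `|u - v|.
Proof.
have h1 := ler_norm (u - v); have h2 := ler_norm (- (u - v)).
rewrite normrN in h2; have h3 := normr_ge0 (u - v).
by case: (leP 1 u) => hu; case: (leP 1 v) => hv; rewrite ler_norml;
  apply/andP; split; lra.
Qed.

Lemma LipC_tent k : LipC (fun x => (tent k x)%:C).
Proof.
apply: (@LipC_intro _ _ 1 (k%:R + 1) 1).
- by move=> x; rewrite normcR ger0_norm ?tent_ge0// tent_le1.
- by move=> x h; rewrite tent_eq0.
- move=> x y; rewrite (_ : (tent k x)%:C - _ = (tent k x - tent k y)%:C).
    rewrite normcR mul1r (le_trans (lip_max0 _ _))// (le_trans (lip_min1 _ _))//.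
    rewrite (_ : _ - _ = `|y| - `|x|); last by ring.
    by rewrite [leRHS]distrC ler_dist_dist.
  by rewrite rmorphB.
Qed.

Lemma LipC_inLp1 f : LipC f -> inLp 1%:E f.
Proof.
move=> Lf; split; first exact: LipC_cmeas.
have If := cintable_normc (LipC_cintable Lf).
rewrite /cnorm Lnorm1.
have -> : (\int[lebesgue_measure]_x `|(normc (f x))%:E| =
    \int[lebesgue_measure]_x (normc (f x))%:E)%E.
  by apply: eq_integral => x _; rewrite abse_EFin ger0_norm ?normc_ge0.
by rewrite -rintE// ltry.
Qed.

Lemma tent_cvgL2 f : cL2 f ->
  nsq (fun x => (tent k x)%:C * f x - f x) @[k --> \oo] --> (0 : R).
Proof.
move=> f2.
have [|||_] := @rint_dct R (fun k x => normc ((tent k x)%:C * f x - f x) ^+ 2)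
  (fun=> 0) (fun x => normc (f x) ^+ 2) _ f2.2; last by rewrite rint0.
- move=> k; apply: cmeas_sqr; apply: cmeasB; last exact: f2.1.
  by apply: cmeasM; [exact: LipC_cmeas (LipC_tent k)|exact: f2.1].
- move=> k x; rewrite ger0_norm ?sqr_ge0// ler_sqr ?nnegrE ?normc_ge0//.
  rewrite (_ : _ - _ = (tent k x - 1)%:C * f x); last by rewrite rmorphB; ring.
  rewrite Normc.normcM normcR ler_piMl ?normc_ge0//.
  by rewrite ler_norml; have := tent_ge0 k x; have := tent_le1 k x; lra.
- move=> x; apply: (@cvg_near_cst _ _ _ _ _ eventually_filter).
  near=> k; rewrite tent_eq1; last by near: k; exact: nbhs_infty_ger.
  by rewrite mul1r subrr normc0 expr0n.
Unshelve. all: end_near. Qed.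

Lemma cvgL2_nsq (f_ : nat -> R -> R[i]) f : (forall k, cL2 (f_ k)) -> cL2 f ->
  nsq (fun x => f_ k x - f x) @[k --> \oo] --> (0 : R) -> cvgL2 f_ f.
Proof.
move=> f_2 f2 h; rewrite /cvgL2.
have -> : (fun k => cnorm 2%:E (fun x => f_ k x - f x)) =
    (fun k => (Num.sqrt (nsq (fun x => f_ k x - f x)))%:E).
  by apply/funext => k; rewrite cnorm2E//; exact: cL2B.
apply: cvg_EFin; first exact: nearW.
rewrite -[X in _ --> X](sqrtr0 R).
by apply: (continuous_cvg _ _ h); exact: sqrt_continuous.
Qed.

(* The approximants are [ifourier G] times tents; by Plancherel their Fourier
   transforms are as close to [G] as they are to [ifourier G], up to 2 pi. *)
Theorem fourierL2_ifourier G : LipC G -> fourierL2 (ifourier G) G.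
Proof.
move=> LG; have g2 := cL2_ifourier LG; have G2 := LipC_cL2 LG.
split; [exact/inLp2P|exact/inLp2P|].
have [L gL] := ifourier_lip LG.
pose f_ k x := (tent k x)%:C * ifourier G x.
have Lf k : LipC (f_ k).
  apply: (LipCM (LipC_tent k) _ gL) => x; exact: normc_ifourier.
exists f_; split.
- move=> k; split; first exact: LipC_inLp1.
  by apply/inLp2P; exact: LipC_cL2.
- apply: cvgL2_nsq => // [k|]; first exact: LipC_cL2.
  exact: tent_cvgL2.
- have E k : nsq (fun x => fourier (f_ k) x - G x) =
      2 * pi * nsq (fun x => f_ k x - ifourier G x).
    have [ff e] := plancherel (Lf k); have fk2 := LipC_cL2 (Lf k).
    rewrite nsqB// nsqB// e nsq_ifourier// inner_ifourierr// cRe_realM.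
    have pn : 2 * pi != 0 :> R by rewrite gt_eqF.
    move: (complex.Re _) (nsq G) (nsq (f_ k)) (2 * pi) pn => x y z p pn.
    by field.
  apply: cvgL2_nsq => // [k|]; first by have [] := plancherel (Lf k).
  rewrite (_ : (fun k => nsq _) = fun k => 2 * pi * nsq (fun x => f_ k x - ifourier G x)).
    have e : (0 : R) = 2 * pi * 0 by rewrite mulr0.
    by rewrite [X in _ --> X]e; apply: cvgM; [exact: cvg_cst|exact: tent_cvgL2].
  by apply/funext => k; exact: E.
Qed.

End InverseFourier.

(** * Orthonormality, and totality for test functions *)

Section MeyerWavelet.
Context {R : realType}.
Variable w : R -> R.
Hypothesis mw : meyer_window w.
Implicit Types (x y : R) (mn : int * int).

Definition meyer_wavelet : R -> R[i] := ifourier (meyer_hat w).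

Let LG := LipC_meyer_hat mw.

Lemma LipC_wavelet_hat mn : LipC (wavelet_hat w mn).
Proof.
have an : (dyadic mn.1)^-1 != 0 :> R by rewrite invr_eq0 gt_eqF ?dyadic_gt0.
have := LipCZ ((dyadic_half mn.1)^-1)%:C
  (LipC_cis (mn.2%:~R * (dyadic mn.1)^-1) (LipC_affine 0 an LG)).
rewrite (_ : (fun _ => _) = wavelet_hat w mn)//.
by apply/funext => x; rewrite /wavelet_hat /atom addr0 [mn.2%:~R * (_ * _)]mulrA.
Qed.

Lemma fourier_atom a c (s x : R) : 0 < a -> c ^+ 2 = a ->
  fourier (atom w a c s) (- x) = c%:C * fourier (meyer_hat w) (s - a * x).
Proof.
move=> a0 c2; have an : a != 0 by rewrite gt_eqF.
have cn : c != 0 by apply: contraNneq an => c0; rewrite -c2 c0 expr0n.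
have ai : 0 < a^-1 by rewrite invr_gt0.
pose g y := meyer_hat w y * cis (y * (s - a * x)).
have Ig : cintable g by apply: fourier_cintable; exact: LipC_cintable.
rewrite !fourierE -[cint (fun y => meyer_hat w y * _)]/(cint g).
have -> : (fun y => atom w a c s y * cis (y * - x)) =
    (fun y => (c^-1)%:C * g (a^-1 * y)).
  apply/funext => y; rewrite /atom /g.
  rewrite (_ : a^-1 * y * (s - a * x) = s * (a^-1 * y) + y * - x); last by field.
  by rewrite cisD !mulrA.
rewrite cintZ; last exact: (cintable_scale ai Ig).
rewrite cint_scale// mulrA invrK -realCM; congr (_%:C * _).
by rewrite -c2 expr2 mulKf.
Qed.

Lemma wavelet_systemE mn :
  wavelet_system meyer_wavelet mn = ifourier (wavelet_hat w mn).
Proof.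
apply/funext => x; rewrite /wavelet_system /meyer_wavelet /ifourier /wavelet_hat.
rewrite fourier_atom ?dyadic_half_sqr ?dyadic_gt0// mulrCA opprB.
by congr (_ * (_ * _)).
Qed.

(** The part over [[-2 pi, 0[] is translated onto [[0, 2 pi[], where evenness and Meyer's identity
    make the sum of both integrands equal to 1. *)
Lemma rint_window_sqr : rint (fun x => w x ^+ 2) = 2 * pi.
Proof.
have pi0 := pi_gt0 R; have pi2 : 0 < 2 * pi :> R by rewrite mulr_gt0.
have mwin : measurable_fun [set: R] w.
  have [L' wL] : exists L, forall x y, `|w x - w y| <= L * `|x - y| by case: mw.
  by apply: continuous_measurable_fun; exact: lip_continuous wL.
have mw2 b : measurable_fun [set: R] (fun x => w (x + b) ^+ 2).
  apply: measurable_funX; apply: (measurableT_comp mwin).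
  exact: measurable_funD.
have w1 x : `|w x ^+ 2| <= 1.
  by rewrite normrX expr_le1// window_bound.
have I1 : rintable (fun x => ivl 0 (2 * pi) x * w x ^+ 2).
  by apply: (@rintable_ivl _ _ _ _ 1) => //; exact: measurable_funX.
have I2 : rintable (fun x => ivl (- (2 * pi)) 0 x * w x ^+ 2).
  by apply: (@rintable_ivl _ _ _ _ 1) => //; exact: measurable_funX.
have I3 : rintable (fun x => ivl 0 (2 * pi) x * w (x + - (2 * pi)) ^+ 2).
  exact: (@rintable_ivl _ _ _ _ 1).
have E : (fun x => w x ^+ 2) = (fun x => ivl (- (2 * pi)) 0 x * w x ^+ 2 +
    ivl 0 (2 * pi) x * w x ^+ 2).
  apply/funext => x; rewrite /ivl.
  case: ifPn => h1; case: ifPn => h2; rewrite ?mul1r ?mul0r ?addr0 ?add0r//.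
    by exfalso; move: h1 h2 => /andP[_ h1] /andP[h2 _]; lra.
  rewrite window_eq0 ?expr0n//.
  have [x0|x0] := ltP x 0.
    have [x1|x1] := leP x (- (4 * pi / 3)); first by left.
    by move: h1; rewrite x0 andbT -ltNge => h1; exfalso; lra.
  have [x1|x1] := leP (4 * pi / 3) x; first by right.
  by move: h2; rewrite x0/= -leNgt => h2; exfalso; lra.
rewrite E rintD// -(rint_shift (- (2 * pi)) I2).
rewrite (_ : (fun x => ivl _ 0 (x + _) * _) =
    fun x => ivl 0 (2 * pi) x * w (x + - (2 * pi)) ^+ 2); last first.
  apply/funext => x; congr (_ * _); rewrite /ivl; congr (if _ then _ else _).
  by congr andb; apply/idP/idP => h; lra.
rewrite -rintD//.
rewrite (_ : (fun _ => _) = fun x => ivl 0 (2 * pi) x * cst 1 x).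
  rewrite (rint_ivl_FTC pi2 (fun x => is_derive_id x 1)) ?subr0//.
  exact: cst_continuous.
apply/funext => x; rewrite -mulrDr /ivl; case: ifPn => [/andP[h1 h2]|_]; last by rewrite !mul0r.
congr (_ * _); rewrite (_ : x + - _ = - (2 * pi - x)); last by ring.
rewrite (window_even mw) addrC.
by case: mw => _ _ _ [_ _ ->]//; rewrite h1 ltW.
Qed.

(** By [bell_sqr], rescaling leaves the integral of [w (x / 2) ^+ 2 - w x ^+ 2], which is
    [2 * 2 pi - 2 pi]. *)
Lemma nsq_wavelet_hat mn : nsq (wavelet_hat w mn) = 2 * pi.
Proof.
have a0 := dyadic_gt0 (R := R) mn.1; have c0 := dyadic_half_gt0 (R := R) mn.1.
have Ib : rintable (fun x => bell w x ^+ 2).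
  have := (LipC_cL2 LG).2.
  rewrite (_ : (fun _ => _) = fun x => bell w x ^+ 2)//.
  apply/funext => x; rewrite Normc.normcM normc_cis mulr1 normcR.
  by rewrite real_normK ?num_real.
have Iw : rintable (fun x => w x ^+ 2).
  have [L' wL] : exists L, forall x y, `|w x - w y| <= L * `|x - y| by case: mw.
  apply: (@rintable_bsupp _ _ (Num.max 1 (4 * pi / 3))).
  - apply: measurable_funX; apply: continuous_measurable_fun.
    exact: lip_continuous wL.
  - by move=> x; rewrite le_max normrX expr_le1// window_bound.
  - move=> x; rewrite gt_max => /andP[_ h].
    by case: mw => _ _ _ [_ h0 _]; rewrite h0 ?expr0n// ltW.
have h2 : 0 < 2^-1 :> R by [].
have ai : 0 < (dyadic mn.1)^-1 :> R by rewrite invr_gt0.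
rewrite /nsq (_ : (fun _ => _) = fun x => (dyadic_half mn.1) ^- 2 *
    bell w ((dyadic mn.1)^-1 * x) ^+ 2); last first.
  apply/funext => x; rewrite /wavelet_hat /atom !Normc.normcM !normc_cis !mulr1 !normcR.
  by rewrite exprMn !real_normK ?num_real// exprVn.
rewrite rintZ; last exact: (rintable_scale ai Ib).
rewrite (rint_scale ai Ib) invrK mulrA -dyadic_half_sqr mulVf ?mul1r; last first.
  by rewrite expf_neq0// gt_eqF.
rewrite (_ : (fun _ => _) = fun x => w (2^-1 * x) ^+ 2 - w x ^+ 2); last first.
  by apply/funext => x; rewrite (bell_sqr mw) [x / 2]mulrC.
rewrite rintB//; last exact: (rintable_scale h2 Iw).
rewrite (rint_scale h2 Iw) invrK rint_window_sqr.
by ring.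
Qed.

(** For [mn] different from [mn'], [frame_upper] is applied to [H = wavelet_hat w mn] and the two
    indices. The coefficient at [mn] already contributes [(2 pi) ^+ 2], which is the whole upper
    bound, so nothing is left for [mn']. *)
Lemma inner_wavelet_hat mn mn' :
  inner (wavelet_hat w mn) (wavelet_hat w mn') = (2 * pi * (mn == mn')%:R)%:C.
Proof.
have [<-|ne] := eqVneq mn mn'; first by rewrite inner_nsq nsq_wavelet_hat mulr1.
have pi2 : 0 < 2 * pi :> R by rewrite mulr_gt0// pi_gt0.
have LH := LipC_wavelet_hat mn; have [M [h1 _ h3]] := LH.
have U : uniq [:: mn; mn'] by rewrite /= inE ne.
have := @frame_upper R w mw _ M M h1 h3 (LipC_cL2 LH) _ U.
rewrite !big_cons big_nil addr0 inner_nsq.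
rewrite nsq_wavelet_hat normcR gtr0_norm// expr2 gerDl => h.
rewrite mulr0; apply: normc_eq0; apply/eqP; rewrite -sqrf_eq0.
by rewrite eq_le h sqr_ge0.
Qed.

Lemma cL2_wavelet_system mn : cL2 (wavelet_system meyer_wavelet mn).
Proof. by rewrite wavelet_systemE; apply: cL2_ifourier; exact: LipC_wavelet_hat. Qed.

Lemma inner_wavelet_system mn mn' :
  inner (wavelet_system meyer_wavelet mn) (wavelet_system meyer_wavelet mn') =
  (mn == mn')%:R.
Proof.
have LH := LipC_wavelet_hat.
have pi2 : 2 * pi != 0 :> R by rewrite gt_eqF// mulr_gt0// pi_gt0.
rewrite !wavelet_systemE inner_ifourier// inner_wavelet_hat -realCM mulrA.
by rewrite mulVf// mul1r; case: eqP.
Qed.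

Lemma wavelet_system_total_LipC f (e : R) : LipC f -> 0 < e ->
  exists2 s : seq (int * int), uniq s &
  nsq (fun x => f x - \sum_(i <- s) inner f (wavelet_system meyer_wavelet i) *
    wavelet_system meyer_wavelet i x) <= e.
Proof.
move=> Lf e0; have [M fM] := Lf; have LH := LipC_wavelet_hat.
have [H2 EH] := plancherel Lf.
have pi2 : 0 < 2 * pi :> R by rewrite mulr_gt0// pi_gt0.
(* The tolerance on the Fourier side: coefficients there are [2 pi] times as large, so their squares
   scale by [(2 pi) ^+ 2]. *)
have e1 : 0 < (2 * pi) ^+ 2 * e by rewrite mulr_gt0// exprn_gt0.
have HB x := normc_fourier x (LipC_cintable Lf).
have [s us hs] := frame_lower mw HB (fun x y => fourier_lip x y fM) H2 e1.
exists s => //.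
rewrite (pythagoras cL2_wavelet_system (LipC_cL2 Lf) inner_wavelet_system)//.
set S := \sum_(i <- s) _; rewrite lerBlDr addrC -lerBlDr.
rewrite -(ler_pM2l (exprn_gt0 2 pi2)) mulrBr.
apply: (@le_trans _ _ (2 * pi * nsq (fourier f) - (2 * pi) ^+ 2 * e)).
  by rewrite EH expr2 -[X in X - _]mulrA.
apply: le_trans hs _; rewrite mulr_sumr; apply: ler_sum => i _.
rewrite wavelet_systemE inner_ifourierr// Normc.normcM normcR.
by rewrite gtr0_norm ?invr_gt0// -exprMn mulVKf ?gt_eqF.
Qed.

End MeyerWavelet.

(** * Approximation by averages *)

Section Averages.
Context {R : realType}.
Local Notation mu := (@lebesgue_measure R).
Implicit Types (x y t M : R) (n : nat).

Definition halfline x t : R := if t <= x then 1 else 0.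

Lemma measurable_halfline x : measurable_fun [set: R] (halfline x).
Proof.
rewrite (_ : halfline x = \1_(`]-oo, x]%classic)).
  by apply: measurable_indic; exact: measurable_itv.
apply/funext => t; rewrite indicE /halfline; case: ifPn => h.
  by rewrite mem_set//= in_itv.
by rewrite memNset//= in_itv/=; apply/negP.
Qed.

Section Primitive.
Variables (g : R -> R) (M : R).
Hypotheses (mg : measurable_fun [set: R] g) (gM : forall x, `|g x| <= M)
  (g0 : forall x, M < `|x| -> g x = 0).

Let M0 : 0 <= M. Proof. by rewrite (le_trans _ (gM 0)). Qed.

Definition primitive x := rint (fun t => halfline x t * g t).

Let Ih x : rintable (fun t => halfline x t * g t).
Proof.
apply: (@rintable_bsupp _ _ M) => [|t|t /g0 ->]; last by rewrite mulr0.
  by apply: measurable_funM => //; exact: measurable_halfline.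
by rewrite /halfline; case: ifP; rewrite ?mul1r ?mul0r ?normr0.
Qed.

Lemma primitive_lip x y : `|primitive x - primitive y| <= M * `|x - y|.
Proof.
wlog yx : x y / y <= x => [H|].
  have [|xy] := leP y x; first exact: H.
  by rewrite distrC [`|x - y|]distrC; apply: H; exact: ltW.
rewrite /primitive -rintB//; apply: le_trans (le_norm_rint (rintableB (Ih x) (Ih y))) _.
have Ii : rintable (fun t => \1_(`]y, x]%classic) t : R) by exact: integrable_indic_itv.
have -> : M * `|x - y| = rint (fun t => M * \1_(`]y, x]%classic) t).
  rewrite rintZ//; congr (_ * _); apply: EFin_inj; rewrite rintE//.
  rewrite integral_indic//= setIT lebesgue_measure_itv/= lte_fin.
  rewrite ger0_norm ?subr_ge0//; case: ltP => // xy.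
  by rewrite (_ : x = y) ?subrr//; apply/eqP; rewrite eq_le xy yx.
apply: le_rint; [by apply: rintable_norm; exact: rintableB|exact: rintableZ|].
move=> t; rewrite -mulrBl normrM mulrC indicE /halfline.
have [tx|tx] := leP t x; have [ty|ty] := leP t y.
- by rewrite subrr normr0 mulr0 mulr_ge0.
- by rewrite subr0 normr1 mem_set ?ler_pM//= in_itv/= ty tx.
- by have := lt_le_trans tx (le_trans ty yx); rewrite ltxx.
- by rewrite subrr normr0 mulr0 mulr_ge0.
Qed.

Lemma primitive_derivable :
  {ae mu, forall x, derivable primitive x 1 /\ derive1 primitive x = g x}.
Proof.
have Ig : rintable g by exact: (@rintable_bsupp _ _ M).
have -> : primitive = fun x => Rintegral mu [set` `]-oo, x]] g.
  apply/funext => x; rewrite Rintegral_mkcond /primitive /rint; congr Rintegral.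
  apply/funext => t; rewrite patchE /halfline mem_setE in_itv/=.
  by case: ifP => _; rewrite ?mul1r ?mul0r.
apply: FTC1Ny.
  by move=> y; apply: integrableS Ig => //; exact: measurable_itv.
have := integrable_locally measurableT Ig.
by rewrite patch_setT.
Qed.

(** The mean of [g] over an interval of length [1 / (n + 1)], written as a difference quotient of
    the primitive: it is Lipschitz for fixed [n], and Lebesgue differentiation gives its limit. *)
Definition average n x := n.+1%:R * (primitive (x + n.+1%:R^-1) - primitive x).

Let n0 n : 0 < n.+1%:R^-1 :> R. Proof. by rewrite invr_gt0. Qed.

Lemma average_bound n x : `|average n x| <= M.
Proof.
rewrite normrM ger0_norm// mulrC -ler_pdivlMr//.
by rewrite (le_trans (primitive_lip _ _))// addrC addKr gtr0_norm.
Qed.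

Lemma average_supp n x : M + 1 < `|x| -> average n x = 0.
Proof.
move=> xM; rewrite /average /primitive -rintB// -[RHS](mulr0 n.+1%:R); congr (_ * _).
rewrite -[RHS]rint0; congr rint; apply/funext => t; rewrite -mulrBl.
have [tM|/g0 ->] := leP `|t| M; last by rewrite mulr0.
have n1 : n.+1%:R^-1 <= 1 :> R by rewrite invf_le1// ler1n.
have := n0 n; move: (n.+1%:R^-1) n1 => e e1 e0.
move: tM; rewrite ler_norml => /andP[t1 t2].
suff -> : halfline (x + e) t = halfline x t by rewrite subrr mul0r.
rewrite /halfline; have [x0|x0] := leP 0 x.
  by rewrite ger0_norm// in xM; rewrite !ifT//; lra.
by rewrite ltr0_norm// in xM; rewrite !ifF//; apply/negbTE; rewrite -ltNge; lra.
Qed.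

Lemma average_lip n x y :
  `|average n x - average n y| <= n.+1%:R * (M + M) * `|x - y|.
Proof.
rewrite -mulrBr normrM ger0_norm// -mulrA ler_pM2l//.
rewrite (_ : _ - _ - _ = (primitive (x + n.+1%:R^-1) - primitive (y + n.+1%:R^-1)) -
  (primitive x - primitive y)); last by ring.
rewrite (le_trans (ler_normB _ _))// mulrDl lerD ?primitive_lip//.
by rewrite (le_trans (primitive_lip _ _))// (_ : _ - _ = x - y)//; ring.
Qed.

Lemma average_cvg : {ae mu, forall x, average n x @[n --> \oo] --> g x}.
Proof.
have := primitive_derivable; apply: filterS; first exact: (ae_filter_ringOfSetsType mu).
move=> x [dx <-].
have /cvgr_dnbhsP h : h^-1 *: (primitive (h + x) - primitive x) @[h --> 0^'] --> derive1 primitive x.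
  move/cvg_ex : dx => [l hl].
  have {}hl : h^-1 *: (primitive (h + x) - primitive x) @[h --> 0^'] --> l.
    by move: hl; under eq_fun do rewrite scaler1.
  by rewrite /derive1; rewrite (cvg_lim _ hl).
have := h (fun n => n.+1%:R^-1); rewrite /GRing.scale/=.
rewrite (_ : (fun n => average n x) =
    fun n => n.+1%:R^-1^-1 * (primitive (n.+1%:R^-1 + x) - primitive x)); last first.
  by apply/funext => n; rewrite invrK [_ + x]addrC.
apply; split; first by move=> n; rewrite gt_eqF.
exact: cvg_harmonic.
Qed.

Lemma measurable_average n : measurable_fun [set: R] (average n).
Proof.
apply: continuous_measurable_fun; apply: lip_continuous => x y.
exact: average_lip.
Qed.

(** Dominated convergence: all averages share the bound [M], and they vanish beyond [M + 1] because
    the averaging intervals have length at most 1. *)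
Lemma average_cvgL2 : rint (fun x => (average n x - g x) ^+ 2) @[n --> \oo] --> (0 : R).
Proof.
have Ii : rintable (fun t => \1_(`[- (M + 1), M + 1]%classic) t : R).
  exact: integrable_indic_itv.
have ae2 : {ae mu, forall x, (average n x - g x) ^+ 2 @[n --> \oo] --> (0 : R)}.
  have := average_cvg; apply: filterS; first exact: (ae_filter_ringOfSetsType mu).
  move=> x h; have e : (0 : R) = (g x - g x) * (g x - g x) by rewrite subrr mul0r.
  rewrite [X in _ --> X]e; under eq_fun do rewrite expr2.
  by apply: cvgM; apply: cvgB => //; exact: cvg_cst.
have ma n : measurable_fun [set: R] (fun x => (average n x - g x) ^+ 2).
  by apply: measurable_funX; apply: measurable_funB => //; exact: measurable_average.
have bd n x : `|(average n x - g x) ^+ 2| <=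
    (M + M) ^+ 2 * \1_(`[- (M + 1), M + 1]%classic) x.
  rewrite indicE; have [xM|xM] := leP `|x| (M + 1).
    rewrite mem_set ?mulr1; last by rewrite /= in_itv/= -ler_norml.
    rewrite normrX ler_sqr ?nnegrE ?addr_ge0// (le_trans (ler_normB _ _))//.
    by rewrite lerD// average_bound.
  have xM' : M < `|x| by rewrite (le_lt_trans _ xM)// lerDl.
  by rewrite average_supp// g0// subrr expr0n normr0 mulr_ge0 ?sqr_ge0.
have [_] := rint_dct_ae ma (@measurable_cst _ _ _ _ _ (0 : R)) (rintableZ _ Ii) bd ae2.
by rewrite rint0.
Qed.

End Primitive.
End Averages.

(** * Density of the test functions in L^2 *)

Section Density.
Context {R : realType}.
Implicit Types (f g : R -> R[i]) (x y M e : R).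

Lemma LipC_dense_bsupp g M e : cmeas g -> (forall x, normc (g x) <= M) ->
  (forall x, M < `|x| -> g x = 0) -> 0 < e ->
  exists2 h, LipC h & nsq (fun x => h x - g x) <= e.
Proof.
move=> [mg1 mg2] gM g0 e0.
have M0 : 0 <= M by rewrite (le_trans (normc_ge0 _) (gM 0)).
have b1 x : `|fRe g x| <= M by rewrite (le_trans (normRe_le _)).
have b2 x : `|fIm g x| <= M by rewrite (le_trans (normIm_le _)).
have s1 x : M < `|x| -> fRe g x = 0 by move=> h; rewrite /fRe g0.
have s2 x : M < `|x| -> fIm g x = 0 by move=> h; rewrite /fIm g0.
have /cvgrPdist_le/(_ _ (divr_gt0 e0 (ltr0Sn _ 1)))[n1 _ h1] :=
  average_cvgL2 mg1 b1 s1.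
have /cvgrPdist_le/(_ _ (divr_gt0 e0 (ltr0Sn _ 1)))[n2 _ h2] :=
  average_cvgL2 mg2 b2 s2.
pose n := maxn n1 n2.
have {}h1 := h1 n (leq_maxl _ _); have {}h2 := h2 n (leq_maxr _ _).
pose a1 := average (fRe g) n; pose a2 := average (fIm g) n.
have L1 := average_lip mg1 b1 s1 n; have L2 := average_lip mg2 b2 s2 n.
have Lh : LipC (fun x => a1 x +i* a2 x).
  apply: (@LipC_intro _ _ (M + M) (M + 1) (n.+1%:R * (M + M) + n.+1%:R * (M + M))).
  - move=> x; rewrite (le_trans (normc_le _))//= lerD//.
      exact: (average_bound mg1 b1 s1).
    exact: (average_bound mg2 b2 s2).
  - move=> x xM; rewrite /a1 /a2 (average_supp mg1 b1 s1)// (average_supp mg2 b2 s2)//.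
  - move=> x y; rewrite (le_trans (normc_le _))//= mulrDl lerD//.
exists (fun x => a1 x +i* a2 x) => //.
have d2 : cL2 (fun x => (a1 x +i* a2 x) - g x).
  by apply: cL2B; [exact: LipC_cL2|exact: (@cL2_bsupp _ _ M)].
have E x : normc (a1 x +i* a2 x - g x) ^+ 2 = (a1 x - fRe g x) ^+ 2 + (a2 x - fIm g x) ^+ 2.
  by rewrite sqr_normc cReD cImD cReN cImN.
have I1 : rintable (fun x => (a1 x - fRe g x) ^+ 2).
  apply: rintable_le d2.2.
    apply: measurable_funX; apply: measurable_funB => //.
    exact: (measurable_average mg1 b1 s1).
  by move=> x; rewrite ger0_norm ?sqr_ge0// E lerDl sqr_ge0.
have I2 : rintable (fun x => (a2 x - fIm g x) ^+ 2).
  apply: rintable_le d2.2.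
    apply: measurable_funX; apply: measurable_funB => //.
    exact: (measurable_average mg2 b2 s2).
  by move=> x; rewrite ger0_norm ?sqr_ge0// E lerDr sqr_ge0.
rewrite /nsq; under eq_fun do rewrite E.
rewrite rintD//; move: h1 h2; rewrite !sub0r !normrN => h1 h2.
have := le_trans (ler_norm _) h1; have := le_trans (ler_norm _) h2.
by rewrite -/a1 -/a2; lra.
Qed.

Lemma LipC_dense f e : cL2 f -> 0 < e ->
  exists2 h, LipC h & nsq (fun x => f x - h x) <= e.
Proof.
move=> f2 e0.
(* The first tent removes large values of [f], the second large arguments, so that [k + 1] is both a
   bound and a support radius for [g k]. *)
pose g k x := (tent k (normc (f x)) * tent k x)%:C * f x.
have mt k : measurable_fun [set: R] (tent k) by have [] := LipC_cmeas (@LipC_tent R k).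
have mg k : cmeas (g k).
  apply: cmeasM; last exact: f2.1.
  apply: cmeasR; apply: measurable_funM => //.
  by apply: measurableT_comp => //; exact: cmeas_normc f2.1.
have tt k x : 0 <= tent k (normc (f x)) * tent k x <= 1.
  by rewrite mulr_ge0 ?tent_ge0//= mulr_ile1 ?tent_ge0 ?tent_le1.
have gf : nsq (fun x => g k x - f x) @[k --> \oo] --> (0 : R).
  have [|||_] := @rint_dct R (fun k x => normc (g k x - f x) ^+ 2)
    (fun=> 0) (fun x => normc (f x) ^+ 2) _ f2.2; last by rewrite rint0.
  - by move=> k; apply: cmeas_sqr; apply: cmeasB => //; exact: f2.1.
  - move=> k x; rewrite ger0_norm ?sqr_ge0// ler_sqr ?nnegrE ?normc_ge0//.
    rewrite (_ : _ - _ = (tent k (normc (f x)) * tent k x - 1)%:C * f x); last first.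
      by rewrite /g rmorphB; ring.
    rewrite Normc.normcM normcR ler_piMl ?normc_ge0//.
    by rewrite ler_norml; have := tt k x; lra.
  - move=> x; apply: (@cvg_near_cst _ _ _ _ _ eventually_filter).
    near=> k; rewrite /g !tent_eq1.
    + by rewrite mul1r mul1r subrr normc0 expr0n.
    + by near: k; exact: nbhs_infty_ger.
    + rewrite ger0_norm ?normc_ge0//; near: k; exact: nbhs_infty_ger.
(* Two errors, each doubled by [nsqD_le]. *)
have e4 : 0 < e / 4 by rewrite divr_gt0.
have /cvgrPdist_le/(_ _ e4)[k _ /(_ k (leqnn _)) hk] := gf.
have [h Lh hh] : exists2 h, LipC h & nsq (fun x => h x - g k x) <= e / 4.
  apply: (@LipC_dense_bsupp (g k) (k%:R + 1)) => // x.
  - rewrite Normc.normcM normcR ger0_norm; last by have /andP[] := tt k x.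
    have [fk|fk] := leP (normc (f x)) (k%:R + 1); last first.
      rewrite tent_eq0 ?mul0r ?mul0r ?addr_ge0//.
      by rewrite ger0_norm ?normc_ge0.
    by rewrite (le_trans _ fk)// ler_piMl ?normc_ge0//; have /andP[] := tt k x.
  - by move=> xk; rewrite /g [tent k x]tent_eq0// mulr0 mul0r.
exists h => //.
have gk2 : cL2 (fun x => g k x - f x).
  split; first by apply: cmeasB => //; exact: f2.1.
  apply: (@rintable_le _ _ (fun x => normc (f x) ^+ 2)); last exact: f2.2.
    by apply: cmeas_sqr; apply: cmeasB => //; exact: f2.1.
  move=> x; rewrite ger0_norm ?sqr_ge0// ler_sqr ?nnegrE ?normc_ge0//.
  rewrite (_ : _ - _ = (tent k (normc (f x)) * tent k x - 1)%:C * f x); last first.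
    by rewrite /g rmorphB; ring.
  rewrite Normc.normcM normcR ler_piMl ?normc_ge0//.
  by rewrite ler_norml; have := tt k x; lra.
have hg2 : cL2 (fun x => h x - g k x).
  have := cL2B (cL2B (LipC_cL2 Lh) f2) gk2.
  by rewrite (_ : (fun _ => _) = fun x => h x - g k x)//; apply/funext => x; ring.
have -> : nsq (fun x => f x - h x) = nsq (fun x => (h x - g k x) + (g k x - f x)).
  congr rint; apply/funext => x; rewrite -normcN; congr (normc _ ^+ 2); ring.
apply: le_trans (nsqD_le hg2 gk2) _.
move: hk; rewrite sub0r normrN => /(le_trans (ler_norm _)) hk.
by lra.
Unshelve. all: end_near. Qed.

End Density.

(** * The orthonormal wavelet *)

Section MeyerBasis.
Context {R : realType}.
Variable w : R -> R.
Hypothesis mw : meyer_window w.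

Theorem orthonormal_meyer_wavelet : orthonormal_wavelet (meyer_wavelet w).
Proof.
have c2 := cL2_wavelet_system mw.
split; first by apply/inLp2P; apply: cL2_ifourier; exact: LipC_meyer_hat.
split; first by split => [i|i j]; [exact/inLp2P|exact: inner_wavelet_system].
move=> f /inLp2P f2 eps eps0.
(* Two errors doubled by [nsqD_le] give [eps ^+ 2 / 2], which leaves room for the strict inequality
   required. *)
have d0 : 0 < eps ^+ 2 / 8 by rewrite divr_gt0// exprn_gt0.
have [g Lg hg] := LipC_dense f2 d0.
have [s us hs] := wavelet_system_total_LipC mw Lg d0.
pose S x := \sum_(i <- s) inner g (wavelet_system (meyer_wavelet w) i) *
  wavelet_system (meyer_wavelet w) i x.
exists s, (fun i => inner g (wavelet_system (meyer_wavelet w) i)).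
rewrite -/(S _).
have S2 : cL2 S by apply: cL2_sum => i; exact: cL2Z.
have g2 := LipC_cL2 Lg.
have fS2 : cL2 (fun x => f x - S x) by exact: cL2B.
rewrite cnorm2E// lte_fin.
have h : nsq (fun x => f x - S x) <= eps ^+ 2 / 2.
  have := nsqD_le (cL2B f2 g2) (cL2B g2 S2).
  rewrite (_ : (fun x => f x - g x + (g x - S x)) = fun x => f x - S x); last first.
    by apply/funext => x; ring.
  by move: hg hs; rewrite -/S; lra.
rewrite -[ltRHS]ger0_norm ?ltW// -sqrtr_sqr ltr_sqrt ?exprn_gt0//.
by rewrite (le_lt_trans h)// ltr_pdivrMr// ltr_pMr ?exprn_gt0// ltr1n.
Qed.

End MeyerBasis.

(** * Smoothness of the inverse Fourier transform *)

Section SmoothFourier.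
Context {R : realType}.
Local Notation mu := (@lebesgue_measure R).
Implicit Types (u v g : R -> R) (x y c M : R).

Definition bsupp u := measurable_fun [set: R] u /\
  exists M, (forall x, `|u x| <= M) /\ (forall x, M < `|x| -> u x = 0).

Lemma bsupp_rintable u : bsupp u -> rintable u.
Proof. by move=> [mu [M [h1 h2]]]; exact: (@rintable_bsupp _ _ M). Qed.

Lemma bsuppM u g : measurable_fun [set: R] g -> (forall x, `|g x| <= 1) ->
  bsupp u -> bsupp (fun x => u x * g x).
Proof.
move=> mg g1 [mu [M [h1 h2]]]; split; first exact: measurable_funM.
exists M; split=> x; last by move=> /h2 ->; rewrite mul0r.
by rewrite normrM -[leRHS]mulr1 ler_pM.
Qed.

Lemma bsuppD u v : bsupp u -> bsupp v -> bsupp (fun x => u x + v x).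
Proof.
move=> [mu [M [h1 h2]]] [mv [K [k1 k2]]]; split; first exact: measurable_funD.
have M0 : 0 <= M by rewrite (le_trans _ (h1 0)).
have K0 : 0 <= K by rewrite (le_trans _ (k1 0)).
exists (M + K); split=> x; first by rewrite (le_trans (ler_normD _ _))// lerD.
by move=> h; rewrite h2 ?k2 ?addr0// (le_lt_trans _ h)// ?lerDl ?lerDr.
Qed.

Lemma bsuppZ c u : bsupp u -> bsupp (fun x => c * u x).
Proof.
move=> [mu [M [h1 h2]]]; split; first exact: measurable_funM.
exists (Num.max (`|c| * M) M); split=> x; first by rewrite le_max normrM ler_wpM2l.
by rewrite gt_max => /andP[_ /h2 ->]; rewrite mulr0.
Qed.

Lemma bsuppX u : bsupp u -> bsupp (fun x => x * u x).
Proof.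
move=> [mu [M [h1 h2]]]; split; first exact: measurable_funM.
have M0 : 0 <= M by rewrite (le_trans _ (h1 0)).
exists (Num.max (M * M) M); split=> x.
  rewrite le_max normrM; have [xM|/h2 ->] := leP `|x| M.
    by rewrite ler_pM.
  by rewrite normr0 mulr0 mulr_ge0.
by rewrite gt_max => /andP[_ /h2 ->]; rewrite mulr0.
Qed.

(** Real and imaginary part of [ifourier] both have this form, and differentiation replaces [(u, v)]
    by [(y v, - y u)]. Multiplication by [y] preserves [bsupp], so the family contains all its
    derivatives. *)
Definition trig_int u v x := rint (fun y => u y * cos (x * y) + v y * sin (x * y)).

Let mcos x : measurable_fun [set: R] (fun y => cos (x * y)).
Proof.
apply: (@measurableT_comp _ _ _ _ _ _ (@cos R)); last exact: measurable_funM.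
exact: continuous_measurable_fun (@continuous_cos R).
Qed.

Let msin x : measurable_fun [set: R] (fun y => sin (x * y)).
Proof.
apply: (@measurableT_comp _ _ _ _ _ _ (@sin R)); last exact: measurable_funM.
exact: continuous_measurable_fun (@continuous_sin R).
Qed.

Lemma bsupp_trig u v x : bsupp u -> bsupp v ->
  bsupp (fun y => u y * cos (x * y) + v y * sin (x * y)).
Proof.
move=> bu bv; apply: bsuppD; apply: bsuppM => // y; [exact: cos_max|exact: sin_max].
Qed.

Lemma is_derive_trig_int u v x : bsupp u -> bsupp v ->
  is_derive x (1 : R) (trig_int u v) (trig_int (fun y => y * v y) (fun y => - (y * u y)) x).
Proof.
move=> bu bv.
pose f (x : R) (y : R) := u y * cos (x * y) + v y * sin (x * y).
pose f' (x : R) (y : R) := y * v y * cos (x * y) + - (y * u y) * sin (x * y).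
have df z y : is_derive z (1 : R) (f ^~ y) (f' z y).
  have dl : is_derive z (1 : R) (fun t => t * y) y.
    by apply: is_derive_eq; rewrite /GRing.scale/= mulr1 mulr0 add0r.
  have dc := @is_derive1_comp _ cos (fun t => t * y) z _ _ (is_derive_cos _) dl.
  have ds := @is_derive1_comp _ sin (fun t => t * y) z _ _ (is_derive_sin _) dl.
  rewrite /f; apply: is_derive_eq.
  by rewrite /GRing.scale/= /f'; ring.
have If z : ball x 1 z -> mu.-integrable [set: R] (EFin \o f z).
  by move=> _; exact: (bsupp_rintable (bsupp_trig z bu bv)).
pose G y := `|y * v y| + `|y * u y|.
have IG : mu.-integrable [set: R] (EFin \o G).
  apply: (@rintableD _ (fun y => `|y * v y|) (fun y => `|y * u y|));
  by apply: rintable_norm; apply: bsupp_rintable; exact: bsuppX.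
have G0 y : 0 <= G y by rewrite addr_ge0.
have d1 z y : partial1of2 f z y = f' z y.
  by rewrite partial1of2E; have [_ ->] := df z y.
have Gub z y : `|partial1of2 f z y| <= G y.
  rewrite d1 /f' (le_trans (ler_normD _ _))// !normrM normrN lerD//.
    by rewrite -normrM ler_piMr// cos_max.
  by rewrite normrM ler_piMr ?mulr_ge0// sin_max.
have xI : `]x - 1, x + 1[%classic x by rewrite /= in_itv/=; lra.
have If' z : `]x - 1, x + 1[%classic z -> mu.-integrable [set: R] (EFin \o f z).
  by move=> _; exact: (bsupp_rintable (bsupp_trig z bu bv)).
have Df z y : `]x - 1, x + 1[%classic z -> [set: R] y -> derivable (f ^~ y) z 1.
  by move=> _ _; exact: ex_derive.
have Gub' z y : `]x - 1, x + 1[%classic z -> [set: R] y -> `|partial1of2 f z y| <= G y.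
  by move=> _ _.
apply: DeriveDef.
  exact: (derivable_under_integral measurableT xI If' Df G0 IG Gub').
rewrite -derive1E (differentiation_under_integral measurableT xI If' Df G0 IG Gub').
by congr Rintegral; apply/funext => y; exact: d1.
Qed.

Lemma derive1n_trig_int p u v : bsupp u -> bsupp v -> exists u' v',
  [/\ bsupp u', bsupp v' & derive1n p (trig_int u v) = trig_int u' v'].
Proof.
move=> bu bv; elim: p => [|p [u' [v' [bu' bv' E]]]]; first by exists u, v.
exists (fun y => y * v' y), (fun y => - (y * u' y)); split.
- exact: bsuppX.
- by under eq_fun do rewrite -mulN1r; apply: bsuppZ; exact: bsuppX.
- rewrite derive1nS E; apply/funext => x; rewrite derive1E.
  by have [_ ->] := is_derive_trig_int x bu' bv'.
Qed.

Lemma csmooth_ifourier (G : R -> R[i]) : LipC G -> csmooth (ifourier G).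
Proof.
move=> LG; have [M GM] := LG; have [g1 g2 _] := GM; have [m1 m2] := LipC_cmeas LG.
have bR : bsupp (fRe G).
  split => //; exists M; split => x; first by rewrite (le_trans (normRe_le _)).
  by move=> h; rewrite /fRe g2.
have bI : bsupp (fIm G).
  split => //; exists M; split => x; first by rewrite (le_trans (normIm_le _)).
  by move=> h; rewrite /fIm g2.
have IG x := fourier_cintable x (LipC_cintable LG).
pose c : R := (2 * pi)^-1.
have ER : fRe (ifourier G) = trig_int (fun y => c * fRe G y) (fun y => c * fIm G y).
  apply/funext => x; rewrite /fRe /ifourier cRe_realM fourierE Re_cint.
  rewrite -rintZ; last exact: (IG (- x)).1.
  congr rint; apply/funext => y; rewrite cReM/= mulrN cosN sinN [y * x]mulrC.
  by rewrite /fRe /fIm -/c; ring.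
have EI : fIm (ifourier G) = trig_int (fun y => c * fIm G y) (fun y => - c * fRe G y).
  apply/funext => x; rewrite /fIm /ifourier cIm_realM fourierE Im_cint.
  rewrite -rintZ; last exact: (IG (- x)).2.
  congr rint; apply/funext => y; rewrite cImM/= mulrN cosN sinN [y * x]mulrC.
  by rewrite /fRe /fIm -/c; ring.
move=> p x; rewrite ER EI; split.
  have [u [v [bu bv ->]]] := derive1n_trig_int p (bsuppZ c bR) (bsuppZ c bI).
  by have [] := is_derive_trig_int x bu bv.
have [u [v [bu bv ->]]] := derive1n_trig_int p (bsuppZ c bI) (bsuppZ (- c) bR).
by have [] := is_derive_trig_int x bu bv.
Qed.

End SmoothFourier.

(** * A calculus of derivative bounds *)

Section DerivativeBounds.
Context {R : realType}.
Implicit Types (f g : R -> R) (x a b A C D : R) (n j p : nat).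

(* The constants are those of (1 - A x)^(-j/2): the level [j] of a product is
   the sum of the levels, with the same [A]. *)
Fixpoint gbound A n j C f : Prop :=
  (forall x, `|f x| <= C * j`!%:R) /\
  (if n is n'.+1 then exists f', (forall x : R, is_derive x (1 : R) f (f' x)) /\
     gbound A n' j.+2 (C * A * j%:R) f' else True).

Lemma gbound_bound A n j C f x : gbound A n j C f -> `|f x| <= C * j`!%:R.
Proof. by case: n => [|n] []. Qed.

Lemma gbound_ge0 A n j C f : gbound A n j C f -> 0 <= C.
Proof.
move=> /gbound_bound -/(_ 0) h; have : 0 <= C * j`!%:R by exact: le_trans h.
by rewrite pmulr_lge0// ltr0n fact_gt0.
Qed.

Lemma gbound_le A A' n j j' C C' f : 0 <= A -> A <= A' -> (j <= j')%N -> C <= C' ->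
  gbound A n j C f -> gbound A' n j' C' f.
Proof.
move=> A0 AA; elim: n j j' C C' f => [|n IHn] j j' C C' f jj CC fb;
  have C0 := gbound_ge0 fb.
  split => // x; rewrite (le_trans (gbound_bound x fb))// ler_pM// ler_nat.
  exact: leq_fact.
split=> [x|].
  by rewrite (le_trans (gbound_bound x fb))// ler_pM// ler_nat leq_fact.
case: fb => _ [f' [df fb]]; exists f'; split => //.
by apply: IHn fb => //; rewrite ?ltnS// ler_pM ?mulr_ge0 ?ler_nat// ler_pM.
Qed.

Lemma gboundW A n j C f : gbound A n.+1 j C f -> gbound A n j C f.
Proof.
elim: n j C f => [|n IHn] j C f; first by case.
move=> [h [f' [df fb]]]; split => //; exists f'; split => //.
exact: IHn.
Qed.

Lemma gboundD A n j C D f g : gbound A n j C f -> gbound A n j D g ->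
  gbound A n j (C + D) (fun x => f x + g x).
Proof.
elim: n j C D f g => [|n IHn] j C D f g [fb fd] [gb gd].
  by split => // x; rewrite (le_trans (ler_normD _ _))// mulrDl lerD.
split=> [x|]; first by rewrite (le_trans (ler_normD _ _))// mulrDl lerD.
case: fd => f' [df fb']; case: gd => g' [dg gb'].
exists (fun x => f' x + g' x); split.
  by move=> x; have := df x; have := dg x => ? ?; apply: is_deriveD.
by rewrite !mulrDl; exact: IHn.
Qed.

Lemma gboundZ A n j C c f : gbound A n j C f ->
  gbound A n j (`|c| * C) (fun x => c * f x).
Proof.
elim: n j C f => [|n IHn] j C f [fb fd].
  by split => // x; rewrite normrM -mulrA ler_wpM2l.
split=> [x|]; first by rewrite normrM -mulrA ler_wpM2l.
case: fd => f' [df fb']; exists (fun x => c * f' x); split.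
  by move=> x; have ? := df x; apply: is_deriveZ.
by rewrite (_ : `|c| * C * A * _ = `|c| * (C * A * j%:R)); [exact: IHn|ring].
Qed.

(** For the values, [j! l! <= (j + l)!]. For the derivative, the constants of the two terms of
    Leibniz' rule add up exactly: [C D A (j + l)] is [C A j D + C D A l]. *)
Lemma gboundM A n j l C D f g : gbound A n j C f -> gbound A n l D g ->
  gbound A n (j + l) (C * D) (fun x => f x * g x).
Proof.
have b0 m (j' l' : nat) C' D' f' g' : gbound A m j' C' f' -> gbound A m l' D' g' ->
    forall x, `|f' x * g' x| <= C' * D' * (j' + l')`!%:R.
  move=> fb gb x; have := ler_pM (normr_ge0 _) (normr_ge0 _)
    (gbound_bound x fb) (gbound_bound x gb).
  rewrite normrM => /le_trans; apply.
  rewrite mulrACA ler_wpM2l ?mulr_ge0 ?(gbound_ge0 fb) ?(gbound_ge0 gb)// -natrM ler_nat.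
  by rewrite -(@bin_fact (j' + l') j') ?leq_addr// addKn leq_pmull// bin_gt0 leq_addr.
elim: n j l C D f g => [|n IHn] j l C D f g fb gb; split; try exact: b0 fb gb.
  by [].
have fW := gboundW fb; have gW := gboundW gb.
case: fb => _ [f' [df fb']]; case: gb => _ [g' [dg gb']].
exists (fun x => f' x * g x + f x * g' x); split.
  move=> x; have ? := df x; have ? := dg x; apply: is_derive_eq.
  by rewrite /GRing.scale/=; ring.
rewrite (_ : C * D * A * (j + l)%:R = C * A * j%:R * D + C * (D * A * l%:R)).
  apply: gboundD; first by rewrite -addSn -addSn; exact: IHn.
  by rewrite -addnS -addnS; exact: IHn.
by rewrite natrD; ring.
Qed.

Lemma gbound_affine A n j C f a b : gbound A n j C f ->
  gbound (`|a| * A) n j C (fun x => f (a * x + b)).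
Proof.
elim: n j C f => [|n IHn] j C f [fb fd]; first by split.
split => //; case: fd => f' [df fb']; exists (fun x => a * f' (a * x + b)); split.
  move=> x.
  have da : is_derive x (1 : R) (fun t => a * t + b) a.
    by apply: is_derive_eq; rewrite /GRing.scale/= ?(mulr1,mulr0,addr0).
  have := @is_derive1_comp _ f (fun t => a * t + b) x _ _ (df _) da.
  by rewrite mulrC.
rewrite (_ : C * _ * _ = `|a| * (C * A * j%:R)); last by ring.
by apply: gboundZ; exact: IHn.
Qed.

Lemma gbound_cst A n j C c : 0 <= A -> `|c| <= C -> gbound A n j C (cst c).
Proof.
move=> A0; elim: n j C c => [|n IHn] j C c cC.
  by split => // x; rewrite (le_trans cC)// ler_peMr ?ler1n ?fact_gt0// (le_trans _ cC).
split=> [x|].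
  by rewrite (le_trans cC)// ler_peMr ?ler1n ?fact_gt0// (le_trans _ cC).
exists (cst 0); split.
  by move=> x; exact: is_derive_cst.
by apply: IHn; rewrite normr0 !mulr_ge0// (le_trans _ cC).
Qed.

(* Composition with sine and cosine: their derivatives only produce factors
   th', so no chain rule of higher order is needed. *)
Lemma gbound_trig A D (th th' : R -> R) : 0 <= A ->
  (forall x : R, is_derive x (1 : R) th (th' x)) -> (forall n, gbound A n 2 D th') ->
  forall n j C f, (0 < j)%N -> gbound A n j C f ->
  gbound (A + D) n j C (fun x => f x * sin (th x)) /\
  gbound (A + D) n j C (fun x => f x * cos (th x)).
Proof.
move=> A0 dth thb; have D0 := gbound_ge0 (thb 0%N).
have AD : A <= A + D by rewrite lerDl.
elim=> [|n IHn] j C f j0 fb; have C0 := gbound_ge0 fb.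
  split; split => // x; rewrite normrM; apply: le_trans (gbound_bound x fb);
    rewrite ler_piMr//; [exact: sin_max|exact: cos_max].
have fW := gboundW fb; case: fb => fb [f' [df fb']].
have ds x := @is_derive1_comp _ sin th x _ _ (is_derive_sin _) (dth x).
have dc x := @is_derive1_comp _ cos th x _ _ (is_derive_cos _) (dth x).
(* Level 2 for [th'] puts this product at the level [j + 2] of [f'], so that both terms of the
   derivative can be added. *)
have fth : gbound A n j.+2 (C * D) (fun x => f x * th' x).
  by rewrite -addn2; exact: gboundM.
have [s1 c1] := IHn _ _ _ (ltn0Sn _) fb'.
have [s2 c2] := IHn _ _ _ (ltn0Sn _) fth.
(* The term coming from the angle carries no factor [j]; this is where [0 < j] enters. *)
have le : C * A * j%:R + C * D <= C * (A + D) * j%:R.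
  rewrite mulrDr mulrDl lerD2l ler_peMr ?mulr_ge0// ler1n//.
split; split.
- move=> x; rewrite normrM; apply: le_trans (fb x).
  by rewrite ler_piMr// sin_max.
- exists (fun x => f' x * sin (th x) + f x * th' x * cos (th x)); split.
    move=> x; have ? := df x; have ? := ds x; apply: is_derive_eq.
    by rewrite /GRing.scale/=; ring.
  apply: (gbound_le _ (lexx _) (leqnn _) le); first by rewrite addr_ge0.
  exact: gboundD.
- move=> x; rewrite normrM; apply: le_trans (fb x).
  by rewrite ler_piMr// cos_max.
- exists (fun x => f' x * cos (th x) + -1 * (f x * th' x * sin (th x))); split.
    move=> x; have ? := df x; have ? := dc x; apply: is_derive_eq.
    by rewrite /GRing.scale/=; ring.
  apply: (gbound_le _ (lexx _) (leqnn _) le); first by rewrite addr_ge0.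
  apply: gboundD => //; have := gboundZ (-1) s2.
  by rewrite normrN normr1 mul1r.
Qed.

(** The p-th derivative is at level [j + 2 p] with constant [C A^p] times the product of
    [j, j + 2, ..., j + 2 p - 2], and each of these factors is at most [j + 2 p]. *)
Lemma gbound_derive1n A j C f p x : 0 <= A -> (forall n, gbound A n j C f) ->
  derivable (derive1n p f) x 1 /\
  `|derive1n p f x| <= C * A ^+ p * (j + p.*2)%:R ^+ p * (j + p.*2)`!%:R.
Proof.
move=> A0; elim: p j C f => [|p IHp] j C f fb.
  rewrite derive1n0 !expr0 !mulr1 addn0; split; last exact: gbound_bound (fb 0%N).
  by have [_ [f' [df _]]] := fb 1%N; have [] := df x.
have [_ [f' [df _]]] := fb 1%N.
have Ef : derive1 f = f'.
  by apply/funext => y; rewrite derive1E; have [_ ->] := df y.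
(* [gbound] provides a derivative for each [n] separately; uniqueness of the derivative identifies
   them. *)
have fb' n : gbound A n j.+2 (C * A * j%:R) f'.
  have [_ [f'' [df' h]]] := fb n.+1.
  suff -> : f' = f'' by [].
  by rewrite -Ef; apply/funext => y; rewrite derive1E; have [_ ->] := df' y.
have -> : derive1n p.+1 f = derive1n p f' by rewrite /derive1n iterSr Ef.
have [h1 h2] := IHp _ _ _ fb'; split => //; apply: le_trans h2 _.
have C0 := gbound_ge0 (fb 0%N).
have -> : (j.+2 + p.*2 = j + p.+1.*2)%N by rewrite doubleS !addnS !addSn.
rewrite ler_wpM2r// [in leRHS]exprSr [in leRHS]exprSr.
rewrite (_ : C * A * j%:R * A ^+ p * _ =
    C * (A ^+ p * A) * ((j + p.+1.*2)%:R ^+ p * j%:R)); last by ring.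
rewrite ler_wpM2l ?mulr_ge0 ?exprn_ge0//.
by rewrite ler_wpM2l ?exprn_ge0// ler_nat leq_addr.
Qed.

End DerivativeBounds.

(** * The flat exponential *)

Section FlatFunction.
Context {R : realType}.
Implicit Types (x y : R) (k n j : nat).

(** The powers [x^-k] make the family stable: the derivative of [flat k] is a combination of
    [flat k.+2] and [flat k.+1], in step with the rise of the level by two in [gbound]. *)
Definition flat k x : R := if 0 < x then x^-1 ^+ k * expR (- x^-1) else 0.

Lemma flat_ge0 k x : 0 <= flat k x.
Proof.
rewrite /flat; case: ifPn => // x0.
by rewrite mulr_ge0 ?expR_ge0// exprn_ge0// invr_ge0 ltW.
Qed.

(** With [y = 1 / x] this is [y^k / k! <= e^y], one term of the exponential series. *)
Lemma flat_le k x : flat k x <= k`!%:R.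
Proof.
rewrite /flat; case: ifPn => // x0.
have y0 : 0 <= x^-1 by rewrite invr_ge0 ltW.
rewrite expRN ler_pdivrMr ?expR_gt0//; case: k => [|k].
  by rewrite expr0 fact0 mul1r -expR0 ler_expR.
have := expR_ge1Dxn k y0; have f0 : 0 < (k.+1)`!%:R :> R by rewrite ltr0n fact_gt0.
move=> h; rewrite mulrC -ler_pdivrMr//; apply: le_trans h.
by rewrite lerDr.
Qed.

Lemma flat_mul k x : 0 < x -> flat k x = flat k.+1 x * x.
Proof.
move=> x0; have xn : x != 0 by rewrite gt_eqF.
by rewrite /flat x0 exprS; move: (expR _) (_ ^+ k) => E y; field.
Qed.

(** For [x > 0], [flat k x] is [flat k.+2 x * x ^+ 2]. The quadratic bound makes the difference
    quotients at 0 tend to 0. *)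
Lemma flat_le_sqr k x : flat k x <= (k.+2)`!%:R * x ^+ 2.
Proof.
have [x0|x0] := ltP 0 x; last by rewrite {1}/flat ltNge x0/= mulr_ge0 ?sqr_ge0.
by rewrite flat_mul// flat_mul// -mulrA -expr2 ler_wpM2r ?sqr_ge0// flat_le.
Qed.

Lemma is_derive_flat0 k : is_derive (0 : R) (1 : R) (flat k) 0.
Proof.
have h : h^-1 *: (flat k (h *: 1 + 0) - flat k 0) @[h --> (0 : R)^'] --> (0 : R).
  apply/cvgrPdist_le => e e0.
  have f0 : 0 < (k.+2)`!%:R :> R by rewrite ltr0n fact_gt0.
  have ef : 0 < e / (k.+2)`!%:R by rewrite divr_gt0.
  near=> h.
  have hn : h != 0 by near: h; exact: nbhs_dnbhs_neq.
  rewrite sub0r normrN /GRing.scale/= mulr1 addr0 [flat k 0]/flat ltxx subr0.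
  rewrite normrM normfV mulrC ler_pdivrMr ?normr_gt0// ger0_norm ?flat_ge0//.
  rewrite (le_trans (flat_le_sqr _ _))// -real_normK ?num_real// expr2 mulrA.
  rewrite ler_wpM2r// mulrC -ler_pdivlMr//.
  near: h; apply: dnbhs0_le; exact: ef.
apply: DeriveDef.
  by apply/cvg_ex; exists 0.
by apply/cvg_lim.
Unshelve. all: end_near. Qed.

Lemma is_derive_flat k x :
  is_derive x (1 : R) (flat k) (flat k.+2 x - k%:R * flat k.+1 x).
Proof.
have [x0|x0|->] := ltgtP x 0.
- have -> : flat k.+2 x - k%:R * flat k.+1 x = 0.
    by rewrite /flat ltNge (ltW x0)/= mulr0 subr0.
  apply: (@near_eq_is_derive R R R (cst 0) _ _ _ 0).
  near=> y; rewrite /flat ltNge (_ : y <= 0)//.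
  by apply: ltW; near: y; exact: lt_nbhsl.
- have xn : x != 0 by rewrite gt_eqF.
  apply: (@near_eq_is_derive R R R (fun y => y^-1 ^+ k * expR (- y^-1))).
    near=> y; rewrite /flat ifT//.
    by near: y; exact: lt_nbhsr.
  have dV : is_derive x (1 : R) (fun y : R => y^-1) (- x ^- 2 *: 1).
    exact: (@is_deriveV R id x 1 1 xn (is_derive_id _ _)).
  have dX : is_derive x (1 : R) (fun y : R => y^-1 ^+ k) ((k%:R * x^-1 ^+ k.-1) *: (- x ^- 2 *: 1)).
    have := is_deriveX k dV; congr (is_derive _ _ _ _).
    by apply/funext => y; elim: k => [|k IHk]; rewrite ?expr0// exprS [in RHS]exprS -IHk.
  have dN : is_derive x (1 : R) (fun y : R => - y^-1) (- (- x ^- 2 *: 1)).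
    exact: is_deriveN.
  have dE := @is_derive1_comp _ expR (fun y : R => - y^-1) x _ _ (is_derive_expR _) dN.
  apply: is_derive_eq.
  rewrite /GRing.scale/= !mulr1 /flat x0 -!exprVn; move: (expR (- x^-1)) => E; move: (x^-1) => y.
  case: k {dX} => [|k] /=; first by rewrite !(mul0r,mulr0) expr0; ring.
  by rewrite !exprS; ring.
- by rewrite /flat !ltxx mulr0 subr0; exact: is_derive_flat0.
Unshelve. all: end_near. Qed.

(** The constant 2 comes from the coefficients of the derivative: [1 + k <= 2 j] as soon as [k <= j]
    and [1 <= j]. *)
Lemma gbound_flat n j k : (k <= j)%N -> (0 < j)%N -> gbound 2 n j 1 (flat k).
Proof.
elim: n j k => [|n IHn] j k kj j0.
  split => // x; rewrite ger0_norm ?flat_ge0// mul1r (le_trans (flat_le _ _))//.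
  by rewrite ler_nat leq_fact.
split=> [x|].
  rewrite ger0_norm ?flat_ge0// mul1r (le_trans (flat_le _ _))//.
  by rewrite ler_nat leq_fact.
exists (fun x => flat k.+2 x + (- k%:R) * flat k.+1 x); split.
  by move=> x; rewrite mulNr; exact: is_derive_flat.
have h1 : gbound 2 n j.+2 1 (flat k.+2) by apply: IHn.
have h2 : gbound 2 n j.+2 1 (flat k.+1) by apply: IHn => //; rewrite ltnS (leq_trans kj).
have := gboundD h1 (gboundZ (- k%:R) h2); apply: gbound_le => //.
rewrite normrN normr_nat mulr1 mul1r.
have : k%:R <= j%:R :> R by rewrite ler_nat.
have : 1 <= j%:R :> R by rewrite ler1n.
lra.
Qed.

End FlatFunction.

(** * A smooth step whose mirrored squares add up to 1 *)

Section SmoothStep.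
Context {R : realType}.
Local Notation mu := (@lebesgue_measure R).
Implicit Types (x y : R) (n : nat).

Definition bump x : R := flat 0 x * flat 0 (- 1 * x + 1).

Lemma bump_ge0 x : 0 <= bump x.
Proof. by rewrite mulr_ge0 ?flat_ge0. Qed.

Lemma gbound_bump n : gbound 2 n 2 1 bump.
Proof.
rewrite -[X in gbound _ _ _ X _]mulr1 -[2%N]/(1 + 1)%N; apply: gboundM.
  exact: gbound_flat.
have := gbound_affine (-1) 1 (@gbound_flat R n 1 0 isT isT).
by rewrite normrN normr1 mul1r.
Qed.

Lemma bump_sym x : bump (1 - x) = bump x.
Proof. by rewrite /bump mulrC; congr (flat 0 _ * flat 0 _); ring. Qed.

Lemma bump_out x : x <= 0 \/ 1 <= x -> bump x = 0.
Proof.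
rewrite /bump; case=> h; first by rewrite {1}/flat ltNge h mul0r.
by rewrite [X in _ * X]/flat ltNge (_ : -1 * x + 1 <= 0) ?mulr0//; lra.
Qed.

Lemma bump_gt0 x : 0 < x < 1 -> 0 < bump x.
Proof.
move=> /andP[h1 h2]; have h3 : 0 < -1 * x + 1 by lra.
by rewrite /bump /flat h1 h3 !expr0 !mul1r mulr_gt0 ?expR_gt0.
Qed.

Lemma continuous_bump : continuous bump.
Proof.
have [_ [f' [df _]]] := gbound_bump 1.
by move=> x; apply: differentiable_continuous; apply/derivable1_diffP/ex_derive.
Qed.

Let bm : measurable_fun [set: R] bump.
Proof. exact: continuous_measurable_fun continuous_bump. Qed.

Let b2 x : `|bump x| <= 2.
Proof. by have := gbound_bound x (gbound_bump 0); rewrite mul1r. Qed.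

Let bs x : 2 < `|x| -> bump x = 0.
Proof.
move=> h; apply: bump_out; have [x0|x0] := leP x 0; first by left.
by right; move: h; rewrite gtr0_norm//; lra.
Qed.

Definition bump_int := primitive bump.

Lemma is_derive_bump_int x : is_derive x (1 : R) bump_int (bump x).
Proof.
have Ig : rintable bump by exact: (rintable_bsupp bm b2 bs).
have E : bump_int = fun x => Rintegral mu [set` `]-oo, x]] bump.
  apply/funext => y; rewrite Rintegral_mkcond /bump_int /primitive /rint; congr Rintegral.
  apply/funext => t; rewrite patchE /halfline mem_setE in_itv/=.
  by case: ifP => _; rewrite ?mul1r ?mul0r.
have x1 : x < x + 1 by rewrite ltrDl.
have Iu : mu.-integrable [set` Interval -oo%O (BRight (x + 1))] (EFin \o bump).
  by apply: integrableS Ig => //; exact: measurable_itv.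
have [|h1 h2] := continuous_FTC1 x1 Iu _ (@continuous_bump x).
  by rewrite /= ltNyr.
by rewrite E; apply: DeriveDef => //; rewrite -derive1E.
Qed.

Lemma bump_int0 x : x <= 0 -> bump_int x = 0.
Proof.
move=> x0; rewrite -[RHS]rint0; congr rint; apply/funext => t.
rewrite /halfline; case: ifPn => h; last by rewrite mul0r.
by rewrite bump_out ?mulr0//; left; exact: le_trans x0.
Qed.

Lemma bump_int1 x : 1 <= x -> bump_int x = bump_int 1.
Proof.
move=> x1; congr rint; apply/funext => t.
have [t1|t1] := leP t 1; first by rewrite /halfline t1 (le_trans t1 x1).
by rewrite bump_out ?mulr0//; right; exact: ltW.
Qed.

Lemma bump_int_ge0 x : 0 <= bump_int x.
Proof.
apply: rint_ge0 => t; rewrite mulr_ge0 ?bump_ge0// /halfline.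
by case: ifP.
Qed.

(** By the symmetry of the bump, [bump_int (1 - x) + bump_int x] has derivative 0; its value is read
    off at 0. *)
Lemma bump_int_sym x : bump_int (1 - x) = bump_int 1 - bump_int x.
Proof.
pose f y := bump_int (1 - y) + bump_int y.
have df y : is_derive y (1 : R) f 0.
  have d1 : is_derive y (1 : R) (fun t : R => 1 - t) (-1).
    by apply: is_derive_eq; rewrite add0r mul1r.
  have d2 := @is_derive1_comp _ bump_int (fun t : R => 1 - t) y _ _ (is_derive_bump_int _) d1.
  have d3 := is_derive_bump_int y.
  apply: is_derive_eq.
  by rewrite bump_sym; ring.
have fc : f x = f 0 by exact: is_derive_0_is_cst.
move: fc; rewrite /f subr0 [X in _ = _ + X]bump_int0// addr0 => <-.
by rewrite addrK.
Qed.

Lemma bump_int1_gt0 : 0 < bump_int 1.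
Proof.
have [|c] := @MVT _ bump_int bump 0 1 ltr01 (fun z _ => is_derive_bump_int z).
  apply: derivable_within_continuous => z _.
  by have [] := is_derive_bump_int z.
rewrite in_itv/= (bump_int0 (lexx 0)) !subr0 mulr1 => /bump_gt0 h ->.
exact: h.
Qed.

(** Normalised to rise from 0 to [pi / 2]. Replacing [x] by [1 - x] yields the complementary angle,
    hence exchanges sine and cosine. *)
Definition step_angle x : R := pi / 2 / bump_int 1 * bump_int x.
Definition step x : R := sin (step_angle x).

Lemma is_derive_step_angle x :
  is_derive x (1 : R) step_angle (pi / 2 / bump_int 1 * bump x).
Proof.
have ? := is_derive_bump_int x; apply: is_deriveZ.
Qed.

Lemma step_angle_itv x : 0 <= step_angle x <= pi / 2.
Proof.
have I0 := bump_int1_gt0; have p0 : 0 <= pi / 2 :> R by rewrite divr_ge0// pi_ge0.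
rewrite /step_angle; move: (pi / 2) p0 => p p0; apply/andP; split.
  by rewrite mulr_ge0 ?bump_int_ge0// divr_ge0// ltW.
rewrite -mulrA ler_piMr// mulrC ler_pdivrMr// mul1r.
by have := bump_int_ge0 (1 - x); rewrite bump_int_sym subr_ge0.
Qed.

Lemma step_itv x : 0 <= step x <= 1.
Proof.
have /andP[h1 h2] := step_angle_itv x.
rewrite /step sin_le1 andbT; apply: sin_ge0_pi; rewrite h1 (le_trans h2)//.
by rewrite ler_pdivrMr// ler_peMr ?pi_ge0// ler1n.
Qed.

Lemma step_eq0 x : x <= 0 -> step x = 0.
Proof. by move=> h; rewrite /step /step_angle (bump_int0 h) mulr0 sin0. Qed.

Lemma step_eq1 x : 1 <= x -> step x = 1.
Proof.
move=> h; rewrite /step /step_angle (bump_int1 h) divfK ?gt_eqF ?bump_int1_gt0//.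
exact: sin_pihalf.
Qed.

Lemma step_sqrD x : step x ^+ 2 + step (1 - x) ^+ 2 = 1.
Proof.
have I0 := bump_int1_gt0.
have -> : step (1 - x) = cos (step_angle x).
  rewrite /step (_ : step_angle (1 - x) = - step_angle x + pi / 2).
    by rewrite sinDpihalf cosN.
  rewrite /step_angle bump_int_sym mulrBr divfK ?gt_eqF//.
  by rewrite addrC.
by rewrite addrC cos2Dsin2.
Qed.

Lemma gbound_step : exists A, 0 <= A /\ forall n, gbound A n 1 1 step.
Proof.
pose c : R := pi / 2 / bump_int 1.
exists (2 + `|c| * 1); split; first by rewrite addr_ge0// mulr_ge0.
move=> n.
have := @gbound_trig R 2 (`|c| * 1) step_angle _ (ler0n _ _) is_derive_step_angle
  (fun n => gboundZ c (gbound_bump n)) n 1 1 (cst 1) isT.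
case; first by apply: gbound_cst; rewrite ?normr1.
by rewrite (_ : (fun x => _ * sin _) = step)//; apply/funext => x; rewrite /= mul1r.
Qed.

End SmoothStep.

(** * From derivative bounds to the extended Gevrey classes *)

Section GevreyEstimate.
Context {R : realType}.
Implicit Types (f : R -> R) (A C h tau sigma : R) (j p : nat).

Definition gevrey_weight tau sigma h p : R :=
  h `^ (p%:R `^ sigma) * gevreyM tau sigma p.

Lemma gevrey_weight_gt0 tau sigma h p : 0 < h -> 0 < gevrey_weight tau sigma h p.
Proof.
move=> h0; rewrite mulr_gt0 ?powR_gt0//.
by case: p => // p; rewrite powR_gt0.
Qed.

Lemma fact_leq_exp m : (m`! <= m ^ m)%N.
Proof.
suff h k : (k <= m -> k`! <= m ^ k)%N by exact: h.
elim: k => // k IHk km; rewrite factS expnS leq_mul// IHk//; exact: ltnW.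
Qed.

(** Since [j + 2 p <= 3 p <= p^2], the three factors are at most [p^p], [p^(2 p)] and [(p^2)^(3 p)],
    and the exponents add up to [9 p]. *)
Lemma bound_le_exp9 A j p : 0 <= A -> A <= p%:R -> (j <= p)%N -> (3 <= p)%N ->
  A ^+ p * (j + p.*2)%:R ^+ p * (j + p.*2)`!%:R <= p%:R ^+ (9 * p) :> R.
Proof.
move=> A0 Ap jp p3.
have m3 : (j + p.*2 <= 3 * p)%N by lia.
have m2 : (j + p.*2 <= p ^ 2)%N by rewrite (leq_trans m3)// expnS expn1 leq_mul.
have p0 : (0 < p)%N by lia.
have -> : (9 * p = p + (2 * p + 2 * (3 * p)))%N by lia.
rewrite (exprD _ p) (exprD _ (2 * p)%N) mulrA ler_pM ?mulr_ge0 ?exprn_ge0//.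
  rewrite ler_pM ?exprn_ge0//.
    by apply: lerXn2r; rewrite ?nnegrE.
  by rewrite -!natrX ler_nat expnM leq_exp2r.
rewrite -natrX ler_nat (leq_trans (fact_leq_exp _))// expnM.
rewrite (@leq_trans ((p ^ 2) ^ (j + p.*2))%N)//; first by rewrite leq_exp2r; lia.
by rewrite leq_pexp2l// expn_gt0 p0.
Qed.

(** One half of the exponent [tau p^sigma] compensates for [h^(p^sigma)], however small [h] is; the
    other half exceeds [9 p] for large [p] because [sigma > 1]. *)
Lemma exp9_le_weight tau sigma h : 0 < tau -> 1 < sigma -> 0 < h ->
  exists P : nat, forall p, (P <= p)%N ->
    p%:R ^+ (9 * p) <= gevrey_weight tau sigma h p.
Proof.
move=> tau0 s1 h0; have s0 : 0 < sigma - 1 by rewrite subr_gt0.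
(* From [B1] on, [p^(tau / 2) >= h^-1]; from [B2] on, [p^(sigma - 1) >= 18 / tau], that is
   [(tau / 2) p^sigma >= 9 p]. *)
pose B1 := h^-1 `^ (2 / tau); pose B2 := (18 / tau) `^ (sigma - 1)^-1.
exists (Num.bound B1 + Num.bound B2).+1 => -[//|q]; set p := q.+1 => Pp.
have P0 : 1 <= p%:R :> R by rewrite ler1n.
have P1 : B1 <= p%:R.
  rewrite (le_trans (ltW (archi_boundP (powR_ge0 _ _))))// ler_nat.
  by apply: leq_trans Pp; rewrite leqW// leq_addr.
have P2 : B2 <= p%:R.
  rewrite (le_trans (ltW (archi_boundP (powR_ge0 _ _))))// ler_nat.
  by apply: leq_trans Pp; rewrite leqW// leq_addl.
have pp : 0 < p%:R :> R by apply: lt_le_trans P0.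
have e1 : h^-1 <= p%:R `^ (tau / 2).
  have -> : h^-1 = B1 `^ (tau / 2).
    rewrite /B1 -powRrM (_ : 2 / tau * (tau / 2) = 1) ?powRr1 ?invr_ge0 ?ltW//.
    by have := gt_eqF tau0; move/negbT => ?; field.
  by rewrite ge0_ler_powR ?nnegrE ?powR_ge0 ?divr_ge0// ltW.
have e2 : 18 / tau <= p%:R `^ (sigma - 1).
  have -> : 18 / tau = B2 `^ (sigma - 1).
    by rewrite /B2 -powRrM mulVf ?gt_eqF// powRr1// divr_ge0// ltW.
  by rewrite ge0_ler_powR ?nnegrE ?powR_ge0// ltW.
pose S := p%:R `^ sigma.
have S0 : 0 <= S by exact: powR_ge0.
have SE : S = p%:R * p%:R `^ (sigma - 1).
  rewrite /S -[X in X * _]powRr1 ?ltW// -powRD; last first.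
    by rewrite (gt_eqF pp) implybT.
  by congr (_ `^ _); rewrite addrC subrK.
have e3 : (9 * p)%:R <= tau / 2 * S.
  rewrite SE natrM mulrCA mulrC ler_wpM2l ?(ltW pp)//.
  have := ler_wpM2l (ltW (divr_gt0 tau0 (ltr0n R 2))) e2.
  rewrite (_ : tau / 2 * (18 / tau) = 9)//.
  by have := gt_eqF tau0; move/negbT => ?; field.
have -> : gevrey_weight tau sigma h p = h `^ S * p%:R `^ (tau * S) by [].
rewrite -powR_mulrn ?(ltW pp)//.
apply: (le_trans (ler_powR P0 e3)).
rewrite -ler_pdivrMl ?powR_gt0// -powRN -[- S]mulN1r (powRrM h) powR_inv1 ?(ltW h0)//.
apply: (@le_trans _ _ ((p%:R `^ (tau / 2)) `^ S * p%:R `^ (tau / 2 * S))).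
  rewrite ler_wpM2r ?powR_ge0// ge0_ler_powR ?nnegrE ?powR_ge0//.
  by rewrite invr_ge0 ltW.
rewrite -powRrM -powRD; last by rewrite (gt_eqF pp) implybT.
by rewrite -mulrDl -splitr.
Qed.

(** From [Q] on the weight dominates by itself; the finitely many smaller [p] are paid for by the
    sum [S] of the ratios. The final 1 in the constant keeps it positive when [C = 0]. *)
Lemma growth_bound_le_weight A C j tau sigma h : 0 <= A -> 0 <= C ->
  0 < tau -> 1 < sigma -> 0 < h ->
  exists2 D, 0 < D & forall p,
    C * A ^+ p * (j + p.*2)%:R ^+ p * (j + p.*2)`!%:R <=
    D * gevrey_weight tau sigma h p.
Proof.
move=> A0 C0 tau0 s1 h0; have [P hP] := exp9_le_weight tau0 s1 h0.
pose u p : R := A ^+ p * (j + p.*2)%:R ^+ p * (j + p.*2)`!%:R.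
have u0 p : 0 <= u p by rewrite !mulr_ge0 ?exprn_ge0.
have v0 p := gevrey_weight_gt0 tau sigma p h0.
pose Q := (P + Num.bound A + j + 3)%N.
pose S := \sum_(i < Q) u i / gevrey_weight tau sigma h i.
have S0 : 0 <= S by apply: sumr_ge0 => i _; rewrite divr_ge0// ltW.
exists (C * (1 + S) + 1) => [|p].
  by rewrite ltr_pwDr// mulr_ge0// addr_ge0.
apply: (@le_trans _ _ (C * ((1 + S) * gevrey_weight tau sigma h p))); last first.
  by rewrite mulrA ler_wpM2r ?(ltW (v0 p))// lerDl.
rewrite -!mulrA ler_wpM2l// mulrA -/(u p).
have [pQ|pQ] := ltnP p Q.
  rewrite -ler_pdivrMr ?v0// (@le_trans _ _ S) ?lerDr//.
  rewrite /S (bigD1 (Ordinal pQ))//= lerDl sumr_ge0// => i _.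
  by rewrite divr_ge0// ltW.
apply: (@le_trans _ _ (gevrey_weight tau sigma h p)); last first.
  by rewrite ler_peMl ?(ltW (v0 p))// lerDl.
apply: le_trans (hP p _); last by lia.
apply: bound_le_exp9 => //; try lia.
rewrite (le_trans (ltW (archi_boundP A0)))// ler_nat; lia.
Qed.

Lemma csmooth_gbound (f : R -> R[i]) A C j : 0 <= A ->
  (forall n, gbound A n j C (fRe f)) -> (forall n, gbound A n j C (fIm f)) ->
  csmooth f.
Proof.
move=> A0 fR fI p x; split.
  by have [] := gbound_derive1n p x A0 fR.
by have [] := gbound_derive1n p x A0 fI.
Qed.

Lemma gevrey_bound_gbound (f : R -> R[i]) A C j tau sigma h : 0 <= A ->
  (forall n, gbound A n j C (fRe f)) -> (forall n, gbound A n j C (fIm f)) ->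
  0 < tau -> 1 < sigma -> 0 < h ->
  exists2 D, 0 < D & forall K, gevrey_bound tau sigma f K D h.
Proof.
move=> A0 fR fI tau0 s1 h0.
have [D D0 hD] := growth_bound_le_weight j A0 (gbound_ge0 (fR 0%N)) tau0 s1 h0.
exists (D + D) => [|K x p _]; first exact: addr_gt0.
rewrite (le_trans (normc_le _))// -mulrA mulrDl lerD// (le_trans _ (hD p))//.
  by have [] := gbound_derive1n p x A0 fR.
by have [] := gbound_derive1n p x A0 fI.
Qed.

Lemma gevreyE_gbound (f : R -> R[i]) A C j k tau sigma : 0 <= A ->
  (forall n, gbound A n j C (fRe f)) -> (forall n, gbound A n j C (fIm f)) ->
  0 < tau -> 1 < sigma -> gevreyE k tau sigma f.
Proof.
move=> A0 fR fI tau0 s1; split; first exact: csmooth_gbound fR fI.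
move=> K _; case: k => [|h h0].
  have [D D0 hD] := gevrey_bound_gbound A0 fR fI tau0 s1 ltr01.
  by exists D, 1.
by have [D D0 hD] := gevrey_bound_gbound A0 fR fI tau0 s1 h0; exists D.
Qed.

End GevreyEstimate.

(** * The concrete window *)

Section SmoothWindow.
Context {R : realType}.
Implicit Types (w f : R -> R) (x y A C : R) (n j p : nat).

Lemma gbound_lipschitz A j C f : gbound A 1 j C f ->
  exists L, forall x y, `|f x - f y| <= L * `|x - y|.
Proof.
move=> [_ [f' [df /= [f'b _]]]]; set L := _ * _ in f'b; exists L.
have lt x y : x < y -> `|f x - f y| <= L * `|x - y|.
  move=> xy; have [|c _] := @MVT _ f f' x y xy (fun z _ => df z).
    by apply: derivable_within_continuous => z _; have [] := df z.
  by rewrite distrC [`|x - _|]distrC => ->; rewrite normrM ler_wpM2r.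
move=> x y; have [xy|xy|->] := ltgtP x y; first exact: lt.
  by rewrite distrC [`|x - _|]distrC; exact: lt.
by rewrite !subrr normr0 mulr0.
Qed.

(** Makes [2 - window_slope * x] fall from 1 at [2 pi / 3] to 0 at [4 pi / 3]. *)
Definition window_slope : R := 3 / (2 * pi).

(** A rising step times its mirror image is even without recourse to [|x|], hence smooth at 0; at
    every point one of the factors is 1. *)
Definition window x := step (window_slope * x + 2) * step (- window_slope * x + 2).

Lemma gbound_window : exists A, 0 <= A /\ forall n, gbound A n 2 1 window.
Proof.
have [A [A0 sA]] := @gbound_step R.
exists (`|window_slope| * A); split; first by rewrite mulr_ge0.
move=> n; rewrite -[X in gbound _ _ _ X _]mulr1 -[2%N]/(1 + 1)%N.
apply: gboundM; first exact: gbound_affine.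
by rewrite -normrN; exact: gbound_affine.
Qed.

Let slopeE x : window_slope * x = 3 * x / (2 * pi).
Proof. by rewrite /window_slope mulrAC. Qed.

Let p0 : 0 < 2 * pi :> R.
Proof. by rewrite mulr_gt0// pi_gt0. Qed.

Lemma even_window x : window (- x) = window x.
Proof. by rewrite /window mulrNN mulrN mulNr mulrC. Qed.

Lemma meyer_window_window : meyer_window window.
Proof.
split.
- move=> x; have /andP[a0 a1] := step_itv (window_slope * x + 2).
  have /andP[b0 b1] := step_itv (- window_slope * x + 2).
  by rewrite mulr_ge0//= mulr_ile1.
- have [A [_ /(_ 1%N) gw]] := gbound_window; exact: gbound_lipschitz gw.
- exact: even_window.
split.
- move=> x; rewrite ler_norml => /andP[h1 h2].
  have h : -1 <= window_slope * x <= 1.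
    rewrite slopeE ler_pdivlMr// ler_pdivrMr//; move: h1 h2.
    by move: pi => p h1 h2; apply/andP; split; lra.
  by rewrite /window !step_eq1 ?mulr1// ?mulNr; lra.
- move=> x h; wlog x0 : x h / 0 <= x => [H|].
    have [|xN] := leP 0 x; first exact: H.
    by rewrite -even_window; apply: H; rewrite ?normrN// oppr_ge0 ltW.
  rewrite /window [X in _ * X]step_eq0 ?mulr0//.
  suff : 2 <= window_slope * x by rewrite mulNr; lra.
  rewrite slopeE ler_pdivlMr//; move: h; rewrite ger0_norm//.
  by move: pi => p h; lra.
- move=> x /andP[x0 x1].
  have s0 : 0 <= window_slope * x by rewrite mulr_ge0// divr_ge0// ltW.
  (* With [s = window_slope * x], passing from [x] to [2 pi - x] replaces [2 - s] by [2 - (3 - s)],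
     which is [1 - (2 - s)]: Meyer's identity becomes [step_sqrD]. *)
  have sp : window_slope * (2 * pi) = 3 by rewrite divfK// gt_eqF.
  have s1 : window_slope * x <= 3.
    by rewrite -sp ler_wpM2l// divr_ge0// ltW.
  have -> : window x = step (- window_slope * x + 2).
    by rewrite /window [X in X * _]step_eq1 ?mul1r//; lra.
  have -> : window (2 * pi - x) = step (1 - (- window_slope * x + 2)).
    rewrite /window !mulrBr sp 2!mulNr sp [X in X * _]step_eq1 ?mul1r; last by lra.
    by congr step; lra.
  exact: step_sqrD.
Qed.

(** Translations do not change [A] and halving the argument halves it, so the same [A] serves all
    factors. *)
Lemma gbound_bell w A j C : 0 <= A -> (forall n, gbound A n j C w) ->
  forall n, gbound A n (j + j) (C * (C + C)) (bell w).
Proof.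
move=> A0 wA n.
have g2 : gbound A n j C (fun x => w (x / 2)).
  have := gbound_affine 2^-1 0 (wA n).
  have -> : (fun x => w (2^-1 * x + 0)) = (fun x => w (x / 2)).
    by apply/funext => x; rewrite addr0 mulrC.
  by apply: gbound_le; rewrite ?mulr_ge0// ler_piMl// ger0_norm// invf_le1// ler1n.
have gs c : gbound A n j C (fun x => w (x + c)).
  have := gbound_affine 1 c (wA n); rewrite normr1 mul1r.
  by under eq_fun do rewrite mul1r.
by apply: gboundM => //; apply: gboundD.
Qed.

(** The derivative 1/2 of the phase is a constant, bounded at level 2 with [D = 1]; [gbound_trig]
    then raises [A] by 1. *)
Lemma gbound_meyer_hat w A j C : 0 <= A -> (0 < j)%N ->
  (forall n, gbound A n j C w) ->
  forall n, gbound (A + 1) n (j + j) (C * (C + C)) (fRe (meyer_hat w)) /\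
            gbound (A + 1) n (j + j) (C * (C + C)) (fIm (meyer_hat w)).
Proof.
move=> A0 j0 wA n.
have dl x : is_derive x (1 : R) (fun t : R => 2^-1 * t) 2^-1.
  by apply: is_derive_eq; rewrite /GRing.scale/= mulr1.
have gl m : gbound A m 2 1 (cst 2^-1 : R -> R).
  by apply: gbound_cst => //; rewrite ger0_norm// invf_le1// ler1n.
have jj : (0 < j + j)%N by rewrite addn_gt0 j0.
have [hs hc] := gbound_trig A0 dl gl jj (gbound_bell A0 wA n).
have -> : fRe (meyer_hat w) = fun x => bell w x * cos (2^-1 * x).
  by apply/funext => x; rewrite /fRe cRe_realM.
have -> : fIm (meyer_hat w) = fun x => bell w x * sin (2^-1 * x).
  by apply/funext => x; rewrite /fIm cIm_realM.
by [].
Qed.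

Lemma compact_supp_meyer_hat w : meyer_window w ->
  compact (closure [set x | meyer_hat w x != 0]).
Proof.
move=> mw; pose K := [set` `[- (8 * pi / 3), 8 * pi / 3]] : set R.
have cK : compact K by exact: segment_compact.
apply: (subclosed_compact _ cK); first exact: closed_closure.
have -> : K = closure K by apply/closure_id; exact: interval_closed.
apply: closureS => x; rewrite /K /= in_itv/= -ler_norml leNgt => h.
by apply: contra h => /ltW h; rewrite /meyer_hat (bell_out mw h) mul0r.
Qed.

End SmoothWindow.

Theorem lemma3p3 (R : realType) (sigma : R) (hsigma : 1 < sigma) :
  exists psi : R -> R[i],
    [/\ orthonormal_wavelet psi,
        csmooth psi &
        exists psihat : R -> R[i],
          fourierL2 psi psihat /\
          (forall k : gevrey_type, gevreyDsigma k sigma psihat)].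
Proof.
have mw := @meyer_window_window R; have LG := LipC_meyer_hat mw.
exists (meyer_wavelet window); split.
- exact: orthonormal_meyer_wavelet.
- exact: csmooth_ifourier.
exists (meyer_hat window); split; first exact: fourierL2_ifourier.
move=> k tau tau0; split; last exact: compact_supp_meyer_hat.
have [A [A0 wA]] := @gbound_window R.
have gw := gbound_meyer_hat A0 (ltn0Sn 1) wA.
apply: (@gevreyE_gbound _ _ (A + 1) (1 * (1 + 1)) (2 + 2)) => //.
- by rewrite addr_ge0.
- by move=> n; have [] := gw n.
- by move=> n; have [] := gw n.
Qed.
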